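(* Let $d\ge 2$ and let $G$ be a subgroup of $\mathrm{Aut}(\mathcal T_d)$. (i) If $x=(x_0,x_1,\dots)\in\mathcal S(G)$ is normal, then $$\mathrm{sp}(x)=\overline{\bigcup_{n=0}^{+\infty}\mathrm{sp}(x_n)}.$$ (ii) Suppose $G$ is finitely generated. Then the equality $\mathrm{sp}(x)=\overline{\bigcup_{n=0}^{+\infty}\mathrm{sp}(x_n)}$ holds for every element $x\in\mathcal S(G)$ if and only if $G$ is virtually abelian.
   Context: Let $X=\{1,\dots,d\}$ and let $\mathcal T_d$ be the $d$-regular rooted tree, with vertex set $\mathcal T_d^0=X^*$ (finite words over $X$), root the empty word $\varnothing$, and each $w$ joined to its children $wx$, $x\in X$. $L_n=X^n$ is the $n$-th level. $\mathrm{Aut}(\mathcal T_d)$ is the group of automorphisms of the rooted tree. For a subgroup $G$ of $\mathrm{Aut}(\mathcal T_d)$, $\rho$ is the unitary representation of $G$ on $\ell^2(\mathcal T_d^0)$ given by $(\rho(g)\xi)(v)=\xi(g^{-1}v)$, extended linearly to the group algebra $\mathbb C G$; $C^*_\rho(G)=\overline{\rho(\mathbb C G)}$ is the norm closure in $\mathcal B(\ell^2(\mathcal T_d^0))$. Let $p_n$ be the orthogonal projection of $\ell^2(\mathcal T_d^0)$ onto $\ell^2(L_n)$. For $x\in C^*_\rho(G)$ put $x_n=p_nxp_n$, viewed as an operator on $\ell^2(L_n)$, and $\mathcal R_n(G)=p_nC^*_\rho(G)p_n\subset\mathcal B(\ell^2(L_n))$; $x\mapsto x_n$ is a surjective $*$-homomorphism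 $C^*_\rho(G)\to\mathcal R_n(G)$. There are surjective $*$-homomorphisms $q_n:\mathcal R_n(G)\to\mathcal R_{n-1}(G)$ ($n\ge 1$) with $q_n(x_n)=x_{n-1}$ for all $x\in C^*_\rho(G)$ (since the representation of $G$ on $\ell^2(L_{n-1})$ is contained in that on $\ell^2(L_n)$). $$\mathcal S(G)=\{(x_0,x_1,\dots)\mid x_n\in\mathcal R_n(G),\ q_{n+1}(x_{n+1})=x_n,\ \sup_n\|x_n\|<\infty\},$$ regarded as a $*$-subalgebra of $\mathcal B(\ell^2(\mathcal T_d^0))$ by letting $(x_n)_n$ act as the strongly convergent sum $\sum_{n\ge0}p_nx_np_n$. $\mathrm{sp}$ denotes the spectrum; $\mathrm{sp}(x_n)$ is the spectrum of $x_n$ as an operator on $\ell^2(L_n)$. A group is virtually abelian if it has an abelian subgroup of finite index. *)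

(* Defs.v *)
From HB Require Import structures.
From mathcomp Require Import all_boot all_order all_algebra.
From mathcomp Require Import complex.
From mathcomp Require Import all_classical all_reals all_analysis.
From mathcomp Require Import ring.
From mathcomp Require showcase.summability.

Set Implicit Arguments.
Unset Strict Implicit.
Unset Printing Implicit Defensive.

Import Order.TTheory GRing.Theory Num.Theory.
Import numFieldNormedType.Exports.

Local Open Scope classical_set_scope.
Local Open Scope ring_scope.
Local Open Scope complex_scope.

Section SquareSummable.
Variables (R : realType) (V : choiceType).
Implicit Types f g : V -> R[i].

Definition sqsum f : \bar R :=
  (\esum_(v in [set: V]) (Normc.normc (f v) ^+ 2)%:E)%E.

Definition square_summable : {pred V -> R[i]} :=
  fun f => `[< (sqsum f < +oo)%E >].

Lemma normc_ge0 (z : R[i]) : 0 <= Normc.normc z.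
Proof. by case: z => a b /=; exact: sqrtr_ge0. Qed.

Lemma sqsum_ge0 f : (0 <= sqsum f)%E.
Proof. by apply: esum_ge0 => v _; rewrite lee_fin sqr_ge0. Qed.

Lemma esum_le_scale (a b : V -> \bar R) (c : R) :
  0 <= c -> (forall v, 0 <= a v)%E -> (forall v, b v <= c%:E * a v)%E ->
  (\esum_(v in [set: V]) b v <= c%:E * \esum_(v in [set: V]) a v)%E.
Proof.
move=> c0 a0 ab; apply: ge_ereal_sup => _ [A [finA _] <-].
apply: (@le_trans _ _ (\sum_(v \in A) c%:E * a v)%E).
  by apply: lee_fsum.
rewrite -ge0_mule_fsumr//; apply: lee_wpmul2l; first by rewrite lee_fin.
by apply: ereal_sup_ubound; exists A.
Qed.

Lemma sqsumZD (a : R[i]) f g :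
  (sqsum (a *: f + g)%R <=
    (2 * Normc.normc a ^+ 2)%:E * sqsum f + 2%:E * sqsum g)%E.
Proof.
have nn (h : V -> R[i]) v : (0 <= (Normc.normc (h v) ^+ 2)%:E)%E.
  by rewrite lee_fin sqr_ge0.
pose F v := ((2 * Normc.normc a ^+ 2)%:E * (Normc.normc (f v) ^+ 2)%:E)%E.
pose H v := (2%:E * (Normc.normc (g v) ^+ 2)%:E)%E : \bar R.
have F0 v : (0 <= F v)%E.
  by rewrite mule_ge0 ?nn// lee_fin mulr_ge0 ?sqr_ge0.
have H0 v : (0 <= H v)%E by rewrite mule_ge0 ?nn// lee_fin.
apply: (@le_trans _ _ (\esum_(v in [set: V]) (F v + H v))%E).
  apply: le_esum => v _; rewrite /F /H -!EFinM -EFinD lee_fin.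
  have le1 := le_normcD (a * f v) (g v).
  apply: (@le_trans _ _
    ((Normc.normc (a * f v) + Normc.normc (g v)) ^+ 2)).
    by rewrite lerXn2r// nnegrE ?addr_ge0 ?normc_ge0.
  rewrite Normc.normcM -mulrA -exprMn.
  set p := _ * _; set q := Normc.normc (g v).
  rewrite -subr_ge0.
  have -> : 2 * p ^+ 2 + 2 * q ^+ 2 - (p + q) ^+ 2 = (p - q) ^+ 2 by ring.
  exact: sqr_ge0.
rewrite esumD//; apply: leeD; apply: esum_le_scale => //.
by rewrite mulr_ge0 ?sqr_ge0.
Qed.

Lemma square_summable_submod_closed : submod_closed square_summable.
Proof.
split.
  apply/asboolP; rewrite /sqsum esum1 ?ltry// => v _.
  by rewrite -[(0 : V -> R[i]) v]/(0 : R[i]) Normc.normc0 expr0n.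
move=> a f g /asboolP fP /asboolP gP; apply/asboolP.
apply: le_lt_trans (sqsumZD a f g) _.
by rewrite lte_add_pinfty//; apply: lte_mul_pinfty; rewrite ?lee_fin//
  mulr_ge0 ?sqr_ge0.
Qed.

HB.instance Definition _ :=
  GRing.isSubmodClosed.Build _ _ square_summable square_summable_submod_closed.

(* The Hilbert space l^2(V), as a subspace of the functions V -> R[i]. *)
Record l2 : Type := L2 { l2val :> V -> R[i]; l2valP : l2val \in square_summable }.

HB.instance Definition _ := [isSub for l2val].
HB.instance Definition _ := [Choice of l2 by <:].
HB.instance Definition _ := [SubChoice_isSubLmodule of l2 by <:].

Definition l2norm (xi : l2) : R := Num.sqrt (fine (sqsum xi)).

(* Linear in xi; the sum over V is the unconditional one, along finite subsets. *)
Definition inner (xi eta : l2) : R[i] :=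
  summability.sum (fun v => xi v * (eta v)^* : R[i]^o).

End SquareSummable.

Section Operators.
Variables (R : realType).

Definition opnorm (V W : choiceType) (T : l2 R V -> l2 R W) : \bar R :=
  ereal_sup [set (l2norm (T xi))%:E | xi in [set xi | l2norm xi <= 1]].

(* B(l^2(V)). *)
Definition bounded_op (V : choiceType) : set (l2 R V -> l2 R V) :=
  [set T | linear T /\ (opnorm T < +oo)%E].

Definition spectrum (V : choiceType) (T : l2 R V -> l2 R V) : set R[i] :=
  [set z | ~ exists S, [/\ bounded_op S,
      S \o (T - z *: idfun) = idfun & (T - z *: idfun) \o S = idfun]].

Definition adjoint (V : choiceType) (T S : l2 R V -> l2 R V) : Prop :=
  forall xi eta, inner (T xi) eta = inner xi (S eta).

(* S is the adjoint of T, so this is T T^* = T^* T. *)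
Definition normal_op (V : choiceType) (T : l2 R V -> l2 R V) : Prop :=
  exists S, [/\ bounded_op S, adjoint T S & T \o S = S \o T].

End Operators.

Section TreeAutomorphisms.
Variable d : nat.

Definition word : choiceType := seq 'I_d.

Definition level (n : nat) : finType := n.-tuple 'I_d.

(* Letters are appended on the right: the children of v are the words vx. *)
Definition child (v w : word) : Prop := exists x : 'I_d, w = rcons v x.

Definition adjacent (v w : word) : Prop := child v w \/ child w v.

Record tree_aut : Type := TreeAut {
  aut_fun :> word -> word;
  aut_inv : word -> word;
  aut_funK : cancel aut_fun aut_inv;
  aut_invK : cancel aut_inv aut_fun;
  aut_root : aut_fun [::] = [::];
  aut_adj : forall v w, adjacent (aut_fun v) (aut_fun w) <-> adjacent v w }.

HB.instance Definition _ := gen_eqMixin tree_aut.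
HB.instance Definition _ := gen_choiceMixin tree_aut.

Lemma tree_aut_eq (g h : tree_aut) : aut_fun g =1 aut_fun h -> g = h.
Proof.
case: g h => [f fi fK fiK fr fa] [k ki kK kiK kr ka] /= /funext fk.
subst k; have fiki : fi = ki.
  by apply/funext => v; rewrite -{1}(kiK v) fK.
by subst ki; congr TreeAut; apply: Prop_irrelevance.
Qed.

Fact aut_one_adj (v w : word) : adjacent (id v) (id w) <-> adjacent v w.
Proof. by []. Qed.

Definition aut_one : tree_aut :=
  @TreeAut id id (fun=> erefl) (fun=> erefl) erefl aut_one_adj.

Fact aut_mul_root (g h : tree_aut) : (g \o h) [::] = [::].
Proof. by rewrite /= !aut_root. Qed.

Fact aut_mul_adj (g h : tree_aut) v w :
  adjacent ((g \o h) v) ((g \o h) w) <-> adjacent v w.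
Proof. by rewrite /= !aut_adj. Qed.

Definition aut_mul (g h : tree_aut) : tree_aut :=
  TreeAut (can_comp (@aut_funK g) (@aut_funK h))
    (can_comp (@aut_invK h) (@aut_invK g)) (aut_mul_root g h) (@aut_mul_adj g h).

Fact aut_inv_root (g : tree_aut) : aut_inv g [::] = [::].
Proof. by rewrite -[in LHS](aut_root g) aut_funK. Qed.

Fact aut_inv_adj (g : tree_aut) v w :
  adjacent (aut_inv g v) (aut_inv g w) <-> adjacent v w.
Proof. by rewrite -(aut_adj g) !aut_invK. Qed.

Definition aut_inverse (g : tree_aut) : tree_aut :=
  TreeAut (@aut_invK g) (@aut_funK g) (aut_inv_root g) (@aut_inv_adj g).

Fact aut_mulA : associative aut_mul.
Proof. by move=> g h k; apply: tree_aut_eq. Qed.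
Fact aut_mul1g : left_id aut_one aut_mul.
Proof. by move=> g; apply: tree_aut_eq. Qed.
Fact aut_mulg1 : right_id aut_one aut_mul.
Proof. by move=> g; apply: tree_aut_eq. Qed.
Fact aut_mulVg : left_inverse aut_one aut_inverse aut_mul.
Proof. by move=> g; apply: tree_aut_eq => v /=; rewrite aut_funK. Qed.
Fact aut_mulgV : right_inverse aut_one aut_inverse aut_mul.
Proof. by move=> g; apply: tree_aut_eq => v /=; rewrite aut_invK. Qed.

HB.instance Definition _ := isGroup.Build tree_aut
  aut_mulA aut_mul1g aut_mulg1 aut_mulVg aut_mulgV.

End TreeAutomorphisms.

Section AbstractGroups.
Variable gT : groupType.
Implicit Types G H A : set gT.

Definition subgroup G : Prop :=
  [/\ G 1%g, forall g h, G g -> G h -> G (g * h)%g & forall g, G g -> G g^-1%g].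

(* G is the least subgroup containing a finite list of its elements. *)
Definition finitely_generated G : Prop :=
  exists s : seq gT, [set` s] `<=` G /\
    forall H, subgroup H -> [set` s] `<=` H -> G `<=` H.

(* Finite index: there are finitely many left cosets g A with g in G. *)
Definition virtually_abelian G : Prop :=
  exists A, [/\ subgroup A, A `<=` G,
    forall a b, A a -> A b -> commute a b &
    finite_set [set [set (g * a)%g | a in A] | g in G]].

End AbstractGroups.

Section Representation.
Variables (R : realType) (d : nat).

Fact rho_subproof (g : tree_aut d) (xi : l2 R (word d)) :
  (fun v => xi ((g^-1)%g v)) \in @square_summable R (word d).
Proof.
apply/asboolP; have /asboolP := l2valP xi; congr (_ < _)%E.
rewrite /sqsum (reindex_esum setT setT (fun v => (g^-1)%g v))//.
split=> // [v w _ _|v _]; first exact: (can_inj (@aut_funK _ g^-1%g)).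
by exists (g v) => //=; rewrite aut_funK.
Qed.

Definition rho (g : tree_aut d) (xi : l2 R (word d)) : l2 R (word d) :=
  L2 (rho_subproof g xi).

Variable G : set (tree_aut d).

(* The operators rho(sum_i c_i g_i) = sum_i c_i rho(g_i), with g_i in G. *)
Definition group_algebra_image : set (l2 R (word d) -> l2 R (word d)) :=
  [set T | exists s : seq (R[i] * tree_aut d),
    (forall p, p \in s -> G p.2) /\ T = \sum_(p <- s) p.1 *: rho p.2].

(* Closure of the image of the group algebra for the operator norm. *)
Definition Cstar : set (l2 R (word d) -> l2 R (word d)) :=
  [set T : l2 R (word d) -> l2 R (word d) | bounded_op T /\
    forall e : R, 0 < e ->
      exists2 S, group_algebra_image S & (opnorm (T - S)%R < e%:E)%E].

Lemma word_val_inj n : set_inj setT (fun t : level d n => val t : word d).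
Proof. by move=> s t _ _; exact: val_inj. Qed.

Lemma sqsum_extend n (f : level d n -> R[i]) :
  sqsum (fun v : word d => if insub v is Some t then f t else 0) = sqsum f.
Proof.
pose F v : \bar R :=
  (Normc.normc (if insub v is Some t then f t else 0) ^+ 2)%:E.
have -> : sqsum f = (\esum_(t in [set: level d n]) F (val t))%E.
  by apply: eq_esum => t _; rewrite /F valK.
rewrite -(esum_image setT _ F (@word_val_inj n)) esum_mkcond.
apply: eq_esum => v _; case: ifPn => // /negP vn; rewrite insubF; last first.
  by apply: contra_notF vn => sv; rewrite inE; exists (Tuple sv).
by rewrite Normc.normc0 expr0n.
Qed.

Fact level_inj_subproof n (xi : l2 R (level d n)) :
  (fun v : word d => if insub v is Some t then xi t else 0)
    \in @square_summable R (word d).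
Proof. by apply/asboolP; rewrite sqsum_extend; exact/asboolP/l2valP. Qed.

(* level_inj n is the inclusion of l^2(L_n) in l^2 of the tree (extension by 0)
   and level_proj n the projection p_n, seen as a map onto l^2(L_n). *)
Definition level_inj n (xi : l2 R (level d n)) : l2 R (word d) :=
  L2 (level_inj_subproof xi).

Fact level_proj_subproof n (xi : l2 R (word d)) :
  (fun t : level d n => xi (val t)) \in @square_summable R (level d n).
Proof.
apply/asboolP; have /asboolP := l2valP xi; apply: le_lt_trans.
rewrite /sqsum -(esum_image setT _
  (fun v => (Normc.normc (xi v) ^+ 2)%:E) (@word_val_inj n)) esum_mkcond.
by apply: le_esum => v _; case: ifP => // _; rewrite lee_fin sqr_ge0.
Qed.

Definition level_proj n (xi : l2 R (word d)) : l2 R (level d n) :=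
  L2 (level_proj_subproof n xi).

Definition compress n (T : l2 R (word d) -> l2 R (word d)) :
    l2 R (level d n) -> l2 R (level d n) :=
  level_proj n \o T \o @level_inj n.

Arguments compress n T : clear implicits.

(* R_n(G) = p_n C^*_rho(G) p_n. *)
Definition Ralg n : set (l2 R (level d n) -> l2 R (level d n)) :=
  compress n @` Cstar.

(* q_graph a b means q_{n+1}(a) = b, for the map q_{n+1} from R_{n+1}(G) to
   R_n(G) that sends p_{n+1} T p_{n+1} to p_n T p_n for every T in C^*_rho(G).
   It is single-valued by q_graph_functional below. *)
Definition q_graph n (a : l2 R (level d n.+1) -> l2 R (level d n.+1))
    (b : l2 R (level d n) -> l2 R (level d n)) : Prop :=
  exists T, [/\ Cstar T, compress n.+1 T = a & compress n T = b].

Definition level_ops : Type := forall n, l2 R (level d n) -> l2 R (level d n).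

(* S(G), as a set of sequences (x_0, x_1, ...). *)
Definition Salg : set level_ops :=
  [set x : level_ops | [/\ forall n, Ralg (x n), forall n, q_graph (x n.+1) (x n) &
    (ereal_sup (range (fun n => opnorm (x n))) < +oo)%E]].

(* The operator on l^2 of the tree defined by a sequence (x_n): the sum of the
   p_n x_n p_n in the strong operator topology, i.e. for every xi the limit in
   norm of the partial sums applied to xi. The limit exists for every sequence
   in S(G) by strong_sum_cvg below; the default value 0 is then not used. *)
Definition strong_sum (x : level_ops) (xi : l2 R (word d)) : l2 R (word d) :=
  xget 0 [set eta |
    (fun N => l2norm (eta -
      \sum_(n < N) level_inj (x n (level_proj n xi)))) @ \oo --> (0 : R)].

End Representation.

Arguments compress {R d} n T _.

Section NormFacts.
Variables (R : realType) (V : choiceType).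
Implicit Types (xi eta : l2 R V).

Lemma sqsum_fin xi : sqsum xi \is a fin_num.
Proof. by rewrite ge0_fin_numE ?sqsum_ge0//; exact/asboolP/l2valP. Qed.

Lemma l2norm_ge0 xi : 0 <= l2norm xi.
Proof. exact: sqrtr_ge0. Qed.

Lemma l2norm_sqr xi : l2norm xi ^+ 2 = fine (sqsum xi).
Proof. by rewrite sqr_sqrtr// fine_ge0// sqsum_ge0. Qed.

Lemma normc_le_l2norm xi v : Normc.normc (xi v) <= l2norm xi.
Proof.
rewrite -(@ler_pXn2r _ 2)// ?nnegrE ?normc_ge0 ?l2norm_ge0//.
rewrite l2norm_sqr -lee_fin fineK ?sqsum_fin//.
rewrite -(@esum_set1 _ _ v (fun w => (Normc.normc (xi w) ^+ 2)%:E)); last first.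
  by rewrite lee_fin sqr_ge0.
rewrite esum_mkcond; apply: le_esum => w _.
by case: ifP => _; rewrite ?lexx ?lee_fin ?sqr_ge0.
Qed.

Lemma l2norm_eq0 xi : l2norm xi = 0 -> xi = 0.
Proof.
move=> xi0; apply: val_inj; apply/funext => v; apply: Normc.eq0_normc.
by apply/eqP; rewrite eq_le normc_ge0 andbT -xi0 normc_le_l2norm.
Qed.

End NormFacts.

Section BoundFacts.
Variables (R : realType) (V : choiceType).
Implicit Types (xi eta : l2 R V).

Lemma l2norm_le (U : choiceType) xi (zeta : l2 R U) (c : R) : 0 <= c ->
  (sqsum xi <= (c ^+ 2)%:E * sqsum zeta)%E -> l2norm xi <= c * l2norm zeta.
Proof.
move=> c0 le; rewrite -(@ler_pXn2r _ 2)// ?nnegrE ?mulr_ge0 ?l2norm_ge0//.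
by rewrite exprMn !l2norm_sqr -lee_fin EFinM !fineK ?sqsum_fin.
Qed.

Lemma l2normZ_le (a : R[i]) xi : l2norm (a *: xi) <= Normc.normc a * l2norm xi.
Proof.
apply: l2norm_le; first exact: normc_ge0.
apply: esum_le_scale => [|v|v]; rewrite ?sqr_ge0// ?lee_fin ?sqr_ge0//.
by rewrite -exprMn -Normc.normcM.
Qed.

End BoundFacts.

Section OpnormFacts.
Variables (R : realType) (V W : choiceType).
Implicit Types (xi eta : l2 R V).

Lemma opnorm_bound (T : l2 R V -> l2 R W) (M : R) xi : linear T -> 0 <= M ->
  (opnorm T <= M%:E)%E -> l2norm (T xi) <= M * l2norm xi.
Proof.
move=> linT M0 TM; have TZ a eta : T (a *: eta) = a *: T eta.
  have T0 : T 0 = 0.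
    have := linT 1 0 0; rewrite !scale1r add0r => /eqP.
    by rewrite -subr_eq subrr => /eqP.
  by have := linT a eta 0; rewrite T0 !addr0.
have [xi0|xi0] := eqVneq (l2norm xi) 0.
  rewrite (l2norm_eq0 xi0) -[in T _](scale0r (0 : l2 R V)) TZ scale0r.
  have -> : l2norm (0 : l2 R W) = 0.
    rewrite /l2norm /sqsum esum1 ?sqrtr0// => v _.
    by rewrite -[(_ : l2 R W) v]/(0 : R[i]) Normc.normc0 expr0n.
  by rewrite mulr_ge0 ?l2norm_ge0.
have xigt0 : 0 < l2norm xi by rewrite lt_def xi0 l2norm_ge0.
have ncR (r : R) : 0 <= r -> Normc.normc r%:C = r.
  by move=> r0; rewrite /= expr0n addr0 sqrtr_sqr ger0_norm.
pose eta := ((l2norm xi)^-1)%:C *: xi.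
have eta1 : l2norm eta <= 1.
  apply: le_trans (l2normZ_le _ _) _.
  by rewrite ncR ?invr_ge0 ?l2norm_ge0// mulVf.
have -> : T xi = (l2norm xi)%:C *: T eta.
  by rewrite -TZ scalerA -rmorphM /= mulfV// rmorph1 scale1r.
have Teta : l2norm (T eta) <= M.
  by rewrite -lee_fin; apply: le_trans TM; apply: ereal_sup_ubound; exists eta.
apply: le_trans (l2normZ_le _ _) _; rewrite ncR ?l2norm_ge0// mulrC.
by rewrite ler_wpM2r ?l2norm_ge0.
Qed.
End OpnormFacts.

Section QuotientMaps.
Variables (R : realType) (d : nat).
Implicit Types (g : tree_aut d) (G : set (tree_aut d)).

Lemma aut_rcons g (v : word d) (x : 'I_d) : exists y, g (rcons v x) = rcons (g v) y.
Proof.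
elim/last_ind: v x => [|v z IH] x.
  have [//|[y]] : adjacent (g [::]) (g (rcons [::] x)).
    by apply/aut_adj; left; exists x.
  by rewrite aut_root => /(congr1 size); rewrite size_rcons.
have [//|[y]] : adjacent (g (rcons v z)) (g (rcons (rcons v z) x)).
  by apply/aut_adj; left; exists x.
have [t ->] := IH z => /rcons_inj[gv _].
have /(congr1 size) := can_inj (@aut_funK _ g) gv.
by rewrite !size_rcons => /eqP; rewrite -[X in X == _]addn0 -addn2 eqn_add2l.
Qed.

Lemma size_aut g (v : word d) : size (g v) = size v.
Proof.
elim/last_ind: v => [|v x IH]; first by rewrite aut_root.
by have [y ->] := aut_rcons g v x; rewrite !size_rcons IH.
Qed.

Lemma linear_rho g : linear (@rho R d g).
Proof. by move=> a xi eta; apply: val_inj. Qed.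

Lemma group_algebra_ind G (P : (l2 R (word d) -> l2 R (word d)) -> Prop) :
  P 0 -> (forall c g T, P T -> P (c *: @rho R d g + T)) ->
  forall T, group_algebra_image G T -> P T.
Proof.
move=> P0 PD T [s [_ ->]]; elim: s => [|p s IH]; first by rewrite big_nil.
by rewrite big_cons; exact: PD.
Qed.

Lemma linear_group_algebra G T : @group_algebra_image R d G T -> linear T.
Proof.
move: T; apply: group_algebra_ind => [a xi eta|c g T linT a xi eta].
  by rewrite -[LHS]/(0 : l2 _ _) -[RHS]/(a *: (0 : l2 _ _) + 0)
    scaler0 addr0.
rewrite -[LHS]/(c *: rho g (a *: xi + eta) + T (a *: xi + eta)).
rewrite -[in RHS]/(a *: (c *: rho g xi + T xi) + (c *: rho g eta + T eta)).
by rewrite linT linear_rho !scalerDr !scalerA (mulrC c) addrACA.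
Qed.

Lemma fin_square_summable (I : finType) (f : I -> R[i]) :
  f \in @square_summable R I.
Proof.
have finI : finite_set [set: I] by exact: finite_finset.
apply/asboolP; rewrite /sqsum esum_fset//.
  by rewrite fsbig_finite//=; apply: lte_sum_pinfty => i _; rewrite ltry.
by move=> i _; rewrite lee_fin sqr_ge0.
Qed.

Definition lift_level n (eta : l2 R (level d n)) : l2 R (level d n.+1) :=
  L2 (fin_square_summable
    (fun t : level d n.+1 => level_inj eta (take n (val t)))).

Lemma level_inj_lift n (eta : l2 R (level d n)) (w : word d) x :
  level_inj (lift_level eta) (rcons w x) = level_inj eta w.
Proof.
rewrite /= ; case: insubP => [t _ tw|].
  have sw : size w = n.
    by have := size_tuple t; rewrite tw size_rcons => -[].
  have -> : take n (val t) = w by rewrite tw -cats1 take_size_cat.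
  by [].
rewrite size_rcons eqSS => sw.
by rewrite insubF//; exact/negbTE.
Qed.

Lemma group_algebra_lift G T n (eta : l2 R (level d n)) (w : word d) x :
  group_algebra_image G T ->
  T (level_inj (lift_level eta)) (rcons w x) = T (level_inj eta) w.
Proof.
move: T; apply: group_algebra_ind => [//|c g T IH].
rewrite -[LHS]/(c * level_inj (lift_level eta) (g^-1 (rcons w x))%g +
  T (level_inj (lift_level eta)) (rcons w x)).
rewrite -[RHS]/(c * level_inj eta (g^-1 w)%g + T (level_inj eta) w).
by have [y ->] := aut_rcons (g^-1)%g w x; rewrite level_inj_lift IH.
Qed.

Lemma Cstar_approx G T (xi zeta : l2 R (word d)) (e : R) : Cstar G T -> 0 < e ->
  exists S, [/\ group_algebra_image G S, l2norm (T xi - S xi) <= e &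
    l2norm (T zeta - S zeta) <= e].
Proof.
move=> [[linT _] apT] e0.
pose c := l2norm xi + l2norm zeta + 1.
have c0 : 0 < c by rewrite ltr_wpDl ?addr_ge0 ?l2norm_ge0.
have [S GS TS] := apT (e / c) (divr_gt0 e0 c0); exists S.
have linTS : linear (T - S).
  move=> a u v; have linS := linear_group_algebra GS.
  rewrite -[LHS]/(T (a *: u + v) - S (a *: u + v)).
  rewrite -[in RHS]/(a *: (T u - S u) + (T v - S v)).
  by rewrite linT linS scalerBr opprD addrACA.
have ec u : l2norm u <= c -> l2norm (T u - S u) <= e.
  move=> uc; apply: le_trans (opnorm_bound u linTS _ (ltW TS)) _.
    by rewrite divr_ge0 ?ltW.
  rewrite -[leRHS]mulr1 -mulrA; apply: ler_wpM2l; first exact: ltW.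
  by rewrite mulrC ler_pdivrMr// mul1r.
by split=> //; apply: ec; rewrite /c -?addrA ?lerDl ?addr_ge0 ?l2norm_ge0//
  addrCA lerDl addr_ge0 ?l2norm_ge0.
Qed.

Lemma Cstar_lift G T n (eta : l2 R (level d n)) (w : word d) x : Cstar G T ->
  T (level_inj (lift_level eta)) (rcons w x) = T (level_inj eta) w.
Proof.
move=> GT; apply/eqP; rewrite -subr_eq0; apply/eqP/Normc.eq0_normc/eqP.
rewrite eq_le normc_ge0 andbT; apply/ler_addgt0Pr => e e0; rewrite add0r.
have [S [GS S1 S2]] := Cstar_approx
  (level_inj (lift_level eta)) (level_inj eta) GT (divr_gt0 e0 (ltr0Sn R 1)).
set a := T _ _; set b := T _ _.
pose s := S (level_inj eta) w.
have -> : a - b = (a - s) + - (b - s) by rewrite opprB addrA subrK.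
apply: le_trans (le_normcD _ _) _; rewrite normcN (splitr e).
apply: lerD; last exact: le_trans (normc_le_l2norm _ w) S2.
rewrite /s -(group_algebra_lift eta w x GS).
exact: le_trans (normc_le_l2norm _ (rcons w x)) S1.
Qed.

Lemma q_graph_functional G n a b b' : (0 < d)%N ->
  @q_graph R d G n a b -> q_graph G a b' -> b = b'.
Proof.
move=> d0 [T [GT Ta <-]] [S [GS Sa <-]]; apply/funext => eta.
apply: val_inj; apply/funext => w; pose x : 'I_d := Ordinal d0.
have sw : size (rcons (val w) x) == n.+1 by rewrite size_rcons size_tuple.
transitivity (compress n.+1 T (lift_level eta) (Tuple sw)).
  by symmetry; exact: (Cstar_lift eta (val w) x GT).
by rewrite Ta -Sa; exact: (Cstar_lift eta (val w) x GS).
Qed.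

End QuotientMaps.

Section StrongSum.
Variables (R : realType) (d : nat).

Lemma sqsum_levels (f : word d -> R[i]) :
  sqsum f = (\sum_(n <oo) sqsum (fun t : level d n => f (val t)))%E.
Proof.
pose F (v : word d) : \bar R := (Normc.normc (f v) ^+ 2)%:E.
have F0 v : (0 <= F v)%E by rewrite lee_fin sqr_ge0.
pose L n : set (word d) := (fun t : level d n => val t : word d) @` setT.
have LE n v : L n v -> size v = n by case=> t _ <-; exact: size_tuple.
have tL : trivIset setT L.
  by move=> m n _ _ [v [/LE <- /LE <-]].
have -> : sqsum f = (\esum_(v in \bigcup_n L n) F v)%E.
  congr esum; apply/esym/seteqP; split=> // v _.
  by exists (size v) => //; exists (in_tuple v).
rewrite nneseries_sum_bigcup//; apply: eq_eseriesr => n _.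
by rewrite /L (esum_image _ _ F)//; exact: word_val_inj.
Qed.

Lemma sum_level_inj (y : forall n, l2 R (level d n)) N (v : word d) :
  (\sum_(n < N) level_inj (y n)) v =
    if (size v < N)%N then y (size v) (in_tuple v) else 0.
Proof.
elim: N => [|N IH]; first by rewrite big_ord0.
rewrite big_ord_recr /= -[LHS]/((\sum_(n < N) level_inj (y n)) v +
  level_inj (y N) v) IH ltnS /=.
case: insubP => [t /eqP sv tv|svN].
  move: t tv; rewrite -sv => t tv; rewrite ltnn leqnn add0r.
  by congr (l2val _ _); apply: val_inj.
by rewrite addr0 [(size v <= N)%N]leq_eqVlt; move/eqP: svN => svN; case: eqP.
Qed.

Lemma linear_Ralg G n a : @Ralg R d G n a -> linear a.
Proof.
case=> T [[linT _] _] <- c xi eta; apply: val_inj.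
rewrite /compress /=; apply/funext => t /=.
rewrite -[RHS]/((c *: T (level_inj xi) + T (level_inj eta)) (val t)) -linT.
congr (l2val (T _) _); apply: val_inj; apply/funext => v /=.
rewrite -[RHS]/(c * level_inj xi v + level_inj eta v) /=.
by case: insub => //; rewrite mulr0 addr0.
Qed.

Lemma strong_sum_cvg G (x : level_ops R d) (xi : l2 R (word d)) : Salg G x ->
  (fun N => l2norm (strong_sum x xi -
    \sum_(n < N) level_inj (x n (level_proj n xi)))) @ \oo --> (0 : R).
Proof.
case=> Rx _ supx; apply: (xgetPex (0 : l2 R (word d)) (P := [set eta |
  (fun N => l2norm (eta - \sum_(n < N) level_inj (x n (level_proj n xi))))
    @ \oo --> (0 : R)])).
have [M M0 xM] : exists2 M : R, 0 <= M & forall n, (opnorm (x n) <= M%:E)%E.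
  exists (fine (maxe 0%E (ereal_sup (range (fun n => opnorm (x n)))))).
    by rewrite fine_ge0// le_max lexx.
  move=> n; rewrite fineK; last first.
    by rewrite ge0_fin_numE ?le_max ?lexx// gt_max ltry.
  by rewrite le_max; apply/orP; right; apply: ereal_sup_ubound; exists n.
pose c n := sqsum (x n (level_proj n xi)).
have c0 n : (0 <= c n)%E by exact: sqsum_ge0.
pose f (v : word d) : R[i] :=
  x (size v) (level_proj (size v) xi) (in_tuple v).
have fE n (t : level d n) : f (val t) = x n (level_proj n xi) t.
  case: t => s sn /=; rewrite /f; move: (sn); rewrite -(eqP sn) => sn'.
  by congr (l2val _ _); exact: val_inj.
have sqf : (sqsum f = \sum_(n <oo) c n)%E.
  by rewrite sqsum_levels; apply: eq_eseriesr => n _; congr sqsum; apply/funext.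
have cM n : (c n <= (M ^+ 2)%:E * sqsum (level_proj n xi))%E.
  have := opnorm_bound (level_proj n xi) (linear_Ralg (Rx n)) M0 (xM n).
  rewrite -(@ler_pXn2r _ 2)// ?nnegrE ?mulr_ge0 ?l2norm_ge0//.
  by rewrite exprMn !l2norm_sqr -lee_fin EFinM !fineK ?sqsum_fin.
have ssc : (\sum_(n <oo) c n < +oo)%E.
  apply: (@le_lt_trans _ _ ((M ^+ 2)%:E * sqsum xi)%E).
    rewrite (sqsum_levels xi) -nneseriesZl//; last by move=> n _; exact: sqsum_ge0.
    by apply: lee_nneseries => // n _; exact: cM.
  by rewrite lte_mul_pinfty ?lee_fin ?sqr_ge0//; exact/asboolP/l2valP.
have fP : f \in @square_summable R (word d) by apply/asboolP; rewrite sqf.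
exists (L2 fP) => /=.
have rE N (v : word d) :
    (L2 fP - \sum_(n < N) level_inj (x n (level_proj n xi))) v =
    if (size v < N)%N then 0 else f v.
  rewrite -[LHS]/(f v - (\sum_(n < N) level_inj (x n (level_proj n xi))) v).
  by rewrite (sum_level_inj (fun n => x n (level_proj n xi))); case: ifP => _; rewrite ?subr0// subrr.
have tail N : sqsum (L2 fP - \sum_(n < N) level_inj (x n (level_proj n xi))) =
    (\sum_(N <= n <oo) c n)%E.
  rewrite sqsum_levels [RHS]eseries_cond [RHS]eseries_mkcond.
  apply: eq_eseriesr => n _ /=; case: ifPn => Nn; rewrite /c /sqsum.
    apply: eq_esum => t _; congr ((Normc.normc _ ^+ 2)%:E).
    by apply: etrans (rE N (val t)) _; rewrite size_tuple ltnNge Nn /= fE.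
  rewrite esum1// => t _.
  rewrite [X in Normc.normc X](_ : _ = 0) ?Normc.normc0 ?expr0n//.
  by apply: etrans (rE N (val t)) _; rewrite size_tuple ltnNge Nn.
rewrite -sqrtr0; apply: (@continuous_cvg _ _ _ _ _ _ (@Num.sqrt R)).
  exact: sqrt_continuous.
apply: fine_cvg; rewrite (_ : (0 : R)%:E = 0%E)//.
under eq_fun do rewrite tail.
by apply: nneseries_tail_cvg.
Qed.
End StrongSum.

(* Main.v *)
Require Import Defs.
From HB Require Import structures.
From mathcomp Require Import all_boot all_order all_algebra.
From mathcomp Require Import complex.
From mathcomp Require Import all_classical all_reals all_analysis.
From mathcomp Require Import ring lra zify.

(* On row vectors of level n, G acts by unitary permutation matrices, and an
   element x of S(G) acts on l^2 of the tree as the block diagonal operator with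
   blocks x_n.  An eigenvalue of x_n is in sp(x), sp(x) is closed, and z is not in
   sp(x) as soon as |v| <= c |v (x_n - z)| for all n and v with c independent of n.
   If U is x_n-stable of dimension at most m, such a bound holds on U with c
   depending only on m, |x| and the distance of z to the eigenvalues; it passes to
   orthogonal sums of stable subspaces.  So equality holds whenever each level is an
   orthogonal sum of stable subspaces of bounded dimension: eigenvectors shared by
   x_n and its adjoint if x is normal (m = 1); the spans of the G-translates of
   eigenvectors shared by an abelian subgroup of index m if G is virtually abelian.

   Conversely, suppose first that the irreducible constituents of all levels have
   degree at most k.  By Jordan's theorem on finite linear groups each of them is
   commutative on a subgroup of index at most N(k).  As G is finitely generated, the
   intersection of all subgroups of index at most N(k) has finite index; it is
   abelian because it commutes on every level.  Otherwise there are irreducible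
   constituents s_k of strictly increasing degrees D_k.  Schur orthogonality gives
   elements of the group algebra acting as a nilpotent Jordan block of size D_k on
   the copies of s_k and as 0 elsewhere.  Their sum over k is an x in S(G) with
   sp(x_n) = {0} for all n, but 1/2 is in sp(x) since the norm of the inverse of
   J - 1/2 grows with the size of the Jordan block J. *)

Import Order.TTheory GRing.Theory Num.Theory.
Import numFieldNormedType.Exports.

Local Open Scope classical_set_scope.
Local Open Scope ring_scope.

Set Implicit Arguments.
Unset Strict Implicit.
Unset Printing Implicit Defensive.

(** * Orthogonal sums of stable subspaces *)

Section HermitianSpace.
Local Open Scope sesquilinear_scope.
Context {C : numClosedFieldType}.
Implicit Types (n : nat).

Notation "U ^!" := (orthomx Num.conj (mx_of_hermitian (hermitian1mx _)) U)
  : matrix_set_scope.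

Definition sqn n (v : 'rV[C]_n) : C := dotmx v v.

Lemma sqnE n (v : 'rV[C]_n) : sqn v = \sum_i `|v 0 i| ^+ 2.
Proof.
rewrite /sqn dotmxE !mxE; apply: eq_bigr => i _.
by rewrite !mxE normCK.
Qed.

Lemma sqn_ge0 n (v : 'rV[C]_n) : 0 <= sqn v.
Proof. exact: dnorm_ge0. Qed.

Lemma sqn_eq0 n (v : 'rV[C]_n) : (sqn v == 0) = (v == 0).
Proof. exact: dnorm_eq0. Qed.

Lemma sqn0 n : sqn (0 : 'rV[C]_n) = 0.
Proof. by apply/eqP; rewrite sqn_eq0. Qed.

Lemma sqnZ n a (v : 'rV[C]_n) : sqn (a *: v) = `|a| ^+ 2 * sqn v.
Proof. exact: dnormZ. Qed.

Lemma sqn_add_le n (u v : 'rV[C]_n) : sqn (u + v) <= 2 * sqn u + 2 * sqn v.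
Proof.
have par : sqn (u + v) + sqn (u - v) = 2 * sqn u + 2 * sqn v.
  by rewrite /sqn dnormD dnormB; ring.
by rewrite -par lerDl sqn_ge0.
Qed.

Lemma sqn_ortho n (U V : 'M[C]_n) (u v : 'rV[C]_n) :
  (U <= V^!)%MS -> (u <= U)%MS -> (v <= V)%MS -> sqn (u + v) = sqn u + sqn v.
Proof.
move=> UV uU vV; suff uv0 : dotmx u v = 0 by exact: hnormDd.
rewrite dotmxE; suff /orthomx1P -> : (u <= v^!)%MS by rewrite mxE.
by rewrite orthomx_sym (submx_trans vV)// orthomx_sym (submx_trans uU).
Qed.

Lemma dotmx_sqr_le n (u v : 'rV[C]_n) : `|dotmx u v| ^+ 2 <= sqn u * sqn v.
Proof. exact: (CauchySchwarz (@dotmx C n)). Qed.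

(** In a row basis of [U], the restriction of [B] is a square matrix of positive size over a closed
    field; an eigenvector of it is carried back to [U]. *)
Lemma stable_eigen n (U B : 'M[C]_n) : stablemx U B -> U != 0 ->
  exists l (v : 'rV_n), [/\ v != 0, (v <= U)%MS & v *m B = l *: v].
Proof.
move=> sU U0; have rU : (0 < \rank U)%N by rewrite lt0n mxrank_eq0.
have [l /eigenvalueP[v vl v0]] := eigenvalue_closed (restrictmx U B) rU.
exists l, (v *m row_base U); split.
- by rewrite mulmx_free_eq0 ?row_base_free.
- by rewrite mulmx_sub// eq_row_base.
have sb : (row_base U *m B <= row_base U)%MS by rewrite stablemx_row_base.
rewrite -mulmxA -(mulmxKpV sb) mulmxA -[_ *m B *m _]/(conjmx (row_base U) B).
by rewrite vl -scalemxAl.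
Qed.

(** The constant of [eig_lower_bound] in dimension at most [r]. Norms are squared throughout: [M]
    bounds the squared norm of the matrix, and [d] is a lower bound for the squared moduli of its
    eigenvalues. *)
Fixpoint eig_const (M d : C) (r : nat) : C :=
  if r is r'.+1 then 2 / d + 4 * eig_const M d r' * (M / d + 1) else 0.

Lemma eig_const_ge0 M d r : 0 <= M -> 0 < d -> 0 <= eig_const M d r.
Proof.
move=> M0 d0; elim: r => //= r IH.
have d0' := ltW d0; apply: addr_ge0; first exact: divr_ge0.
by apply: mulr_ge0; [exact: mulr_ge0 | apply: addr_ge0 => //; exact: divr_ge0].
Qed.

(** Induction on the dimension. If [u] in [U] is an eigenvector for [l], then [B - l] kills [u] and
    maps [U] onto a stable subspace of smaller rank. There the bound holds for [v (B - l)], and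
    [l v = v B - v (B - l)] carries it to [v]. *)
Lemma eig_lower_bound n (B : 'M[C]_n) (M d : C) : 0 <= M -> 0 < d ->
  (forall w, sqn (w *m B) <= M * sqn w) ->
  (forall l (v : 'rV_n), v != 0 -> v *m B = l *: v -> d <= `|l| ^+ 2) ->
  forall r (U : 'M[C]_n), stablemx U B -> (\rank U <= r)%N ->
  forall v : 'rV_n, (v <= U)%MS -> sqn v <= eig_const M d r * sqn (v *m B).
Proof.
move=> M0 d0 BM Bd; elim=> [|r IH] U sU rU v vU.
  have U0 : U = 0 by apply/eqP; rewrite -mxrank_eq0 -leqn0.
  by move: vU; rewrite U0 submx0 => /eqP->; rewrite sqn0 mul0r.
have [U0|U0] := eqVneq U 0.
  move: vU; rewrite U0 submx0 => /eqP->; rewrite sqn0 mulr_ge0 ?sqn_ge0//.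
  exact: (eig_const_ge0 r.+1).
have [l [u [u0 uU ul]]] := stable_eigen sU U0.
pose B' := B - l%:M; have BB' : B *m B' = B' *m B.
  by rewrite /B' mulmxBl mulmxBr scalar_mxC.
have sU' : stablemx (U *m B') B.
  by rewrite -mulmxA -BB' mulmxA submxMr.
have sUB' : (U *m B' <= U)%MS.
  by rewrite mulmxBr addmx_sub// mul_mx_scalar -scaleNr scalemx_sub.
have rU' : (\rank (U *m B') <= r)%N.
  rewrite -ltnS (leq_trans _ rU)// ltn_neqAle mxrankS ?andbT//.
  apply/eqP => rk.
  have : (u <= kermx B')%MS.
    by apply/sub_kermxP; rewrite mulmxBr ul mul_mx_scalar subrr.
  move: u0; rewrite -mxrank_eq0 => /negP ru uk; apply: ru.
  have := mxrank_mul_ker U B'.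
  rewrite rk => /eqP; rewrite -[X in _ == X]addn0 eqn_add2l => /eqP k0.
  have : (u <= U :&: kermx B')%MS by rewrite sub_capmx uU.
  by move/mxrankS; rewrite k0 leqn0.
have {}IH := IH _ sU' rU' (v *m B') (submxMr _ vU).
have l2 : d <= `|l| ^+ 2 by exact: Bd ul.
have l0 : 0 < `|l| ^+ 2 := lt_le_trans d0 l2.
set K := eig_const M d r in IH *; have K0 : 0 <= K by exact: eig_const_ge0.
(* [B] commutes with [B'], so [v B' B = (v B) B'], and the norm bound on [B] is applied to [v B]. *)
have step1 : sqn (v *m B' *m B) <= 2 * (M + `|l| ^+ 2) * sqn (v *m B).
  rewrite -mulmxA -BB' mulmxA /B' mulmxBr mul_mx_scalar -scaleNr.
  apply: le_trans (sqn_add_le _ _) _; rewrite sqnZ normrN.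
  by rewrite -subr_ge0 (_ : _ - _ = 2 * (M * sqn (v *m B) - sqn (v *m B *m B)));
    [rewrite mulr_ge0// subr_ge0 BM | ring].
have step2 : `|l| ^+ 2 * sqn v <= 2 * sqn (v *m B) + 2 * sqn (v *m B').
  rewrite -sqnZ (_ : l *: v = v *m B + (- 1) *: (v *m B')).
    by apply: le_trans (sqn_add_le _ _) _; rewrite sqnZ normrN1 expr1n mul1r.
  by rewrite /B' mulmxBr mul_mx_scalar scaleN1r opprB addrC subrK.
(* The goal is multiplied by [|l|^2]; since [d <= |l|^2], the quotients by [d] in the constant
   absorb this factor. *)
rewrite -(ler_pM2l l0) (le_trans step2)//=.
apply: (@le_trans _ _ (2 * sqn (v *m B) + 2 * (K * (2 * (M + `|l| ^+ 2) * sqn (v *m B))))).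
  rewrite lerD2l ler_wpM2l// (le_trans IH)// ler_wpM2l//.
have -> : 2 * sqn (v *m B) + 2 * (K * (2 * (M + `|l| ^+ 2) * sqn (v *m B))) =
  (2 + 4 * K * (M + `|l| ^+ 2)) * sqn (v *m B) by ring.
rewrite mulrA ler_wpM2r ?sqn_ge0// -/K [leRHS]mulrDr; apply: lerD.
  by rewrite mulrCA ler_peMr// ler_pdivlMr// mul1r.
rewrite [leRHS]mulrCA; apply: ler_wpM2l; first exact: mulr_ge0.
rewrite mulrDr mulr1 lerD2r.
by rewrite mulrCA ler_peMr// ler_pdivlMr// mul1r.
Qed.

Lemma stable_ortho n (U B : 'M[C]_n) : stablemx U (B^t*) -> stablemx (U^!)%MS B.
Proof.
move=> sU; rewrite orthomx1E -mulmxA.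
have -> : B *m U^t* = (U *m B^t*)^t* by rewrite trmx_mul map_mxM trmxCK.
have /submxP[D ->] := sU; rewrite trmx_mul map_mxM mulmxA.
have /orthomx1P -> : ((U^!)%MS <= U^!)%MS by [].
by rewrite mul0mx.
Qed.

Definition stable n (S : 'M[C]_n -> Prop) (U : 'M[C]_n) :=
  forall A, S A -> stablemx U A.

(** Induction along an orthogonal decomposition: a piece [U] on which [p] holds is split off [W]. As
    [S] is closed under adjoints, the complement of [U] in [W] is again stable, and its rank is
    smaller. *)
Lemma stable_ortho_ind n (S : 'M[C]_n -> Prop) (p : 'rV[C]_n -> Prop) :
  (forall A, S A -> S (A^t*)) -> p 0 ->
  (forall W, stable S W -> W != 0 -> exists U,
    [/\ stable S U, U != 0, (U <= W)%MS & forall v : 'rV_n, (v <= U)%MS -> p v]) ->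
  (forall U V u v, stable S U -> stable S V -> (U <= V^!)%MS ->
    (u <= U)%MS -> (v <= V)%MS -> p u -> p v -> p (u + v)) ->
  forall v, p v.
Proof.
move=> Sadj p0 pex pD v.
suff H r : forall W, stable S W -> (\rank W <= r)%N ->
    forall v : 'rV_n, (v <= W)%MS -> p v.
  apply: (H n 1%:M); rewrite ?submx1 ?rank_leq_row// => A _.
  by rewrite submx1.
elim: r => [|r IH] W sW rW {}v vW.
  have W0 : W = 0 by apply/eqP; rewrite -mxrank_eq0 -leqn0.
  by move: vW; rewrite W0 submx0 => /eqP->.
have [W0|W0] := eqVneq W 0; first by move: vW; rewrite W0 submx0 => /eqP->.
have [U [sU U0 UW pU]] := pex _ sW W0.
have sUo : stable S (U^!)%MS by move=> A SA; apply/stable_ortho/sU/Sadj.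
have sV : stable S (W :&: U^!)%MS.
  move=> A SA; rewrite sub_capmx.
  rewrite (submx_trans (submxMr A (capmxSl _ _)) (sW _ SA)).
  by rewrite (submx_trans (submxMr A (capmxSr _ _)) (sUo _ SA)).
(* Otherwise [W], and with it [U], would lie in the complement of [U], forcing [U = 0]. *)
have rV : (\rank (W :&: U^!)%MS <= r)%N.
  rewrite -ltnS (leq_trans _ rW)// ltnNge; apply/negP => le.
  have /submxP[D WD] : (W <= W :&: U^!)%MS.
    by rewrite -(geq_leqif (mxrank_leqif_sup (capmxSl W (U^!)%MS))).
  have UU : (U <= U^!)%MS.
    by apply: (submx_trans UW); rewrite WD mulmx_sub// capmxSr.
  move: U0; rewrite -submx0 -(orthomx_ortho_disj U) sub_capmx submx_refl UU.
  by [].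
pose a := v *m proj_ortho U.
have aU : (a <= U)%MS by exact: proj_ortho_sub.
have bU : (v - a <= U^!)%MS by exact: proj_ortho_compl_sub.
have bV : (v - a <= W :&: U^!)%MS.
  rewrite sub_capmx bU andbT addmx_sub// -scaleN1r scalemx_sub//.
  exact: submx_trans UW.
rewrite (_ : v = a + (v - a)); last by rewrite addrC subrK.
apply: (pD U (W :&: U^!)%MS) => //; first by rewrite orthomx_sym capmxSr.
- exact: pU.
- exact: IH bV.
Qed.

End HermitianSpace.

(** * Jordan's theorem *)

Section FrobeniusNorm.
Local Open Scope sesquilinear_scope.
Context {C : numClosedFieldType}.
Implicit Types (n : nat).

(** The square of the Frobenius norm. *)
Definition frob n (X : 'M[C]_n) : C := \tr (X *m X^t*).

Lemma frobE n (X : 'M[C]_n) : frob X = \sum_i \sum_j `|X i j| ^+ 2.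
Proof.
rewrite /frob /mxtrace; apply: eq_bigr => i _; rewrite mxE.
by apply: eq_bigr => j _; rewrite !mxE normCK.
Qed.

Lemma frob_rows n (X : 'M[C]_n) : frob X = \sum_i sqn (row i X).
Proof.
rewrite frobE; apply: eq_bigr => i _; rewrite sqnE.
by apply: eq_bigr => j _; rewrite mxE.
Qed.

Lemma frob_ge0 n (X : 'M[C]_n) : 0 <= frob X.
Proof. by rewrite frob_rows sumr_ge0// => i _; exact: sqn_ge0. Qed.

Lemma frob_entry n (X : 'M[C]_n) i j : `|X i j| ^+ 2 <= frob X.
Proof.
rewrite frobE (bigD1 i)//= (bigD1 j)//= -addrA lerDl.
apply: addr_ge0; apply: sumr_ge0 => k _; first exact: exprn_ge0.
by apply: sumr_ge0 => l _; exact: exprn_ge0.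
Qed.

Lemma frob_eq0 n (X : 'M[C]_n) : frob X = 0 -> X = 0.
Proof.
move=> X0; apply/matrixP => i j; rewrite mxE; apply/eqP.
have := frob_entry X i j; rewrite X0 => le0.
by rewrite -normr_eq0 -sqrf_eq0 eq_le le0 exprn_ge0.
Qed.

Lemma frobN n (X : 'M[C]_n) : frob (- X) = frob X.
Proof. by rewrite !frobE; do 2![apply: eq_bigr => ? _]; rewrite mxE normrN. Qed.

Lemma frobD_le n (X Y : 'M[C]_n) : frob (X + Y) <= 2 * frob X + 2 * frob Y.
Proof.
rewrite !frob_rows !mulr_sumr -big_split; apply: ler_sum => i _ /=.
by rewrite linearD sqn_add_le.
Qed.

(** Each entry of the product is the scalar product of a row of [X] with a conjugated column of [Y],
    so Cauchy-Schwarz applies. *)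
Lemma frobM_le n (X Y : 'M[C]_n) : frob (X *m Y) <= frob X * frob Y.
Proof.
have -> : frob Y = \sum_j sqn (row j (Y^t*)).
  rewrite frobE exchange_big; apply: eq_bigr => j _; rewrite sqnE.
  by apply: eq_bigr => i _; rewrite !mxE norm_conjC.
rewrite frobE (frob_rows X) mulr_suml; apply: ler_sum => i _.
rewrite mulr_sumr; apply: ler_sum => j _.
have -> : (X *m Y) i j = dotmx (row i X) (row j (Y^t*)).
  rewrite dotmxE !mxE; apply: eq_bigr => k _.
  by rewrite !mxE conjCK.
exact: dotmx_sqr_le.
Qed.

Lemma frob_unitaryl n (U X : 'M[C]_n) : U \is unitarymx -> frob (U *m X) = frob X.
Proof.
move=> /unitarymxP /mulmx1C UU.
by rewrite /frob trmx_mul map_mxM -mulmxA mxtrace_mulC -!mulmxA UU mulmx1.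
Qed.

Lemma frob_unitaryr n (U X : 'M[C]_n) : U \is unitarymx -> frob (X *m U) = frob X.
Proof.
move=> /unitarymxP UU.
by rewrite /frob trmx_mul map_mxM mulmxA -(mulmxA X) UU mulmx1.
Qed.

(** Subtracting the identity from both factors does not change the commutator. Hence a commutator
    with a matrix close to the identity is closer to it than the other factor. *)
Lemma frob_commutator_le n (X Y : 'M[C]_n) :
  frob (X *m Y - Y *m X) <= 4 * frob (X - 1%:M) * frob (Y - 1%:M).
Proof.
have -> : X *m Y - Y *m X =
    (X - 1%:M) *m (Y - 1%:M) + - ((Y - 1%:M) *m (X - 1%:M)).
  rewrite !mulmxBl !mulmxBr !mul1mx !mulmx1.
  by apply/matrixP => i j; rewrite !mxE; ring.
apply: le_trans (frobD_le _ _) _; rewrite frobN.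
have -> : 4 * frob (X - 1%:M) * frob (Y - 1%:M) =
  2 * (frob (X - 1%:M) * frob (Y - 1%:M)) + 2 * (frob (Y - 1%:M) * frob (X - 1%:M)) by ring.
by apply: lerD; apply: ler_wpM2l => //; exact: frobM_le.
Qed.

(** The diagonal entries of [X - 1] have modulus less than 1, so their sum cannot be [- n]. *)
Lemma trace_near1_neq0 n (X : 'M[C]_n) : (0 < n)%N ->
  4 * frob (X - 1%:M) < 1 -> \tr X != 0.
Proof.
move=> n0 fX; apply/eqP => trX.
have : \tr (X - 1%:M) = - n%:R by rewrite linearB /= trX mxtrace1 sub0r.
move/(congr1 (@Num.norm _ C)); rewrite normrN normr_nat => trn.
have ent i : `|(X - 1%:M) i i| < 1.
  rewrite -(@ltr_pXn2r _ 2)// ?nnegrE// expr1n (le_lt_trans (frob_entry _ _ _))//.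
  by apply: le_lt_trans fX; rewrite ler_peMl ?frob_ge0// (ler_nat C 1 4).
have : `|\tr (X - 1%:M)| < n%:R.
  apply: le_lt_trans (ler_norm_sum _ _ _) _.
  rewrite -[X in X%:R](card_ord n) -sumr_const.
  by apply: ltr_sum => //; apply/hasP; exists (Ordinal n0); rewrite ?mem_index_enum.
by rewrite trn ltxx.
Qed.

End FrobeniusNorm.

Section IndexBounds.
Variable gT : groupType.
Implicit Types (A B G : set gT).

(* A is a subgroup of G of index at most N: the colours separate the left
   cosets of A. *)
Definition index_le A G (N : nat) := exists c : gT -> 'I_N,
  forall g h, G g -> G h -> c g = c h -> A (g^-1 * h)%g.

Lemma index_le_finType (F : finType) (c : gT -> F) A G :
  (forall g h, G g -> G h -> c g = c h -> A (g^-1 * h)%g) -> index_le A G #|F|.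
Proof.
move=> cA; exists (fun g => enum_rank (c g)) => g h Gg Gh.
by move/enum_rank_inj; exact: cA.
Qed.

Lemma index_leW A B G N N' : A `<=` B -> (N <= N')%N ->
  index_le A G N -> index_le B G N'.
Proof.
move=> AB NN' [c cA]; exists (fun g => widen_ord NN' (c g)) => g h Gg Gh e.
by apply/AB/cA => //; apply: val_inj; have := congr1 val e.
Qed.

Lemma index_leI A B G N N' : index_le A G N -> index_le B G N' ->
  index_le (A `&` B) G (N * N').
Proof.
move=> [c cA] [c' cB].
have -> : (N * N')%N = #|{: 'I_N * 'I_N'}| by rewrite card_prod !card_ord.
apply: (index_le_finType (c := fun g => (c g, c' g))) => g h Gg Gh [e e'].
by split; [exact: cA | exact: cB].
Qed.

(** An element is coloured by its colour for [B] together with the colour for [A] of its quotient by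
    a chosen representative [rep] of the first colour; that quotient lies in [B]. *)
Lemma index_le_trans A B G N N' : subgroup G -> B `<=` G ->
  index_le B G N -> index_le A B N' -> index_le A G (N * N').
Proof.
move=> [G1 GM GV] BG [c cB] [c' cA].
pose rep i := xget 1%g [set r | G r /\ c r = i].
have repP g : G g -> G (rep (c g)) /\ c (rep (c g)) = c g.
  by move=> Gg; apply: (xgetPex 1%g (P := [set r | G r /\ c r = c g])); exists g.
have -> : (N * N')%N = #|{: 'I_N * 'I_N'}| by rewrite card_prod !card_ord.
apply: (index_le_finType (c := fun g => (c g, c' ((rep (c g))^-1 * g)%g))).
move=> g h Gg Gh [e e']; have [Gr cr] := repP g Gg.
have := cA ((rep (c g))^-1 * g)%g ((rep (c g))^-1 * h)%g.
rewrite invgM invgK mulgA mulgK; apply.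
- exact: cB.
- by apply: cB; rewrite // cr.
- by rewrite e' -e.
Qed.

End IndexBounds.

(** * A finite partition of the unitary matrices into small cells *)

Section UnitaryBoxes.
Local Open Scope sesquilinear_scope.
Local Open Scope complex_scope.
Variable R : realType.

(** The cell of [x] when [[-1, 1]] is cut into intervals of length [1 / s]; the endpoint 1 has the
    extra cell [2 * s]. *)
Definition box (s : nat) (x : R) : 'I_(2 * s).+1 :=
  inord (Num.truncn (s%:R * (x + 1))).

Lemma box_close s (x y : R) : (0 < s)%N -> `|x| <= 1 -> `|y| <= 1 ->
  box s x = box s y -> (x - y) ^+ 2 <= (s%:R ^+ 2)^-1.
Proof.
move=> s0 x1 y1; have s0' : 0 < s%:R :> R by rewrite ltr0n.
have tr (z : R) : `|z| <= 1 -> 0 <= s%:R * (z + 1) /\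
    (Num.truncn (s%:R * (z + 1)) < (2 * s).+1)%N.
  rewrite ler_norml => /andP[z1 z2].
  have z0 : 0 <= s%:R * (z + 1) by rewrite mulr_ge0 ?ler0n// -lerBlDr sub0r.
  split=> //; rewrite truncn_lt_nat// (@le_lt_trans _ _ (s%:R * 2))//.
    by rewrite ler_wpM2l ?ler0n//; lra.
  by rewrite -natrM ltr_nat mulnC.
have [[x0 xb] [y0 yb]] := (tr _ x1, tr _ y1).
move/(congr1 (@nat_of_ord _)); rewrite /box !inordK// => e.
have := truncn_itv x0; rewrite e => /andP[xl xr].
have := truncn_itv y0 => /andP[yl yr]; set n := Num.truncn _ in e xl xr yl yr.
rewrite -(ler_pM2r (exprn_gt0 2 s0')) mulVf ?expf_neq0 ?gt_eqF//.
rewrite -exprMn -[leRHS](expr1n _ 2) -ler_sqrt ?sqr_ge0 ?ltr01 ?expr1n//.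
rewrite sqrtr1 sqrtr_sqr ler_norml; move: xl xr yl yr; rewrite -natr1.
have -> : (x - y) * s%:R = s%:R * (x + 1) - s%:R * (y + 1) by ring.
by move=> *; apply/andP; split; lra.
Qed.

Lemma unitary_entry k (U : 'M[R[i]]_k) i j : U \is unitarymx ->
  `|complex.Re (U i j)| <= 1 /\ `|complex.Im (U i j)| <= 1.
Proof.
move=> /unitarymxP /matrixP /(_ i i); rewrite !mxE eqxx mulr1n (bigD1 j)//= => e.
have e1 : `|U i j| ^+ 2 <= 1.
  rewrite -e !mxE normCK lerDl sumr_ge0// => l _.
  by rewrite !mxE mul_conjC_ge0.
move: e1; rewrite -add_Re2_Im2 -[1]/(1%:C) lecR => e1.
split; rewrite -sqrtr_sqr -[leRHS]sqrtr1 ler_wsqrtr// (le_trans _ e1)//.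
  by rewrite lerDl sqr_ge0.
by rewrite lerDr sqr_ge0.
Qed.

Lemma unitary_boxes k : exists N (c : 'M[R[i]]_k -> 'I_N), forall U V,
  U \is unitarymx -> V \is unitarymx -> c U = c V -> 4 * frob (U - V) < 1.
Proof.
(* In one cell the real and imaginary parts of an entry differ by at most [1 / s], so four times the
   squared distance is at most [8 k^2 / s^2], which is less than 1 for [s = 3 k + 1]. *)
pose s := (3 * k).+1.
pose c (U : 'M[R[i]]_k) := [ffun p : 'I_k * 'I_k =>
  (box s (complex.Re (U p.1 p.2)), box s (complex.Im (U p.1 p.2)))].
exists _, (enum_rank \o c) => U V uU uV /enum_rank_inj/ffunP cUV.
have ent i j : `|(U - V) i j| ^+ 2 <= (2 * (s%:R ^+ 2)^-1)%:C.
  have := cUV (i, j); rewrite !ffunE /= => -[eRe eIm].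
  have [U1 U2] := unitary_entry i j uU; have [V1 V2] := unitary_entry i j uV.
  have := box_close (ltn0Sn _) U1 V1 eRe; have := box_close (ltn0Sn _) U2 V2 eIm.
  rewrite -add_Re2_Im2 lecR !mxE.
  case: (U i j) (V i j) => a b [a' b'] /= h1 h2.
  by rewrite mulrDl mul1r lerD.
have le : frob (U - V) <= ((2 * (s%:R ^+ 2)^-1) * (k%:R ^+ 2))%:C.
  rewrite frobE (_ : _%:C = \sum_(i < k) \sum_(j < k) (2 * (s%:R ^+ 2)^-1)%:C).
    by do 2![apply: ler_sum => ? _].
  rewrite !sumr_const !card_ord -mulrnA mulnn -[RHS]mulr_natr natrX.
  by rewrite (rmorphM (real_complex R)) rmorphXn rmorph_nat.
apply: le_lt_trans (_ : 4 * ((2 * (s%:R ^+ 2)^-1) * (k%:R ^+ 2))%:C < 1).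
  by rewrite ler_wpM2l.
rewrite -(rmorph_nat (real_complex R)) -rmorphM -(rmorph1 (real_complex R)) ltcR.
have s0 : 0 < s%:R ^+ 2 :> R by rewrite exprn_gt0.
rewrite -(ltr_pM2r s0) mul1r.
rewrite (_ : _ * _ = 8 * k%:R ^+ 2); last by field; rewrite gt_eqF ?ltr0n.
by rewrite -!natrX -natrM ltr_nat /s; nia.
Qed.

End UnitaryBoxes.

(** * Unitary matrix representations of a subgroup *)

Section UnitaryRepresentations.
Local Open Scope sesquilinear_scope.
Context {C : numClosedFieldType} {gT : groupType}.
Implicit Types (G H : set gT) (n : nat).

Notation "U ^!" := (orthomx Num.conj (mx_of_hermitian (hermitian1mx _)) U)
  : matrix_set_scope.

(** The map [s] is defined on the whole group type and constrained on [G] only, so that restricting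
    to a subgroup keeps the same function. *)
Record unirep G n (s : gT -> 'M[C]_n) : Prop := Unirep {
  unirepM : forall g h, G g -> G h -> s (g * h)%g = s g *m s h;
  unirepU : forall g, G g -> s g \is unitarymx }.

Lemma unirep_sub G H n (s : gT -> 'M[C]_n) : H `<=` G -> unirep G s -> unirep H s.
Proof. by move=> HG [sM sU]; split=> [g h /HG Gg /HG|g /HG]; auto. Qed.

Lemma unirep1 G n (s : gT -> 'M[C]_n) : subgroup G -> unirep G s -> s 1%g = 1%:M.
Proof.
move=> [G1 _ _] [sM sU]; have u := unitarymx_unit (sU _ G1).
by apply: (can_inj (mulKmx u)); rewrite mulmx1 -sM// mulg1.
Qed.

Lemma unirepV G n (s : gT -> 'M[C]_n) g : subgroup G -> unirep G s -> G g ->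
  s g^-1%g = (s g)^t*.
Proof.
move=> sG rs Gg; have [G1 _ GV] := sG.
have u := unitarymx_unit (unirepU rs Gg).
apply: (can_inj (mulKmx u)); rewrite -(unirepM rs)//; last exact: GV.
by rewrite mulgV (unirep1 sG rs) (unitarymxP (unirepU rs Gg)).
Qed.

Definition rep_set G n (s : gT -> 'M[C]_n) (A : 'M[C]_n) := exists2 g, G g & A = s g.

Lemma rep_set_adj G n (s : gT -> 'M[C]_n) A : subgroup G -> unirep G s ->
  rep_set G s A -> rep_set G s (A^t*).
Proof.
move=> sG rs [g Gg ->]; exists g^-1%g; first by case: sG => _ _; exact.
by rewrite (unirepV sG rs Gg).
Qed.

Lemma onb_exists n (V : 'M[C]_n) : exists2 B : 'M[C]_(\rank V, n),
  B \is unitarymx & (B :=: V)%MS.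
Proof.
exists (schmidt (row_base V)); first by rewrite schmidt_unitarymx ?rank_leq_col.
apply: eqmx_trans (eqmx_schmidt_free (row_base_free V)) (eq_row_base V).
Qed.

Lemma unitary_intertwine m n (B : 'M[C]_(m, n)) X : B \is unitarymx ->
  (B *m X <= B)%MS -> B *m X = B *m X *m B^t* *m B.
Proof.
by move=> /unitarymxP BB /submxP[D e]; rewrite e -(mulmxA D) BB mulmx1.
Qed.

Lemma unirep_restrict G m n (s : gT -> 'M[C]_n) (B : 'M[C]_(m, n)) :
  subgroup G -> unirep G s -> B \is unitarymx ->
  (forall g, G g -> (B *m s g <= B)%MS) ->
  unirep G (fun g => B *m s g *m B^t*).
Proof.
move=> sG rs uB sB; have BB := unitarymxP uB.
have inter g (Gg : G g) := unitary_intertwine uB (sB g Gg).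
split=> [g h Gg Gh|g Gg].
  by rewrite (unirepM rs)// !mulmxA -(inter g Gg).
apply/unitarymxP; rewrite !trmx_mul !map_mxM trmxCK !mulmxA -(inter g Gg).
by rewrite -(mulmxA B) (unitarymxP (unirepU rs Gg)) mulmx1 BB.
Qed.

End UnitaryRepresentations.

(** * Subgroups of bounded index with commuting image *)

Section Jordan.
Local Open Scope sesquilinear_scope.
Context {R : realType} {gT : groupType}.
Implicit Types (G H A : set gT).

Notation "U ^!" := (orthomx Num.conj (mx_of_hermitian (hermitian1mx _)) U)
  : matrix_set_scope.

Definition commuting_image A n (s : gT -> 'M[R[i]]_n) :=
  forall a b, A a -> A b -> s a *m s b = s b *m s a.

(** If [s g] and [s h] lie in one cell, then [s (g^-1 h)] is close to the identity, because
    multiplying by the unitary [s g] preserves the distance. The cells therefore separate the cosets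
    of [A]. *)
Lemma small_index k : exists N, forall G (s : gT -> 'M[R[i]]_k) A,
  subgroup G -> unirep G s ->
  (forall g, G g -> 4 * frob (s g - 1%:M) < 1 -> A g) -> index_le A G N.
Proof.
have [N [c cP]] := unitary_boxes R k; exists N => G s A sG rs smallA.
have [G1 GM GV] := sG.
exists (c \o s) => g h Gg Gh e; apply: smallA; first by apply: GM => //; exact: GV.
have ug := unirepU rs Gg; rewrite -(frob_unitaryl _ ug).
rewrite mulmxBr mulmx1 -(unirepM rs)//; last by apply: GM => //; exact: GV.
rewrite mulVKg.
rewrite -opprB frobN; exact: (cP _ _ ug (unirepU rs Gh) e).
Qed.

(* A finite set of colours through which s factors makes its image finite, so
   that a non-scalar h closest to the identity exists.  If s g is close to the
   identity, then [g, h] is closer to it than h, hence scalar; comparing the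
   nonzero traces of s h and s (g h g^-1) shows that g and h commute. *)
Lemma close_commute n G (s : gT -> 'M[R[i]]_n) (F : finType) (key : gT -> F) :
  subgroup G -> unirep G s ->
  (forall g h, G g -> G h -> key g = key h -> s g = s h) ->
  (exists g, [/\ G g, 4 * frob (s g - 1%:M) < 1 & ~~ is_scalar_mx (s g)]) ->
  exists h, [/\ G h, ~~ is_scalar_mx (s h) &
    forall g, G g -> 4 * frob (s g - 1%:M) < 1 -> s g *m s h = s h *m s g].
Proof.
move=> sG rs fact [g0 [Gg0 g0s g0n]]; have [G1 GM GV] := sG.
have n0 : (0 < n)%N.
  case: (n) s {rs fact g0s} g0n => // s /negP[].
  by apply/is_scalar_mxP; exists 0; apply/matrixP => -[].
pose P (f : F) := `[< exists g, [/\ G g, ~~ is_scalar_mx (s g) & key g = f] >].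
pose lift f := xget 1%g [set g | [/\ G g, ~~ is_scalar_mx (s g) & key g = f]].
have liftP f : P f -> [/\ G (lift f), ~~ is_scalar_mx (s (lift f)) & key (lift f) = f].
  move=> /asboolP; exact: (xgetPex 1%g
    (P := [set g | [/\ G g, ~~ is_scalar_mx (s g) & key g = f]])).
pose fr f := frob (s (lift f) - 1%:M).
have Pg g : G g -> ~~ is_scalar_mx (s g) -> P (key g).
  by move=> Gg ng; apply/asboolP; exists g.
have frP g : G g -> ~~ is_scalar_mx (s g) -> fr (key g) = frob (s g - 1%:M).
  move=> Gg ng; have [Gl _ lk] := liftP _ (Pg g Gg ng).
  by rewrite /fr (fact _ _ Gl Gg lk).
have frr : {in P, forall f, fr f \is Num.real} by move=> f _; rewrite ger0_real// frob_ge0.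
case: (real_arg_minP (Pg _ Gg0 g0n) frr) => f Pf fmin.
have [Gh hn _] := liftP f Pf; set h := lift f in Gh hn; exists h; split=> // g Gg gs.
have hmin x : G x -> ~~ is_scalar_mx (s x) -> frob (s h - 1%:M) <= frob (s x - 1%:M).
  by move=> Gx nx; rewrite -(frP _ Gx nx); exact: fmin (Pg _ Gx nx).
have hs : 4 * frob (s h - 1%:M) < 1.
  by apply: le_lt_trans g0s; rewrite ler_wpM2l// hmin.
have h1 : 0 < frob (s h - 1%:M).
  rewrite lt_def frob_ge0 andbT; apply: contra hn => /eqP/frob_eq0/eqP.
  by rewrite subr_eq0 => /eqP->; exact: scalar_mx_is_scalar.
pose k := (g * h * (h * g)^-1)%g.
have Ghg : G (h * g)%g by exact: GM.
have Gk : G k by apply: (GM); [exact: GM | exact: GV].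
have sk : s k *m (s h *m s g) = s g *m s h.
  by rewrite -!(unirepM rs)// /k mulgVK.
have /is_scalar_mxP[c kc] : is_scalar_mx (s k).
  apply: contraT => nk; have := hmin k Gk nk.
  rewrite -(frob_unitaryr (s k - 1%:M) (unirepU rs Ghg)) mulmxBl mul1mx.
  rewrite (unirepM rs Gh Gg) sk => le.
  have := le_trans le (frob_commutator_le (s g) (s h)).
  rewrite -[leLHS]mul1r ler_pM2r// => le1.
  by have := lt_le_trans gs le1; rewrite ltxx.
move: sk; rewrite kc mul_scalar_mx => sk.
have := congr1 (fun X => \tr (X *m (s g)^t*)) sk.
rewrite -scalemxAl mxtraceZ -(mulmxA (s h)) (unitarymxP (unirepU rs Gg)) mulmx1.
rewrite mxtrace_mulC mulmxA.
have -> : (s g)^t* *m s g = 1%:M by apply/mulmx1C/unitarymxP/(unirepU rs Gg).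
rewrite mul1mx => /eqP; rewrite -subr_eq0 -{2}[\tr (s h)]mul1r -mulrBl mulf_eq0.
rewrite (negbTE (trace_near1_neq0 n0 hs)) orbF subr_eq0 => /eqP c1.
by rewrite -sk c1 scale1r.
Qed.

(** Induction on the degree. If every element close to the identity acts as a scalar, the elements
    acting as scalars form the subgroup. Otherwise [close_commute] gives a non-scalar [s h] whose
    centralizer [H] has bounded index; [H] preserves a proper eigenspace of [s h] and its
    complement, and the subgroups obtained on these two are intersected. *)
Theorem Jordan_bound k : exists N, forall n G (s : gT -> 'M[R[i]]_n)
    (F : finType) (key : gT -> F), (n <= k)%N ->
  subgroup G -> unirep G s ->
  (forall g h, G g -> G h -> key g = key h -> s g = s h) ->
  exists A, [/\ subgroup A, A `<=` G, index_le A G N & commuting_image A s].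
Proof.
elim: k => [|k [N IH]].
  exists 1%N => n G s F key; rewrite leqn0 => /eqP n0 sG rs _; exists G; split=> //.
    exists (fun=> ord0) => g h Gg Gh _; have [_ GM GV] := sG.
    by apply: GM => //; exact: GV.
  move=> a b _ _; apply/matrixP => i; by move: (ltn_ord i); rewrite {2}n0.
have /boolp.choice[M MP] := small_index.
(* [L] dominates the index bounds of [small_index] for all degrees up to [k + 1]. Of the two
   summands of the final bound, [L * (N * N)] serves the case of a proper eigenspace and [L] the
   scalar case. *)
pose L := (\sum_(n < k.+2) M n)%N.
exists (L * (N * N) + L)%N => n G s F key nk sG rs fact.
have ML : (M n <= L)%N.
  by rewrite /L (bigD1 (Ordinal (nk : (n < k.+2)%N)))//= leq_addr.
have [G1 GM GV] := sG.
have [[g0 g0P]|allscalar] := pselect (exists g, [/\ G g,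
    4 * frob (s g - 1%:M) < 1 & ~~ is_scalar_mx (s g)]); last first.
  exists [set g | G g /\ is_scalar_mx (s g)]; split.
  - split=> [|g h [Gg /is_scalar_mxP[a ga]] [Gh /is_scalar_mxP[b hb]]|
      g [Gg /is_scalar_mxP[a ga]]].
    + by split=> //; rewrite (unirep1 sG rs) scalar_mx_is_scalar.
    + split; first exact: GM.
      by rewrite (unirepM rs)// ga hb -scalar_mxM scalar_mx_is_scalar.
    + split; first exact: GV.
      by rewrite (unirepV sG rs Gg) ga tr_scalar_mx map_scalar_mx scalar_mx_is_scalar.
  - by move=> g [].
  - apply: (@index_leW _ [set g | G g /\ is_scalar_mx (s g)] _ _ (M n)) => //.
      by rewrite (leq_trans ML)// leq_addl.
    apply: (MP n G s) => // g Gg gs; split=> //; apply: contraT => ng.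
    by case: allscalar; exists g.
  - move=> a b [_ /is_scalar_mxP[x ax]] [_ /is_scalar_mxP[y bY]].
    by rewrite ax bY -!scalar_mxM mulrC.
have [h [Gh hn hcomm]] := close_commute sG rs fact (ex_intro _ g0 g0P).
pose H := [set g | G g /\ s g *m s h = s h *m s g].
have HG : H `<=` G by move=> g [].
have sH : subgroup H.
  split=> [|g g' [Gg eg] [Gg' eg']|g [Gg eg]].
  - by split=> //; rewrite (unirep1 sG rs) mul1mx mulmx1.
  - split; first exact: GM.
    by rewrite (unirepM rs)// -mulmxA eg' mulmxA eg mulmxA.
  - split; first exact: GV.
    have ug := unirepU rs Gg; have u := unitarymx_unit ug.
    rewrite (unirepV sG rs Gg) -invmx_unitary//.
    apply: (can_inj (mulKmx u)); rewrite mulKVmx// mulmxA eg.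
    by rewrite -mulmxA mulmxV// mulmx1.
have iH : index_le H G (M n) by apply: (MP n G s) => // g Gg gs; split=> //; exact: hcomm.
have n0 : (0 < n)%N.
  case: (n) (s) hn => // s' /negP[].
  by apply/is_scalar_mxP; exists 0; apply/matrixP => -[].
have [l hl] := eigenvalue_closed (s h) n0.
pose V := eigenspace (s h) l.
have V0 : (0 < \rank V)%N by rewrite lt0n mxrank_eq0.
have Vn : (\rank V < n)%N.
  rewrite ltn_neqAle rank_leq_row andbT; apply: contra hn => fV.
  have /eigenspaceP : (1%:M <= V)%MS by rewrite sub1mx.
  by rewrite mul1mx scalemx1 => ->; exact: scalar_mx_is_scalar.
have rH := unirep_sub HG rs.
have sV g : H g -> stablemx V (s g).
  by move=> [_ eg]; apply: comm_mx_stable_eigenspace; exact/esym.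
clearbody V.
have sVo g : H g -> stablemx (V^!)%MS (s g).
  move=> Hg; apply: stable_ortho; rewrite -(unirepV sH rH Hg).
  by apply: sV; case: sH => _ _; exact.
have [B uB BV] := onb_exists V; have [B' uB' BV'] := onb_exists (V^!)%MS.
have VB : (V <= B)%MS by rewrite BV.
have VB' : (V^! <= B')%MS by rewrite BV'.
have sB g : H g -> (B *m s g <= B)%MS.
  by move=> Hg; rewrite BV (eqmxMr (s g) BV) sV.
have sB' g : H g -> (B' *m s g <= B')%MS.
  by move=> Hg; rewrite BV' (eqmxMr (s g) BV') sVo.
have rk : (\rank V <= k)%N by rewrite -ltnS (leq_trans Vn).
have rk' : (\rank (V^!) <= k)%N.
  by rewrite rank_ortho -ltnS (leq_trans _ nk)// -subSn ?rank_leq_row// leq_subLR -add1n leq_add2r.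
have fac m (D : 'M[R[i]]_(m, n)) g g' : H g -> H g' -> key g = key g' ->
    D *m s g *m D^t* = D *m s g' *m D^t*.
  by move=> [Gg _] [Gg' _] e; rewrite (fact _ _ Gg Gg' e).
have [A [sA AH iA cA]] := IH _ H _ F key rk sH (unirep_restrict sH rH uB sB) (fac _ B).
have [A' [sA' AH' iA' cA']] := IH _ H _ F key rk' sH (unirep_restrict sH rH uB' sB') (fac _ B').
exists (A `&` A'); split.
- case: sA sA' => [A1 AM AV] [A1' AM' AV']; split=> //.
  + by move=> a b [? ?] [? ?]; split; [exact: AM|exact: AM'].
  + by move=> a [? ?]; split; [exact: AV|exact: AV'].
- by move=> a [/AH[]].
- apply: (@index_leW _ (A `&` A') _ _ (M n * (N * N))) => //.
    by rewrite (leq_trans _ (leq_addr _ _))// leq_mul2r ML orbT.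
  by apply: (index_le_trans sG HG iH); exact: index_leI.
have key_comm m (D : 'M[R[i]]_(m, n)) a b : D \is unitarymx ->
    (forall g, H g -> (D *m s g <= D)%MS) -> H a -> H b ->
    D *m s a *m D^t* *m (D *m s b *m D^t*) = D *m s b *m D^t* *m (D *m s a *m D^t*) ->
    D *m (s a *m s b) = D *m (s b *m s a).
  move=> uD sD Ha Hb e.
  move: (unitary_intertwine uD (sD a Ha)) (unitary_intertwine uD (sD b Hb)) e.
  move: (D *m s a *m D^t*) (D *m s b *m D^t*) => a' b' i1 i2 e.
  by rewrite [LHS]mulmxA i1 -[LHS]mulmxA i2 [LHS]mulmxA e [RHS]mulmxA i2
    -[RHS]mulmxA i1 [RHS]mulmxA.
move=> a b [Aa A'a] [Ab A'b].
have [Ha Hb] := (AH _ Aa, AH _ Ab).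
have e := key_comm _ B a b uB sB Ha Hb (cA a b Aa Ab).
have e' := key_comm _ B' a b uB' sB' Ha Hb (cA' a b A'a A'b).
(* The kernel of the commutator contains [V] and its complement, hence the whole space. *)
pose K := kermx (s a *m s b - s b *m s a).
have k1 : (V <= K)%MS.
  apply: (submx_trans VB); apply/sub_kermxP; rewrite mulmxBr e.
  exact: subrr.
have k2 : (V^! <= K)%MS.
  apply: (submx_trans VB'); apply/sub_kermxP; rewrite mulmxBr e'.
  exact: subrr.
have sub0 : (V + V^! <= K)%MS by rewrite addsmx_sub k1.
rewrite (addsmx_ortho V) in sub0.
by apply/eqP; rewrite -subr_eq0 -[_ - _]mul1mx; apply/eqP/sub_kermxP.
Qed.

End Jordan.

(** * Subgroups of bounded index *)

Section SmallIndexSubgroups.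
Variable gT : groupType.
Implicit Types (G H : set gT).

(** The colours of [index_le] may split a coset. Recolouring each element by the colour of a
    representative that depends only on its coset gives one colour per coset. *)
Lemma coset_coloring G H N : subgroup G -> subgroup H -> H `<=` G ->
  index_le H G N -> exists c : gT -> 'I_N,
    forall g h, G g -> G h -> (c g = c h <-> H (g^-1 * h)%g).
Proof.
move=> [G1 GM GV] [H1 HM HV] HG [c cH].
pose S g := [set k | G k /\ H (k^-1 * g)%g].
exists (fun g => c (xget 1%g (S g))).
have SP g : G g -> S g (xget 1%g (S g)).
  by move=> Gg; apply: (xgetPex 1%g (P := S g)); exists g; split=> //; rewrite mulVg.
move=> g h Gg Gh; split=> [e|gh]; last first.
  suff -> : S g = S h by [].
  apply/seteqP; split=> k [Gk Hk]; split=> //.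
    by rewrite -(mulVKg g h) mulgA; apply: HM.
  have -> : (k^-1 * g = k^-1 * h * (g^-1 * h)^-1)%g.
    by rewrite invgM invgK -mulgA mulVKg.
  by apply: HM => //; exact: HV.
have [Gk Hk] := SP g Gg; have [Gl Hl] := SP h Gh.
have Hkl := cH _ _ Gk Gl e.
move: Hk Hl Hkl; set k := xget _ _; set l := xget _ _ => Hk Hl Hkl.
have -> : (g^-1 * h = (k^-1 * g)^-1 * ((k^-1 * l) * (l^-1 * h)))%g.
  by rewrite invgM invgK !mulgA mulgK mulgK.
by apply: (HM); [exact: HV | exact: HM].
Qed.

Section Transitions.
Variables (G : set gT) (s : seq gT) (N : nat).

(* The action of the letters of s by left translation on the colours. *)
Definition transitions (c : gT -> 'I_N)
    (D : {ffun 'I_(size s) * 'I_N -> 'I_N} * 'I_N) :=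
  D.2 = c 1%g /\
  forall j y, G y -> D.1 (j, c y) = c (nth 1%g s j * y)%g.

Lemma transitions_exist c :
  (forall a y z, G a -> G y -> G z -> c y = c z -> c (a * y)%g = c (a * z)%g) ->
  (forall a, a \in s -> G a) -> exists D, transitions c D.
Proof.
move=> cM sG.
pose f (p : 'I_(size s) * 'I_N) := c (nth 1%g s p.1 * xget 1%g [set y | G y /\ c y = p.2])%g.
exists (finfun f, c 1%g); split=> // j y Gy; rewrite ffunE /f /=.
have [Gz cz] : G (xget 1%g [set z | G z /\ c z = c y]) /\ c (xget 1%g [set z | G z /\ c z = c y]) = c y.
  by apply: (xgetPex 1%g (P := [set z | G z /\ c z = c y])); exists y.
by apply: cM => //; apply/sG/mem_nth.
Qed.

(** The elements [a] such that translation by [a] and by [a^-1] preserves agreement of [c] and [c']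
    form a subgroup containing the generators. As [c] and [c'] agree at 1, they agree on [G]. *)
Lemma transitions_inj c c' D : subgroup G ->
  (forall a, a \in s -> G a /\ a^-1%g \in s) ->
  (forall H, subgroup H -> [set` s] `<=` H -> G `<=` H) ->
  transitions c D -> transitions c' D -> forall g, G g -> c g = c' g.
Proof.
move=> [G1 GM GV] sG gen [D1 DT] [D1' DT'] g Gg.
pose P a := forall y, G y -> c y = c' y -> c (a * y)%g = c' (a * y)%g.
have PM a b : G b -> P a -> P b -> P (a * b)%g.
  move=> Gb Pa Pb y Gy e; rewrite -mulgA; apply: Pa; first exact: GM.
  exact: Pb.
have Ps a : a \in s -> P a.
  move=> sa y Gy e; have ia : (index a s < size s)%N by rewrite index_mem.
  have := DT (Ordinal ia) y Gy; have := DT' (Ordinal ia) y Gy.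
  by rewrite /= nth_index// e => -> ->.
have /gen : subgroup [set a | [/\ G a, P a & P a^-1%g]].
  split=> [|a b [Ga Pa Pa'] [Gb Pb Pb']|a [Ga Pa Pa']].
  - by split=> // y Gy e; rewrite ?invg1 !mul1g.
  - split; [exact: GM | exact: PM|].
    by rewrite invgM; apply: PM => //; exact: GV.
  - by split; [exact: GV | | rewrite invgK].
move=> /(_ _ g Gg)[|_ Pg _].
- move=> a /= sa; have [Ga sa'] := sG a sa.
  by split=> //; exact: Ps.
- by have := Pg 1%g G1; rewrite mulg1; apply; rewrite -D1 D1'.
Qed.

End Transitions.

(** On a finitely generated group a coset colouring is determined by its transitions and its value
    at 1, for which there are finitely many possibilities. So the subgroups of index at most [N] are
    handled by finitely many colours at once. *)
Lemma small_index_core G N : subgroup G -> finitely_generated G ->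
  exists N', index_le [set g | G g /\ forall H, subgroup H -> H `<=` G ->
    index_le H G N -> H g] G N'.
Proof.
move=> sG [s0 [s0G gen0]]; have [G1 GM GV] := sG.
(* The list is closed under inverses, as [transitions_inj] requires. *)
pose s := s0 ++ [seq (a^-1)%g | a <- s0].
have sP a : a \in s -> G a /\ a^-1%g \in s.
  rewrite mem_cat => /orP[sa|/mapP[b sb ->]].
    split; first exact: s0G.
    by rewrite mem_cat; apply/orP; right; apply: map_f.
  split; first by apply: (GV); exact: s0G.
  by rewrite invgK mem_cat sb.
have gen H : subgroup H -> [set` s] `<=` H -> G `<=` H.
  move=> sH sub; apply: gen0 => // a /= sa; apply: sub => /=.
  by rewrite mem_cat sa.
pose T := (({ffun 'I_(size s) * 'I_N -> 'I_N} * 'I_N) * 'I_N)%type.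
(* [kap g] records, for all transition data, which colours [g] can receive. If [kap g = kap h], then
   [g] and [h] lie in the same coset of every subgroup of index at most [N]. *)
pose kap g : {ffun T -> bool} := [ffun Di =>
  `[< exists c, transitions G c Di.1 /\ c g = Di.2 >]].
exists #|{ffun T -> bool}|; apply: (index_le_finType (c := kap)) => g h Gg Gh e; split.
  by apply: GM => //; exact: GV.
move=> H sH HG iH; have [c cP] := coset_coloring sG sH HG iH.
have [D cD] : exists D, transitions (s := s) G c D.
  apply: transitions_exist => [a y z Ga Gy Gz|a /sP[]//].
  move/(cP _ _ Gy Gz) => yz; apply/(cP _ _ (GM _ _ Ga Gy) (GM _ _ Ga Gz)).
  by rewrite invgM -mulgA mulKg.
apply/(cP _ _ Gg Gh).
have : kap g (D, c g) by rewrite ffunE; apply/asboolP; exists c.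
rewrite e ffunE => /asboolP[c' [cD' /= <-]].
exact: (transitions_inj sG sP gen cD' cD Gh).
Qed.

End SmallIndexSubgroups.

(** * Averages over finite quotients and Schur orthogonality *)

Section Averages.
Context {C : numClosedFieldType} {gT : groupType}.
Variable G : set gT.
Hypothesis sG : subgroup G.

(* key is, on G, the quotient map onto a finite group. *)
Record finite_quotient (F : finType) (key : gT -> F) : Prop := FiniteQuotient {
  fqM : forall g g' h h', G g -> G g' -> G h -> G h' -> key g = key g' ->
    key h = key h' -> key (g * h)%g = key (g' * h')%g;
  fqV : forall g g', G g -> G g' -> key g = key g' -> key g^-1%g = key g'^-1%g }.

Definition factors (F : finType) (key : gT -> F) T (f : gT -> T) :=
  forall g h, G g -> G h -> key g = key h -> f g = f h.

Section Mean.
Variables (F : finType) (key : gT -> F).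

Definition key_image : {set F} := [set i | `[< exists g, G g /\ key g = i >]].
Definition key_lift (i : F) : gT := xget 1%g [set g | G g /\ key g = i].

(** The average over the finite image of [key], evaluated at chosen lifts; the choice is immaterial
    when [f] factors through [key]. *)
Definition mean (V : lmodType C) (f : gT -> V) : V :=
  (#|key_image|%:R)^-1 *: \sum_(i in key_image) f (key_lift i).

Lemma key_liftP i : i \in key_image -> G (key_lift i) /\ key (key_lift i) = i.
Proof.
rewrite inE => /asboolP; exact: (xgetPex 1%g (P := [set g | G g /\ key g = i])).
Qed.

Lemma key_image_key g : G g -> key g \in key_image.
Proof. by move=> Gg; rewrite inE; apply/asboolP; exists g. Qed.

Lemma key_image_gt0 : (#|key_image|%:R : C) != 0.
Proof.
rewrite pnatr_eq0 -lt0n; apply/card_gt0P; exists (key 1%g).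
by apply: key_image_key; case: sG.
Qed.

Lemma eq_mean (V : lmodType C) (f f' : gT -> V) :
  (forall g, G g -> f g = f' g) -> mean f = mean f'.
Proof.
move=> ff'; congr (_ *: _); apply: eq_bigr => i /key_liftP[Gi _]; exact: ff'.
Qed.

Lemma mean_cst (V : lmodType C) (v : V) : mean (fun=> v) = v.
Proof.
by rewrite /mean sumr_const -[v *+ _]scaler_nat scalerA mulVf ?key_image_gt0// scale1r.
Qed.

Lemma mean_morph (V W : lmodType C) (p : V -> W) (f : gT -> V) :
  (forall a u v, p (a *: u + v) = a *: p u + p v) ->
  p (mean f) = mean (fun g => p (f g)).
Proof.
move=> plin; have p0 : p 0 = 0.
  have := plin 1 0 0; rewrite !scale1r add0r => /eqP.
  by rewrite -subr_eq subrr => /eqP.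
have pD u v : p (u + v) = p u + p v by have := plin 1 u v; rewrite !scale1r.
have pZ a u : p (a *: u) = a *: p u by have := plin a u 0; rewrite p0 !addr0.
by rewrite /mean pZ (big_morph p pD p0).
Qed.

(** The map [t] induces an injection of the finite image of [key] into itself, hence a permutation
    of the summands. *)
Lemma mean_reindex (V : lmodType C) (t : gT -> gT) (f : gT -> V) :
  factors key f -> (forall g, G g -> G (t g)) ->
  (forall g h, G g -> G h -> (key (t g) = key (t h) <-> key g = key h)) ->
  mean (fun g => f (t g)) = mean f.
Proof.
move=> ff tG tinj; pose h i := key (t (key_lift i)).
have hinj : {in key_image &, injective h}.
  move=> i j /key_liftP[Gi ei] /key_liftP[Gj ej] /(tinj _ _ Gi Gj).
  by rewrite ei ej.
have him : h @: key_image = key_image.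
  apply/eqP; rewrite eqEcard card_in_imset// leqnn andbT.
  by apply/fintype.subsetP => _ /imsetP[i /key_liftP[Gi _] ->]; apply/key_image_key/tG.
congr (_ *: _); rewrite -[in RHS]him big_imset//=.
apply: eq_bigr => i ii; have [Gi ei] := key_liftP ii.
have hi : h i \in key_image by rewrite -him imset_f.
by have [Gh eh] := key_liftP hi; apply: ff => //; exact: tG.
Qed.

Hypothesis fq : finite_quotient key.

Lemma mean_shiftl (V : lmodType C) (f : gT -> V) a : factors key f -> G a ->
  mean (fun g => f (a * g)%g) = mean f.
Proof.
move=> ff Ga; have [_ GM GV] := sG; apply: mean_reindex => // [g Gg|g h Gg Gh].
  exact: GM.
split=> [e|e]; last by apply: (fqM fq).
rewrite -(mulKg a g) -(mulKg a h); apply: (fqM fq) => //; first [exact: GV | exact: GM].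
Qed.

Lemma mean_shiftr (V : lmodType C) (f : gT -> V) a : factors key f -> G a ->
  mean (fun g => f (g * a)%g) = mean f.
Proof.
move=> ff Ga; have [_ GM GV] := sG; apply: mean_reindex => // [g Gg|g h Gg Gh].
  exact: GM.
split=> [e|e]; last by apply: (fqM fq).
rewrite -(mulgK a g) -(mulgK a h); apply: (fqM fq) => //; first [exact: GV | exact: GM].
Qed.

Lemma mean_inv (V : lmodType C) (f : gT -> V) : factors key f ->
  mean (fun g => f g^-1%g) = mean f.
Proof.
move=> ff; have [_ GM GV] := sG; apply: mean_reindex => // g h Gg Gh.
split=> [e|e]; last exact: (fqV fq).
by rewrite -(invgK g) -(invgK h); apply: (fqV fq) => //; exact: GV.
Qed.

End Mean.

Lemma mean_exchange (F F' : finType) (key : gT -> F) (key' : gT -> F')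
    (V : lmodType C) (f : gT -> gT -> V) :
  mean key (fun g => mean key' (f g)) = mean key' (fun h => mean key (f^~ h)).
Proof.
rewrite /mean -!scaler_sumr !scalerA mulrC; congr (_ *: _).
by rewrite exchange_big.
Qed.

(* Average over both quotients and use translation invariance for each of them. *)
Lemma mean_indep (F F' : finType) (key : gT -> F) (key' : gT -> F')
    (V : lmodType C) (f : gT -> V) :
  finite_quotient key -> finite_quotient key' -> factors key f -> factors key' f ->
  mean key f = mean key' f.
Proof.
move=> fq fq' ff ff'; rewrite -[LHS](mean_cst key').
transitivity (mean key' (fun g => mean key (fun h => f (h * g)%g))).
  by apply: eq_mean => g Gg; rewrite (mean_shiftr fq ff Gg).
rewrite mean_exchange -[RHS](mean_cst key); apply: eq_mean => h Gh.
exact: (mean_shiftl fq' ff' Gh).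
Qed.

End Averages.

(** * Schur's lemma and the orthogonality relations *)

Section SchurOrthogonality.
Local Open Scope sesquilinear_scope.
Context {C : numClosedFieldType} {gT : groupType}.
Variable G : set gT.
Hypothesis sG : subgroup G.

Definition irreducible n (s : gT -> 'M[C]_n) := (0 < n)%N /\
  forall U : 'M[C]_n, stable (rep_set G s) U -> U != 0 -> row_full U.

Definition intertwiner m n (s : gT -> 'M[C]_m) (r : gT -> 'M[C]_n) (c : 'M[C]_(m, n)) :=
  forall g, G g -> s g *m c = c *m r g.

(** An eigenspace of [c] is nonzero and stable, hence everything. *)
Lemma intertwiner_scalar n (s : gT -> 'M[C]_n) c : irreducible s ->
  intertwiner s s c -> is_scalar_mx c.
Proof.
move=> [n0 irr] ic; have [a ac] := eigenvalue_closed c n0.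
have : row_full (eigenspace c a).
  apply: irr => // _ [g Gg ->]; apply: comm_mx_stable_eigenspace.
  exact/esym/ic.
rewrite -sub1mx => /eigenspaceP; rewrite mul1mx scalemx1 => ->.
exact: scalar_mx_is_scalar.
Qed.

(** The row space of a nonzero [c] is stable under [r], so it is full and [c] has rank [n]; but a
    matrix with [m] rows has rank at most [m]. *)
Lemma intertwiner_lt m n (s : gT -> 'M[C]_m) (r : gT -> 'M[C]_n) c :
  irreducible r -> (m < n)%N -> intertwiner s r c -> c = 0.
Proof.
move=> [_ irr] mn ic; apply/eqP; apply: contraTT mn => c0; rewrite -leqNgt.
have : row_full <<c>>%MS.
  apply: irr => [_ [g Gg ->]|].
    by rewrite (eqmxMr _ (genmxE c)) genmxE -ic// submxMl.
  by rewrite -mxrank_eq0 mxrank_gen mxrank_eq0.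
by rewrite /row_full mxrank_gen => /eqP <-; exact: rank_leq_row.
Qed.

Lemma intertwiner_adj m n (s : gT -> 'M[C]_m) (r : gT -> 'M[C]_n) c :
  unirep G s -> unirep G r -> intertwiner s r c -> intertwiner r s (c^t*).
Proof.
move=> us ur ic g Gg; have GV : G g^-1%g by case: sG => _ _; exact.
have := congr1 (fun X => X^t*) (ic _ GV).
by rewrite !trmx_mul !map_mxM (unirepV sG us Gg) (unirepV sG ur Gg) !trmxCK.
Qed.

Lemma intertwiner_neq m n (s : gT -> 'M[C]_m) (r : gT -> 'M[C]_n) c :
  unirep G s -> unirep G r -> irreducible s -> irreducible r -> m != n ->
  intertwiner s r c -> c = 0.
Proof.
move=> us ur irs irr; rewrite neq_ltn => /orP[mn|mn] ic.
  exact: intertwiner_lt ic.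
have := intertwiner_lt irs mn (intertwiner_adj us ur ic).
by move/(congr1 (fun X => X^t*)); rewrite trmxCK trmx0 map_mx0.
Qed.

Lemma intertwiner_gt m n (s : gT -> 'M[C]_m) (r : gT -> 'M[C]_n) c :
  unirep G s -> unirep G r -> irreducible s -> (n < m)%N ->
  intertwiner s r c -> c = 0.
Proof.
move=> us ur irs mn ic.
have := intertwiner_lt irs mn (intertwiner_adj us ur ic).
by move/(congr1 (fun X => X^t*)); rewrite trmxCK trmx0 map_mx0.
Qed.

Variables (F : finType) (key : gT -> F).
Hypothesis fq : finite_quotient G key.

Local Notation mean := (mean G key).
Local Notation factors := (factors G key).

(** Averaging turns an arbitrary matrix [Z] into an intertwiner, to which Schur's lemma applies. *)
Definition conj_mean m n (s : gT -> 'M[C]_m) (r : gT -> 'M[C]_n) (Z : 'M[C]_(m, n)) :=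
  mean (fun g => (s g)^t* *m Z *m r g).

Lemma conj_mean_intertwiner m n (s : gT -> 'M[C]_m) (r : gT -> 'M[C]_n) Z :
  unirep G s -> unirep G r -> factors s -> factors r ->
  intertwiner s r (conj_mean s r Z).
Proof.
move=> us ur fs fr h Gh; have uh := unirepU us Gh.
have e : conj_mean s r Z = (s h)^t* *m conj_mean s r Z *m r h.
  rewrite -[LHS](mean_shiftr sG fq _ Gh); last first.
    by move=> g g' Gg Gg' e; rewrite (fs _ _ Gg Gg' e) (fr _ _ Gg Gg' e).
  rewrite [RHS](@mean_morph _ _ _ _ _ _ _ (fun X => (s h)^t* *m X *m r h)); last first.
    by move=> a u v; rewrite mulmxDr mulmxDl -scalemxAr -scalemxAl.
  apply: eq_mean => g Gg; rewrite (unirepM us)// (unirepM ur)//.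
  by rewrite trmx_mul map_mxM !mulmxA.
by rewrite [in LHS]e !mulmxA (unitarymxP uh) mul1mx.
Qed.

(* The image under r of dim(s) times the average of tr (N s(g)^* ) g: it acts as
   N on the copies of s in r and as 0 on the other irreducible constituents. *)
Definition fourier_op m n (s : gT -> 'M[C]_m) (r : gT -> 'M[C]_n) (N : 'M[C]_m) :=
  mean (fun g => (m%:R * \tr (N *m (s g)^t*)) *: r g).

(** The entries are expressed through averages of matrix units, so that what Schur's lemma says of
    intertwiners determines [fourier_op]. *)
Lemma fourier_op_entry m n (s : gT -> 'M[C]_m) (r : gT -> 'M[C]_n) N i j :
  fourier_op s r N i j =
  m%:R * \sum_a \sum_b N a b * conj_mean s r (delta_mx a i) b j.
Proof.
pose t a b x := ((s (key_lift G key x))^t* *m delta_mx a i *m r (key_lift G key x)) b j.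
have tE a b x : t a b x = ((s (key_lift G key x))^t*) b a * r (key_lift G key x) i j.
  rewrite /t -mulmxA mxE (bigD1 a)//= big1 ?addr0 => [|k ka].
    rewrite !mxE (bigD1 i)//= big1 ?addr0 => [|l li]; first by rewrite !mxE !eqxx mul1r.
    by rewrite !mxE (negbTE li) andbF mul0r.
  by rewrite [X in _ * X]mxE big1 ?mulr0// => l _; rewrite !mxE (negbTE ka) mul0r.
rewrite /fourier_op /conj_mean /mean mxE summxE.
set k := _^-1.
under [in RHS]eq_bigr => a _ do under eq_bigr => b _ do rewrite mxE summxE.
rewrite -/(t _ _ _).
have -> : \sum_a \sum_b N a b * (k * \sum_(x in key_image G key) t a b x) =
    k * \sum_(x in key_image G key) \sum_a \sum_b N a b * t a b x.
  rewrite [in RHS]exchange_big mulr_sumr; apply: eq_bigr => a _.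
  rewrite exchange_big mulr_sumr; apply: eq_bigr => b _.
  by rewrite mulrCA mulr_sumr.
rewrite mulrCA; congr (_ * _); rewrite mulr_sumr; apply: eq_bigr => x _.
rewrite mxE -mulrA; congr (_ * _); rewrite /mxtrace mulr_suml.
apply: eq_bigr => a _; rewrite mxE mulr_suml; apply: eq_bigr => b _.
by rewrite tE mulrA.
Qed.

Lemma fourier_op_eq0 m n (s : gT -> 'M[C]_m) (r : gT -> 'M[C]_n) N :
  (forall c, intertwiner s r c -> c = 0) ->
  unirep G s -> unirep G r -> factors s -> factors r -> fourier_op s r N = 0.
Proof.
move=> int0 us ur fs fr; apply/matrixP => i j; rewrite fourier_op_entry mxE.
rewrite big1 ?mulr0// => a _; rewrite big1// => b _.
by rewrite (int0 _ (conj_mean_intertwiner _ us ur fs fr)) mxE mulr0.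
Qed.

(** The average of a matrix unit [delta_mx a i] is scalar by Schur's lemma and keeps its trace, so
    it is [1 / n] times the identity if [a = i] and 0 otherwise. The factor [n] in [fourier_op]
    cancels the denominator. *)
Lemma fourier_op_self n (s : gT -> 'M[C]_n) N : irreducible s ->
  unirep G s -> factors s -> fourier_op s s N = N.
Proof.
move=> irs us fs; have [n0 _] := irs.
have n0' : n%:R != 0 :> C by rewrite pnatr_eq0 -lt0n.
have cE a i : conj_mean s s (delta_mx a i) = ((a == i)%:R / n%:R)%:M.
  have /is_scalar_mxP[x cx] := intertwiner_scalar irs
    (conj_mean_intertwiner (delta_mx a i) us us fs fs).
  have : \tr (conj_mean s s (delta_mx a i)) = (a == i)%:R.
    rewrite [LHS](@mean_morph _ _ _ _ _ _ C^o (@mxtrace C n)); last first.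
      by move=> k u v; rewrite mxtraceD mxtraceZ.
    rewrite -[RHS](mean_cst sG key (_ : C^o)); apply: eq_mean => g Gg.
    rewrite -mulmxA mxtrace_mulC -mulmxA (unitarymxP (unirepU us Gg)) mulmx1.
    rewrite /mxtrace (bigD1 i)//= big1 ?addr0 => [|l li]; rewrite mxE.
      by rewrite eqxx andbT eq_sym.
    by rewrite (negbTE li) andbF.
  rewrite cx mxtrace_scalar => xn; congr (_%:M).
  by rewrite -xn -[x *+ n]mulr_natr mulfK.
apply/matrixP => i j; rewrite fourier_op_entry.
rewrite (bigD1 i)//= [X in _ + X]big1 ?addr0 => [|a ai]; last first.
  by rewrite big1// => b _; rewrite cE (negbTE ai) mul0r mxE mul0rn mulr0.
rewrite (bigD1 j)//= [X in _ + X]big1 ?addr0 => [|b bj]; last first.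
  by rewrite cE mxE (negbTE bj) mulr0n mulr0.
by rewrite cE !mxE !eqxx mulr1n mul1r mulrCA mulfV ?mulr1.
Qed.

Lemma intertwine_fourier_op m n p (s : gT -> 'M[C]_m) (r : gT -> 'M[C]_n)
    (r' : gT -> 'M[C]_p) c N : intertwiner r r' c ->
  c *m fourier_op s r' N = fourier_op s r N *m c.
Proof.
move=> ic; rewrite (@mean_morph _ _ _ _ _ _ _ (mulmx c)); last first.
  by move=> a u v; rewrite mulmxDr -scalemxAr.
rewrite [RHS](@mean_morph _ _ _ _ _ _ _ (fun X => X *m c)); last first.
  by move=> a u v; rewrite mulmxDl -scalemxAl.
by apply: eq_mean => g Gg; rewrite -scalemxAr -scalemxAl ic.
Qed.

Lemma factors_fourier m n (s : gT -> 'M[C]_m) (r : gT -> 'M[C]_n) N :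
  factors s -> factors r -> factors (fun g => (m%:R * \tr (N *m (s g)^t*)) *: r g).
Proof. by move=> fs fr g g' Gg Gg' e; rewrite (fs _ _ Gg Gg' e) (fr _ _ Gg Gg' e). Qed.

(** The substitution of [g^-1] for [g] in the average exchanges [s g] and [r g] with their
    adjoints. *)
Lemma fourier_op_adj m n (s : gT -> 'M[C]_m) (r : gT -> 'M[C]_n) N :
  unirep G s -> unirep G r -> factors s -> factors r ->
  (fourier_op s r N)^t* = fourier_op s r (N^t*).
Proof.
move=> us ur fs fr; rewrite -[RHS](mean_inv sG fq (factors_fourier _ fs fr)).
have adjZ a (X : 'M[C]_n) : (a *: X)^t* = a^* *: X^t*.
  by rewrite linearZ map_mxZ.
have adjD (X Y : 'M[C]_n) : (X + Y)^t* = X^t* + Y^t*.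
  by rewrite linearD map_mxD.
have adj0 : (0 : 'M[C]_n)^t* = 0 by rewrite trmx0 map_mx0.
rewrite /fourier_op /mean adjZ (big_morph (fun X : 'M[C]_n => X^t*) adjD adj0).
congr (_ *: _); first by rewrite fmorphV rmorph_nat.
apply: eq_bigr => x /key_liftP[Gx _]; set g := key_lift G key x in Gx *.
rewrite adjZ (unirepV sG ur Gx); congr (_ *: _).
rewrite rmorphM rmorph_nat; congr (_ * _).
rewrite [LHS](_ : _ = \tr ((N *m (s g)^t*)^t*)); last first.
  by rewrite /mxtrace rmorph_sum; apply: eq_bigr => i _; rewrite !mxE.
by rewrite trmx_mul map_mxM trmxCK mxtrace_mulC (unirepV sG us Gx) trmxCK.
Qed.

(** After a translation by [g] in the inner average, the sum over [g] moves into the trace, where it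
    becomes [fourier_op s' s N']. This is known when [s'] and [s] are equal or have different
    degrees. *)
Lemma fourier_op_mul m m' n (s : gT -> 'M[C]_m) (s' : gT -> 'M[C]_m')
    (r : gT -> 'M[C]_n) N N' :
  unirep G s -> unirep G r -> factors s -> factors r ->
  fourier_op s' r N' *m fourier_op s r N =
  mean (fun h => (m%:R * \tr (N *m (s h)^t* *m fourier_op s' s N')) *: r h).
Proof.
move=> us ur fs fr; have [_ GM GV] := sG.
rewrite [LHS](@mean_morph _ _ _ _ _ _ _ (fun X => X *m fourier_op s r N)); last first.
  by move=> a u v; rewrite mulmxDl -scalemxAl.
transitivity (mean (fun g => mean (fun h =>
    (m'%:R * \tr (N' *m (s' g)^t*)) *: ((m%:R * \tr (N *m (s h)^t* *m s g)) *: r h)))).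
  apply: eq_mean => g Gg; rewrite -scalemxAl.
  rewrite -[RHS](@mean_morph _ _ _ _ _ _ _ (fun X => (m'%:R * \tr (N' *m (s' g)^t*)) *: X)); last first.
    by move=> a u v; rewrite scalerDr !scalerA mulrC.
  congr (_ *: _).
  rewrite (@mean_morph _ _ _ _ _ _ _ (mulmx (r g))); last first.
    by move=> a u v; rewrite mulmxDr -scalemxAr.
  rewrite -[RHS](mean_shiftl sG fq _ Gg); last first.
    by move=> x y Gx Gy e; rewrite (fs _ _ Gx Gy e) (fr _ _ Gx Gy e).
  apply: eq_mean => h Gh; rewrite (unirepM us)// (unirepM ur)// -scalemxAr.
  rewrite trmx_mul map_mxM -!mulmxA; congr ((_ * \tr (_ *m _)) *: _).
  have gg : (s g)^t* *m s g = 1%:M by apply/mulmx1C/unitarymxP/(unirepU us).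
  by rewrite gg mulmx1.
rewrite mean_exchange; apply: eq_mean => h Gh.
rewrite (@mean_morph _ _ _ _ _ _ _ (fun X => (m%:R * \tr (N *m (s h)^t* *m X)) *: r h)); last first.
  by move=> a u v; rewrite mulmxDr -scalemxAr mxtraceD mxtraceZ mulrDr scalerDl scalerA mulrCA.
apply: eq_mean => g Gg; rewrite scalerA -scalemxAr mxtraceZ; congr (_ *: _).
by rewrite mulrCA.
Qed.

Lemma fourier_op_mul_same n p (s : gT -> 'M[C]_n) (r : gT -> 'M[C]_p) N N' :
  irreducible s -> unirep G s -> unirep G r -> factors s -> factors r ->
  fourier_op s r N' *m fourier_op s r N = fourier_op s r (N' *m N).
Proof.
move=> irs us ur fs fr; rewrite fourier_op_mul// fourier_op_self//.
by apply: eq_mean => g Gg; rewrite mxtrace_mulC mulmxA.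
Qed.

Lemma fourier_op_mul_neq m m' n (s : gT -> 'M[C]_m) (s' : gT -> 'M[C]_m')
    (r : gT -> 'M[C]_n) N N' : irreducible s -> irreducible s' -> m != m' ->
  unirep G s -> unirep G s' -> unirep G r -> factors s -> factors s' -> factors r ->
  fourier_op s' r N' *m fourier_op s r N = 0.
Proof.
move=> irs irs' mm' us us' ur fs fs' fr; rewrite fourier_op_mul//.
rewrite (@fourier_op_eq0 _ _ s' s)//; last first.
  by move=> c; apply: intertwiner_neq => //; rewrite eq_sym.
rewrite -[RHS](mean_cst sG key); apply: eq_mean => g Gg.
by rewrite mulmx0 mxtrace0 mulr0 scale0r.
Qed.

End SchurOrthogonality.

(** * Operators and matrices *)

Section FiniteLevels.
Local Open Scope complex_scope.
Context {R : realType} {I : finType}.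
Implicit Types (xi eta : l2 R I).

(** Elements of [l2 R I] become row vectors, so that operators act by right multiplication and
    subspaces are row spaces. *)
Definition vec xi : 'rV[R[i]]_#|I| := \row_i xi (enum_val i).

Definition unvec (v : 'rV[R[i]]_#|I|) : l2 R I :=
  L2 (fin_square_summable (fun t => v 0 (enum_rank t))).

Lemma vecK : cancel vec unvec.
Proof.
by move=> xi; apply: val_inj; apply/funext => t /=; rewrite mxE enum_rankK.
Qed.

Lemma unvecK : cancel unvec vec.
Proof. by move=> v; apply/rowP => i; rewrite mxE /= enum_valK. Qed.

Lemma vecP a xi eta : vec (a *: xi + eta) = a *: vec xi + vec eta.
Proof. by apply/rowP => i; rewrite !mxE. Qed.

Lemma vecZ a xi : vec (a *: xi) = a *: vec xi.
Proof. by apply/rowP => i; rewrite !mxE. Qed.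

Lemma vecB xi eta : vec (xi - eta) = vec xi - vec eta.
Proof. by apply/rowP => i; rewrite !mxE. Qed.

Lemma unvecP a u v : unvec (a *: u + v) = a *: unvec u + unvec v.
Proof. by apply: (can_inj vecK); rewrite vecP !unvecK. Qed.

Lemma sqn_vec xi : sqn (vec xi) = (l2norm xi ^+ 2)%:C.
Proof.
rewrite l2norm_sqr /sqsum esum_fset; last 2 first.
- exact: finite_finset.
- by move=> t _; rewrite lee_fin sqr_ge0.
rewrite fsbig_finite/=; last exact: finite_finset.
rewrite sumEFin /= sqnE rmorph_sum /=.
transitivity (\sum_(t : I) (Normc.normc (xi t) ^+ 2)%:C).
  rewrite (reindex (@enum_val I I)); last first.
    by exists enum_rank => t _; rewrite ?enum_valK ?enum_rankK.
  apply: eq_bigr => i _; rewrite mxE rmorphXn /=.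
  by case: (xi _).
rewrite [RHS](perm_big (index_enum I))//.
apply: uniq_perm; rewrite ?index_enum_uniq ?finmap.fset_uniq// => t.
rewrite mem_index_enum in_fset_set; last exact: finite_finset.
by rewrite in_setT.
Qed.

Lemma l2norm_le_sqn xi eta (c : R) : 0 <= c -> l2norm xi <= c * l2norm eta ->
  sqn (vec xi) <= (c ^+ 2)%:C * sqn (vec eta).
Proof.
move=> c0 le; rewrite !sqn_vec -(rmorphM (real_complex R)) lecR -exprMn.
by rewrite ler_pXn2r ?nnegrE ?mulr_ge0 ?l2norm_ge0.
Qed.

Lemma linear_matrix (T : l2 R I -> l2 R I) : linear T ->
  exists B, forall xi, vec (T xi) = vec xi *m B.
Proof.
move=> linT; pose f v := vec (T (unvec v)).
have flin : linear f by move=> a u v; rewrite /f unvecP linT vecP.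
pose fL : {linear _ -> _} := HB.pack f (GRing.isLinear.Build _ _ _ _ f flin).
exists (lin1_mx fL) => xi; rewrite mul_rV_lin1.
by rewrite -[RHS]/(f (vec xi)) /f vecK.
Qed.

Definition mxop (B : 'M[R[i]]_#|I|) xi : l2 R I := unvec (vec xi *m B).

Lemma mxop_linear B : linear (mxop B).
Proof. by move=> a u v; rewrite /mxop vecP mulmxDl -scalemxAl unvecP. Qed.

End FiniteLevels.

Section OperatorNorms.
Local Open Scope complex_scope.
Context {R : realType} {V : choiceType}.
Implicit Types (T S : l2 R V -> l2 R V).

Lemma bounded_opP T : bounded_op T <-> linear T /\
  exists2 M : R, 0 <= M & forall xi, l2norm (T xi) <= M * l2norm xi.
Proof.
split=> [[linT bT]|[linT [M M0 TM]]]; split=> //.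
  have [M M0 TM] : exists2 M : R, 0 <= M & (opnorm T <= M%:E)%E.
    exists (fine (maxe 0%E (opnorm T))); first by rewrite fine_ge0// le_max lexx.
    rewrite fineK ?le_max ?lexx ?orbT// ge0_fin_numE ?le_max ?lexx//.
    by rewrite gt_max ltry.
  by exists M => // xi; exact: opnorm_bound.
apply: (@le_lt_trans _ _ M%:E); last exact: ltry.
apply: ge_ereal_sup => _ [xi xi1 <-]; rewrite lee_fin (le_trans (TM _))//.
by rewrite -[leRHS]mulr1 ler_wpM2l.
Qed.

Lemma linear0_fun (U W : lmodType R[i]) (f : U -> W) : linear f -> f 0 = 0.
Proof.
move=> fl; have := fl 1 0 0; rewrite !scale1r add0r => /eqP.
by rewrite -subr_eq subrr => /eqP.
Qed.

Lemma not_spectrum T z : ~ spectrum T z <-> exists S, [/\ bounded_op S,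
  forall xi, S (T xi - z *: xi) = xi & forall xi, T (S xi) - z *: S xi = xi].
Proof.
split=> [/contrapT[S [bS e1 e2]]|[S [bS e1 e2]]].
  exists S; split=> // xi; first by have := congr1 (fun f => f xi) e1.
  by have := congr1 (fun f => f xi) e2.
apply; exists S; split=> //; apply/funext => xi; [exact: e1|exact: e2].
Qed.

End OperatorNorms.

Section FiniteSpectrum.
Local Open Scope complex_scope.
Context {R : realType} {I : finType}.
Variables (T : l2 R I -> l2 R I) (B : 'M[R[i]]_#|I|).
Hypothesis TB : forall xi, vec (T xi) = vec xi *m B.

(** By Cauchy-Schwarz on the columns, the Frobenius norm of the matrix bounds the operator. *)
Lemma linear_bounded (S : l2 R I -> l2 R I) : linear S -> bounded_op S.
Proof.
move=> linS; apply/bounded_opP; split=> //; have [D SD] := linear_matrix linS.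
exists (Num.sqrt (complex.Re (frob D))); first exact: sqrtr_ge0.
move=> xi; rewrite -(@ler_pXn2r _ 2)// ?nnegrE ?mulr_ge0 ?sqrtr_ge0 ?l2norm_ge0//.
have rD : (complex.Re (frob D))%:C = frob D by apply/RRe_real/ger0_real/frob_ge0.
have D0 : 0 <= complex.Re (frob D) by rewrite -ler0c rD frob_ge0.
rewrite exprMn (sqr_sqrtr D0) -lecR [leRHS](rmorphM (real_complex R)) /= rD -!sqn_vec SD mulrC.
have -> : sqn (vec xi *m D) = \sum_j `|(vec xi *m D) 0 j| ^+ 2 by exact: sqnE.
rewrite frobE exchange_big mulr_sumr; apply: ler_sum => j _ /=.
have -> : (vec xi *m D) 0 j = dotmx (vec xi) (\row_k (D k j)^*).
  rewrite dotmxE !mxE; apply: eq_bigr => k _.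
  by rewrite !mxE conjCK.
apply: le_trans (dotmx_sqr_le _ _) _.
rewrite ler_wpM2l ?sqn_ge0// sqnE; apply: ler_sum => k _.
by rewrite mxE norm_conjC.
Qed.

Lemma finite_spectrumP z : spectrum T z <->
  exists2 v : 'rV_#|I|, v != 0 & v *m B = z *: v.
Proof.
split=> [Tz|[v v0 vz]]; last first.
  apply: contrapT => /not_spectrum[S [[linS _] e _]]; move/eqP: v0; apply.
  have Tv : T (unvec v) = z *: unvec v.
    by apply: (can_inj vecK); rewrite TB vecZ unvecK vz.
  have := e (unvec v); rewrite Tv subrr (linear0_fun linS).
  move=> /(congr1 vec); rewrite unvecK => <-.
  by apply/rowP => i; rewrite !mxE.
apply: contrapT => nv; move: Tz; apply/not_spectrum.
have Bz : B - z%:M \in unitmx.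
  rewrite -row_free_unit -kermx_eq0; apply: contraT => /rowV0Pn[v vk v0].
  case: nv; exists v => //; have /sub_kermxP := vk.
  by rewrite mulmxBr mul_mx_scalar => /eqP; rewrite subr_eq0 => /eqP.
exists (mxop (invmx (B - z%:M))); split.
- exact/linear_bounded/mxop_linear.
- move=> xi; rewrite /mxop; apply: (can_inj vecK); rewrite unvecK.
  have -> : vec (T xi - z *: xi) = vec xi *m (B - z%:M).
    by rewrite mulmxBr mul_mx_scalar -TB vecB vecZ.
  by rewrite mulmxK.
- move=> xi; apply: (can_inj vecK).
  have -> eta : vec (T eta - z *: eta) = vec eta *m (B - z%:M).
    by rewrite mulmxBr mul_mx_scalar -TB vecB vecZ.
  by rewrite unvecK mulmxKV.
Qed.

End FiniteSpectrum.

(** * Block diagonal operators on the tree and their spectrum *)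

Section BlockOperators.
Local Open Scope complex_scope.
Context {R : realType} {d : nat}.
Implicit Types (xi eta : l2 R (word d)) (x y : level_ops R d).

Lemma level_projP n a xi eta :
  level_proj n (a *: xi + eta) = a *: level_proj n xi + level_proj n eta.
Proof. exact: val_inj. Qed.

Lemma level_projB n a xi eta :
  level_proj n (xi - a *: eta) = level_proj n xi - a *: level_proj n eta.
Proof. exact: val_inj. Qed.

Lemma level_injP n a (u v : l2 R (level d n)) :
  level_inj (a *: u + v) = a *: level_inj u + level_inj v.
Proof.
apply: val_inj; apply/funext => w /=.
rewrite -[RHS]/(a * level_inj u w + level_inj v w) /=.
by case: insub => //; rewrite mulr0 addr0.
Qed.

Lemma level_projK n (u : l2 R (level d n)) : level_proj n (level_inj u) = u.
Proof. by apply: val_inj; apply/funext => t /=; rewrite valK. Qed.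

Lemma level_proj_neq m n (u : l2 R (level d n)) : m != n ->
  level_proj m (level_inj u) = 0.
Proof.
move=> mn; apply: val_inj; apply/funext => t /=.
by rewrite insubF// size_tuple; exact/negbTE.
Qed.

Lemma level_ext xi eta : (forall n, level_proj n xi = level_proj n eta) -> xi = eta.
Proof.
move=> e; apply: val_inj; apply/funext => w.
by have := congr1 (fun f => f (in_tuple w)) (congr1 (@l2val _ _) (e (size w))).
Qed.

Lemma l2norm_level_inj n (u : l2 R (level d n)) : l2norm (level_inj u) = l2norm u.
Proof. by rewrite /l2norm sqsum_extend. Qed.

Definition block_for y (S : l2 R (word d) -> l2 R (word d)) :=
  forall n xi, level_proj n (S xi) = y n (level_proj n xi).

(** The value at a word is read off the block of its length; summing the squared norms over the
    levels gives square summability. *)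
Lemma block_exists y (M : R) : 0 <= M ->
  (forall n u, l2norm (y n u) <= M * l2norm u) -> exists S, block_for y S.
Proof.
move=> M0 yM.
suff sq xi : (fun w : word d => y (size w) (level_proj (size w) xi) (in_tuple w))
    \in @square_summable R (word d).
  exists (fun xi => L2 (sq xi)) => n xi; apply: val_inj; apply/funext => -[w wn] /=.
  move: (wn); rewrite -(eqP wn) => wn'.
  by congr (l2val _ _); exact: val_inj.
set f := (X in X \in _).
have fE n (t : level d n) : f (val t) = y n (level_proj n xi) t.
  case: t => s sn /=; rewrite /f; move: (sn); rewrite -(eqP sn) => sn'.
  by congr (l2val _ _); exact: val_inj.
apply/asboolP; apply: (@le_lt_trans _ _ ((M ^+ 2)%:E * sqsum xi)%E); last first.
  by rewrite lte_mul_pinfty ?lee_fin ?sqr_ge0//; exact/asboolP/l2valP.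
rewrite !sqsum_levels -nneseriesZl//; last by move=> n _; exact: sqsum_ge0.
apply: lee_nneseries => [n _ _|n _]; first exact: sqsum_ge0.
have -> : (fun t : level d n => f (val t)) = y n (level_proj n xi) by exact/funext.
have := yM n (level_proj n xi).
rewrite -(@ler_pXn2r _ 2)// ?nnegrE ?mulr_ge0 ?l2norm_ge0//.
by rewrite exprMn !l2norm_sqr -lee_fin EFinM !fineK ?sqsum_fin.
Qed.

Lemma block_bounded y S (M : R) : 0 <= M -> (forall n, linear (y n)) ->
  (forall n u, l2norm (y n u) <= M * l2norm u) -> block_for y S -> bounded_op S.
Proof.
move=> M0 yl yM yS; apply/bounded_opP; split.
  by move=> a xi eta; apply: level_ext => n; rewrite level_projP !yS level_projP yl.
exists M => // xi; apply: l2norm_le => //.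
rewrite (sqsum_levels (S xi)) (sqsum_levels xi) -nneseriesZl//; last first.
  by move=> n _; exact: sqsum_ge0.
apply: lee_nneseries => [n _ _|n _]; first exact: sqsum_ge0.
have := yM n (level_proj n xi); rewrite -yS.
rewrite -(@ler_pXn2r _ 2)// ?nnegrE ?mulr_ge0 ?l2norm_ge0//.
by rewrite exprMn !l2norm_sqr -lee_fin EFinM !fineK ?sqsum_fin.
Qed.

Lemma Salg_linear G x n : Salg G x -> linear (x n).
Proof. by case=> Rx _ _; exact: linear_Ralg (Rx n). Qed.

Lemma Salg_bound G x : Salg G x ->
  exists2 M : R, 0 <= M & forall n u, l2norm (x n u) <= M * l2norm u.
Proof.
move=> Sx; have [Rx _ supx] := Sx.
have [M M0 xM] : exists2 M : R, 0 <= M & forall n, (opnorm (x n) <= M%:E)%E.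
  exists (fine (maxe 0%E (ereal_sup (range (fun n => opnorm (x n)))))).
    by rewrite fine_ge0// le_max lexx.
  move=> n; rewrite fineK; last first.
    by rewrite ge0_fin_numE ?le_max ?lexx// gt_max ltry.
  by rewrite le_max; apply/orP; right; apply: ereal_sup_ubound; exists n.
by exists M => // n u; apply: opnorm_bound => //; exact: Salg_linear Sx.
Qed.

Lemma strong_sum_block G x : Salg G x -> block_for x (strong_sum x).
Proof.
move=> Sx n xi; apply: val_inj; apply/funext => t; apply/eqP.
rewrite -subr_eq0; apply/eqP/Normc.eq0_normc/eqP.
rewrite eq_le normc_ge0 andbT; apply/ler_addgt0Pr => e e0; rewrite add0r.
have /cvgrPdist_le/(_ e e0)[N _ HN] := strong_sum_cvg xi Sx.
(* From [n.+1] terms on, the partial sum contains level [n], so its value at [t] no longer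
   changes. *)
have := HN (maxn N n.+1) (leq_maxl _ _); rewrite sub0r normrN ger0_norm ?l2norm_ge0//.
apply: le_trans; apply: le_trans (normc_le_l2norm _ (val t)).
rewrite le_eqVlt; apply/orP; left; apply/eqP; congr Normc.normc.
rewrite -[RHS]/(strong_sum x xi (val t) -
  (\sum_(k < maxn N n.+1) level_inj (x k (level_proj k xi))) (val t)).
congr (_ - _); rewrite (sum_level_inj (fun k => x k (level_proj k xi))).
have -> : (size (val t) < maxn N n.+1)%N = true by rewrite size_tuple leq_maxr.
case: t => w wn /=; move: (wn).
by rewrite -(eqP wn) => wn'; congr (l2val _ _); exact: val_inj.
Qed.

Lemma strong_sum_inj G x n u : Salg G x ->
  strong_sum x (level_inj u) = level_inj (x n u).
Proof.
move=> Sx; apply: level_ext => m; rewrite (strong_sum_block Sx).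
have [->|mn] := eqVneq m n; first by rewrite !level_projK.
by rewrite !level_proj_neq// (linear0_fun (Salg_linear (n := m) Sx)).
Qed.

Lemma norm_normc (z : R[i]) : `|z| = (Normc.normc z)%:C.
Proof. by case: z. Qed.

(** If [T - z] has an inverse of norm at most [C], an eigenvalue [l] of a block satisfies
    [1 <= C |z - l|], as seen on an eigenvector extended by 0. No eigenvalue of a block is then
    closer to [z] than [1 / (C + 1)]. *)
Lemma closure_spectrum_sub G x : Salg G x ->
  closure (\bigcup_n spectrum (x n) : set R[i]^o) `<=` spectrum (strong_sum x).
Proof.
move=> Sx z clz; apply: contrapT => /not_spectrum[S [bS e _]].
have [_ [C C0 SC]] := (bounded_opP S).1 bS.
pose r := (C + 1)^-1; have r0 : 0 < r by rewrite invr_gt0 ltr_wpDl.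
have [l [[n _ xl] zl]] : (\bigcup_n spectrum (x n) : set R[i]^o) `&`
    [set l | Normc.normc (z - l) < r] !=set0.
  apply: clz; apply/nbhs_ballP; exists r%:C; first by rewrite /= ltcR.
  by move=> l; rewrite /ball /= norm_normc ltcR.
have [B xB] := linear_matrix (Salg_linear (n := n) Sx).
have [v v0 vl] := (finite_spectrumP xB l).1 xl.
pose xi := level_inj (unvec v).
have xl' : strong_sum x xi = l *: xi.
  rewrite (strong_sum_inj _ Sx); have -> : x n (unvec v) = l *: unvec v.
    by apply: (can_inj vecK); rewrite xB vecZ unvecK vl.
  by rewrite -[l *: unvec v]addr0 level_injP (linear0_fun (@level_injP n)) addr0.
have := SC (strong_sum x xi - z *: xi); rewrite e xl' -scalerBl => le.
have xi0 : 0 < l2norm xi.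
  rewrite lt_def l2norm_ge0 andbT; apply: contra v0 => /eqP/l2norm_eq0 xi0.
  have : unvec v = 0 by rewrite -[unvec v]level_projK -/xi xi0 (linear0_fun (@level_projP n)).
  by move/(congr1 vec); rewrite unvecK => ->; apply/eqP/rowP => i; rewrite !mxE.
have {}le := le_trans le (ler_wpM2l C0 (l2normZ_le (l - z) xi)).
move: le; rewrite mulrA -{1}[l2norm xi]mul1r ler_pM2r// -normcN opprB => le.
have : C * Normc.normc (z - l) <= C * r by rewrite ler_wpM2l// ltW.
move/(le_trans le); rewrite /r ler_pdivlMr ?ltr_wpDl// mul1r.
by move/(lt_le_trans (ltr_pwDr ltr01 (lexx C))); rewrite ltxx.
Qed.

(** The lower bound makes every block of [x - z] invertible with an inverse of norm at most the
    square root of [c]; a bound common to all levels lets the inverses assemble into a bounded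
    operator. *)
Lemma not_spectrum_strong_sum G x (B : forall n, 'M[R[i]]_#|level d n|) z (c : R) :
  Salg G x -> (forall n u, vec (x n u) = vec u *m B n) -> 0 <= c ->
  (forall n v, sqn v <= c%:C * sqn (v *m (B n - z%:M))) ->
  ~ spectrum (strong_sum x) z.
Proof.
move=> Sx xB c0 low; apply/not_spectrum.
have Bz n : B n - z%:M \in unitmx.
  rewrite -row_free_unit -kermx_eq0; apply: contraT => /rowV0Pn[v /sub_kermxP vk].
  have := low n v; rewrite vk sqn0 mulr0 => le.
  by rewrite -sqn_eq0 eq_le le sqn_ge0.
pose y n := mxop (invmx (B n - z%:M)).
have yM n u : l2norm (y n u) <= Num.sqrt c * l2norm u.
  rewrite -(@ler_pXn2r _ 2)// ?nnegrE ?mulr_ge0 ?sqrtr_ge0 ?l2norm_ge0//.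
  rewrite exprMn (sqr_sqrtr c0) -lecR [leRHS](rmorphM (real_complex R)) /= -!sqn_vec.
  by apply: le_trans (low n _) _; rewrite /y /mxop unvecK (mulmxKV (Bz n)).
have [S yS] := block_exists (sqrtr_ge0 c) yM.
exists S; split.
- by apply: (block_bounded (sqrtr_ge0 c) _ yM yS) => n; exact: mxop_linear.
- move=> xi; apply: level_ext => n; rewrite yS level_projB (strong_sum_block Sx).
  apply: (can_inj vecK); rewrite unvecK vecB vecZ xB.
  by rewrite -mul_mx_scalar -mulmxBr (mulmxK (Bz n)).
- move=> xi; apply: level_ext => n; rewrite level_projB (strong_sum_block Sx) yS.
  apply: (can_inj vecK); rewrite vecB vecZ xB unvecK.
  by rewrite -mul_mx_scalar -mulmxBr (mulmxKV (Bz n)).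
Qed.

Lemma not_closure_far (A : set R[i]^o) z : ~ closure A z ->
  exists2 e : R, 0 < e & forall l, A l -> e%:C <= `|l - z| ^+ 2.
Proof.
move=> ncl; apply: contrapT => nfar; apply: ncl => U /nbhs_ballP[e /= e0 eU].
have [e' e'0 ee'] : exists2 e' : R, 0 < e' & e = e'%:C.
  by exists (complex.Re e); [rewrite -ltcR RRe_real ?gtr0_real | rewrite RRe_real ?gtr0_real].
apply: contrapT => nU; apply: nfar; exists (e' ^+ 2); first exact: exprn_gt0.
move=> l Al; rewrite rmorphXn /= lerXn2r ?nnegrE ?normr_ge0 ?ler0c ?(ltW e'0)//.
rewrite real_leNgt ?normr_real ?gtr0_real// -?ee'//.
apply/negP => lz; apply: nU; exists l; split=> //; apply: eU.
by rewrite /ball /= distrC.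
Qed.

End BlockOperators.

(** * Levels decomposing into small subspaces *)

Section SmallSubspaces.
Local Open Scope sesquilinear_scope.
Context {C : numClosedFieldType}.
Implicit Types (n : nat).

Lemma stable_min n (S : 'M[C]_n -> Prop) W : stable S W -> W != 0 ->
  exists U, [/\ stable S U, U != 0, (U <= W)%MS &
    forall U', stable S U' -> U' != 0 -> (U' <= U)%MS -> (U <= U')%MS].
Proof.
move: {2}(\rank W) (leqnn (\rank W)) => r; elim: r W => [|r IH] W rW sW W0.
  by move: W0; rewrite -mxrank_eq0 -leqn0 rW.
have [[U' [sU' U'0 U'W nWU']]|nU] := pselect (exists U', [/\ stable S U',
    U' != 0, (U' <= W)%MS & ~ (W <= U')%MS]).
  have [|U [sU U0 UU' Um]] := IH U' _ sU' U'0.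
    rewrite -ltnS (leq_trans _ rW)// ltnNge; apply/negP => le; apply: nWU'.
    by rewrite -(geq_leqif (mxrank_leqif_sup U'W)).
  by exists U; split=> //; exact: submx_trans U'W.
exists W; split=> // U' sU' U'0 U'W; apply: contrapT => nWU'.
by apply: nU; exists U'.
Qed.

(** In a minimal stable [U], the intersection with an eigenspace of a member of [S] is stable by
    commutation, hence all of [U] once it is nonzero. So every nonzero vector of [U] is a common
    eigenvector. *)
Lemma common_eigen n (S : 'M[C]_n -> Prop) W :
  (forall A B, S A -> S B -> A *m B = B *m A) -> stable S W -> W != 0 ->
  exists v : 'rV_n, [/\ v != 0, (v <= W)%MS & forall A, S A -> exists l, v *m A = l *: v].
Proof.
move=> Scomm sW W0; have [U [sU U0 UW Um]] := stable_min sW W0.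
have [v vU v0] := rowV0Pn U0.
exists v; split=> //; first exact: submx_trans UW.
move=> A SA; have [l [u [u0 uU ul]]] := stable_eigen (sU _ SA) U0.
exists l; apply/eigenspaceP; apply: (submx_trans vU).
suff UE : (U <= U :&: eigenspace A l)%MS by exact: submx_trans UE (capmxSr _ _).
apply: Um; last exact: capmxSl.
- move=> B SB; rewrite sub_capmx.
  rewrite (submx_trans (submxMr B (capmxSl _ _)) (sU _ SB))/=.
  apply: (submx_trans (submxMr B (capmxSr _ _))).
  by apply: comm_mx_stable_eigenspace; exact: Scomm.
- apply/rowV0Pn; exists u => //; rewrite sub_capmx uU.
  by apply/eigenspaceP.
Qed.

(** The translates of a common eigenvector of [A] by coset representatives span a [G]-stable
    subspace; its dimension is at most the number [m] of representatives. *)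
Lemma virtually_abelian_small (gT : groupType) (G : set gT) :
  subgroup G -> virtually_abelian G -> exists m, forall n (s : gT -> 'M[C]_n),
    unirep G s -> forall W, stable (rep_set G s) W -> W != 0 ->
    exists U, [/\ stable (rep_set G s) U, U != 0, (U <= W)%MS & (\rank U <= m)%N].
Proof.
move=> sG [A [sA AG Acomm fin]]; have [G1 GM GV] := sG.
have [A1 AM AV] := sA.
have [t [tG tP]] : exists t : seq gT, (forall r, r \in t -> G r) /\
    forall g, G g -> exists2 r, r \in t & A (r^-1 * g)%g.
  have /finite_seqP[L LE] := fin.
  pose rep X := xget 1%g [set r | G r /\ [set (r * a)%g | a in A] = X].
  have repP X : X \in L -> G (rep X) /\ [set (rep X * a)%g | a in A] = X.
    move=> XL; have : [set` L] X by [].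
    rewrite -LE => -[g Gg gX].
    by apply: (xgetPex 1%g (P := [set r | G r /\ [set (r * a)%g | a in A] = X])); exists g.
  exists [seq rep X | X <- L]; split=> [r /mapP[X XL ->]|g Gg].
    by have [] := repP X XL.
  have XL : [set (g * a)%g | a in A] \in L.
    by have : [set` L] [set (g * a)%g | a in A]; [rewrite -LE; exists g|].
  exists (rep [set (g * a)%g | a in A]); first exact: map_f.
  have [_ eX] := repP _ XL.
  have : [set (rep [set (g * a)%g | a in A] * a)%g | a in A] g.
    by rewrite eX; exists 1%g => //; rewrite mulg1.
  by case=> a Aa e; rewrite -{2}e mulKg.
exists (size t) => n s rs W sW W0.
have rsA : unirep A s by exact: unirep_sub rs.
have [||v [v0 vW vA]] := common_eigen (S := rep_set A s) _ _ W0.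
- by move=> _ _ [a Aa ->] [b Ab ->]; rewrite -!(unirepM rsA)// Acomm.
- by move=> _ [a /AG Ga ->]; apply: sW; exists a.
(* The representatives [r] are those of left cosets while the action on rows is from the right,
   hence the inverses: any [h] in [G] is [a r^-1] with [a] in [A], and [v s(a)] is a multiple of
   [v]. *)
pose M := \matrix_(i < size t) (v *m s (nth 1%g t i)^-1%g).
have tGi (i : 'I_(size t)) : G (nth 1%g t i) by apply/tG/mem_nth.
have Mrow r : r \in t -> (v *m s r^-1%g <= M)%MS.
  move=> rt; have ir : (index r t < size t)%N by rewrite index_mem.
  by have := row_sub (Ordinal ir) M; rewrite rowK /= nth_index.
exists (genmx M); split.
- move=> _ [g Gg ->]; rewrite (eqmxMr _ (genmxE M)) genmxE.
  apply/row_subP => i; rewrite row_mul rowK -mulmxA.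
  rewrite -(unirepM rs)//; last exact: GV.
  set h := (_ * g)%g; have Gh : G h by apply: GM => //; exact: GV.
  have [r rt Ar] := tP _ (GV _ Gh).
  have -> : h = ((r^-1 * h^-1)^-1 * r^-1)%g by rewrite invgM !invgK mulgK.
  rewrite (unirepM rs); last 2 first.
  + by apply/AG/AV.
  + by apply/GV/tG.
  have [l vl] : exists l, v *m s ((r^-1 * h^-1)^-1)%g = l *: v.
    by apply: vA; exists ((r^-1 * h^-1)^-1)%g => //; exact: AV.
  by rewrite mulmxA vl -scalemxAl scalemx_sub// Mrow.
- have [r rt _] := tP _ G1; rewrite -mxrank_eq0 mxrank_gen mxrank_eq0.
  apply: contra v0 => /eqP M0; have := Mrow r rt; rewrite M0 => /submx0null e.
  have u : s r^-1%g \in unitmx by apply/unitarymx_unit/(unirepU rs)/GV/tG.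
  by rewrite -(mulmxK u v) e mul0mx.
- rewrite genmxE; apply/row_subP => i; rewrite rowK.
  apply: submx_trans (submxMr _ vW) _; apply: sW.
  by exists (nth 1%g t i)^-1%g => //; exact: GV.
- by rewrite mxrank_gen rank_leq_row.
Qed.

End SmallSubspaces.

(** * Equality of spectra from stable subspaces of bounded dimension *)

Section SpectrumEquality.
Local Open Scope sesquilinear_scope.
Context {R : realType} {d : nat} {G : set (tree_aut d)}.

Lemma RRe_ge0 (z : R[i]) : 0 <= z ->
  exists2 c : R, 0 <= c & z = (c%:C)%C.
Proof.
move=> z0; exists (complex.Re z); last by rewrite RRe_real ?ger0_real.
by rewrite -ler0c RRe_real ?ger0_real.
Qed.

(** For [z] away from all eigenvalues, [eig_lower_bound] bounds [x n - z] from below on each small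
    stable subspace with a constant independent of [n], and the bound passes to orthogonal sums. *)
Lemma small_spectrum_eq (x : level_ops R d)
    (B : forall n, 'M[R[i]]_#|level d n|) m
    (S : forall n, 'M[R[i]]_#|level d n| -> Prop) :
  Salg G x -> (forall n u, vec (x n u) = vec u *m B n) ->
  (forall n A, S n A -> S n (A^t*)) ->
  (forall n W, stable (S n) W -> stablemx W (B n)) ->
  (forall n W, stable (S n) W -> W != 0 ->
    exists U, [/\ stable (S n) U, U != 0, (U <= W)%MS & (\rank U <= m)%N]) ->
  spectrum (strong_sum x) = closure (\bigcup_n spectrum (x n) : set R[i]^o).
Proof.
move=> Sx xB Sadj SB small; apply/seteqP; split; last exact: closure_spectrum_sub Sx.
move=> z; apply: contraPP => /not_closure_far[e e0 far].
have [M M0 xM] := Salg_bound Sx.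
(* A bound for the squared norm of every [x n - z], coming from [sqn_add_le]. *)
pose M' : R[i] := 2 * ((M ^+ 2)%:C)%C + 2 * `|z| ^+ 2.
have M'0 : 0 <= M'.
  by rewrite addr_ge0 ?mulr_ge0 ?exprn_ge0// ler0c exprn_ge0.
have e0' : 0 < (e%:C)%C :> R[i] by rewrite ltcR.
have [c c0 cE] := RRe_ge0 (eig_const_ge0 m M'0 e0').
apply: (not_spectrum_strong_sum Sx xB c0) => n v; rewrite -cE.
pose D := B n - z%:M.
have sD W : stable (S n) W -> stablemx W D.
  move=> sW; rewrite mulmxBr addmx_sub ?SB// mul_mx_scalar -scaleNr.
  by rewrite scalemx_sub.
have DM w : sqn (w *m D) <= M' * sqn w.
  rewrite mulmxBr mul_mx_scalar -scaleNr; apply: le_trans (sqn_add_le _ _) _.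
  rewrite sqnZ normrN /M' [leRHS]mulrDl -!mulrA lerD2r ler_wpM2l//.
  have -> : w *m B n = vec (x n (unvec w)) by rewrite xB unvecK.
  rewrite -{2}[w]unvecK !sqn_vec -(rmorphM (real_complex R)) lecR -exprMn.
  by rewrite ler_pXn2r// ?nnegrE ?mulr_ge0 ?l2norm_ge0.
have Deig l (w : 'rV_#|level d n|) : w != 0 -> w *m D = l *: w ->
    (e%:C)%C <= `|l| ^+ 2.
  move=> w0 wl; rewrite -[l](addrK z); apply: far; exists n => //.
  apply/(finite_spectrumP (xB n)); exists w => //.
  rewrite scalerDl -wl mulmxBr mul_mx_scalar subrK.
  by [].
pose p w := sqn w <= eig_const M' (e%:C)%C m * sqn (w *m D).
apply: (@stable_ortho_ind _ _ (S n) p (Sadj n)); rewrite {}/p.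
- by rewrite mul0mx !sqn0 mulr0.
- move=> W sW W0; have [U [sU U0 UW rU]] := small n W sW W0.
  exists U; split=> // u uU.
  exact: (eig_lower_bound M'0 e0' DM Deig (sD _ sU) rU).
- move=> U V u w sU sV UV uU wV pu pw.
  rewrite mulmxDl (sqn_ortho UV uU wV).
  rewrite (sqn_ortho UV (submx_trans (submxMr D uU) (sD _ sU))
    (submx_trans (submxMr D wV) (sD _ sV))).
  by rewrite mulrDr; exact: lerD pu pw.
Qed.

End SpectrumEquality.

(** * Normal elements *)

Section NormalElements.
Local Open Scope sesquilinear_scope.
Context {R : realType} {d : nat} {G : set (tree_aut d)}.

(** The net of partial sums is constant once the finite set contains [s]. *)
Lemma sum_finite_support (V : choiceType) (f : V -> R[i]) (s : seq V) : uniq s ->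
  (forall v, v \notin s -> f v = 0) ->
  summability.sum (f : V -> R[i]^o) = \sum_(v <- s) f v.
Proof.
move=> us f0; have pf := @summability.totally_filter V.
apply: (@cvg_lim (R[i]^o) (@norm_hausdorff _ _) _ _ pf).
apply: (@cvg_near_cst _ (R[i]^o) _ _ _ (@filter_filter _ _ pf)).
exists (finmap.seq_fset tt s) => // A sA.
rewrite /summability.partial_sum -(finmap.big_seq_fsetE _ A xpredT f).
rewrite (bigID (fun v => v \in s))/= [X in _ + X]big1 ?addr0//.
rewrite -big_filter; apply: perm_big; apply: uniq_perm => //.
  by rewrite filter_uniq ?finmap.fset_uniq.
move=> v; rewrite mem_filter; case: (boolP (v \in s)) => //= vs.
by move/finmap.fsubsetP: sA; apply; rewrite finmap.seq_fsetE.
Qed.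

Lemma inner_level n (u : l2 R (level d n)) (xi : l2 R (word d)) :
  inner (level_inj u) xi = dotmx (vec u) (vec (level_proj n xi)).
Proof.
pose s := [seq (val t : word d) | t <- enum (level d n)].
rewrite /inner (@sum_finite_support _ _ s).
- rewrite big_map big_enum /= dotmxE mxE.
  rewrite (reindex (@enum_val (level d n) (level d n))); last first.
    by exists enum_rank => t _; rewrite ?enum_valK ?enum_rankK.
  by apply: eq_bigr => i _; rewrite !mxE /= valK.
- by rewrite map_inj_uniq ?enum_uniq//; exact: val_inj.
- move=> v vs /=; rewrite insubF ?mul0r//; apply: contraNF vs => vn.
  by apply/mapP; exists (Tuple vn) => //; rewrite mem_enum.
Qed.

(** Testing the adjoint identity on the basis vectors of level [n] identifies the block of [S] with
    the conjugate transpose of [B n]. *)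
Lemma adjoint_block (x : level_ops R d) (B : forall n, 'M[R[i]]_#|level d n|) S :
  Salg G x -> (forall n u, vec (x n u) = vec u *m B n) ->
  adjoint (strong_sum x) S ->
  forall n xi, vec (level_proj n (S xi)) = vec (level_proj n xi) *m (B n)^t*.
Proof.
move=> Sx xB adj n xi; apply/rowP => i.
have := adj (level_inj (unvec (delta_mx 0 i))) xi.
rewrite (strong_sum_inj _ Sx) !inner_level xB unvecK => e.
apply: (can_inj conjCK); transitivity (dotmx (delta_mx 0 i) (vec (level_proj n (S xi)))).
  rewrite [RHS]dotmxE [RHS]mxE (bigD1 i)//= big1 ?addr0 => [|k ki]; rewrite !mxE ?eqxx ?mul1r//.
  by rewrite (negbTE ki) andbF mul0r.
rewrite -e dotmxE -rowE !mxE rmorph_sum; apply: eq_bigr => k _.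
by rewrite !mxE rmorphM /= conjCK mulrC.
Qed.

Lemma Salg_matrix (x : level_ops R d) : Salg G x ->
  exists B : forall n, 'M[R[i]]_#|level d n|,
    forall n u, vec (x n u) = vec u *m B n.
Proof.
move=> Sx; exists (fun n => sval (cid (linear_matrix (Salg_linear (n := n) Sx)))).
by move=> n u; case: cid.
Qed.

(** Normality passes to each block, so [B n] and its adjoint commute and share eigenvectors; the
    stable subspaces can be taken of dimension 1. *)
Lemma normal_spectrum_eq (x : level_ops R d) : Salg G x -> normal_op (strong_sum x) ->
  spectrum (strong_sum x) = closure (\bigcup_n spectrum (x n) : set R[i]^o).
Proof.
move=> Sx [S [_ adj TS]].
have [B xB] := Salg_matrix Sx; have SB := adjoint_block Sx xB adj.
have BB n : B n *m (B n)^t* = (B n)^t* *m B n.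
  apply/row_matrixP => i; rewrite !rowE.
  have := congr1 (fun T => vec (level_proj n (T (level_inj (unvec (delta_mx 0 i)))))) TS.
  rewrite /= (strong_sum_block Sx) xB !SB (strong_sum_block Sx) xB level_projK unvecK.
  by rewrite !mulmxA => ->.
apply: (@small_spectrum_eq _ _ G x B 1 (fun n A => A = B n \/ A = (B n)^t*) Sx xB).
- by move=> n A [->|->]; [right|left; rewrite trmxCK].
- by move=> n W sW; apply: sW; left.
- move=> n W sW W0; have [|v [v0 vW vS]] := common_eigen _ sW W0.
    by move=> A A' [->|->] [->|->].
  exists (genmx v); split.
  + move=> A /vS[l vl]; rewrite (eqmxMr _ (genmxE v)) genmxE vl.
    exact: scalemx_sub.
  + by rewrite -mxrank_eq0 mxrank_gen mxrank_eq0.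
  + by rewrite genmxE.
  + by rewrite mxrank_gen rank_leq_row.
Qed.

End NormalElements.

(** * The representation of a level *)

Section LevelRepresentation.
Local Open Scope sesquilinear_scope.
Context {R : realType} {d : nat}.
Implicit Types (g h : tree_aut d) (G : set (tree_aut d)).

Fact act_subproof n g (t : level d n) : size (g (val t)) == n.
Proof. by rewrite size_aut size_tuple. Qed.

Definition act n g (t : level d n) : level d n := Tuple (act_subproof g t).

Definition level_key n g : {ffun level d n -> level d n} := [ffun t => act g t].

Lemma actM n g h (t : level d n) : act (g * h)%g t = act g (act h t).
Proof. exact: val_inj. Qed.

Lemma act1 n (t : level d n) : act 1%g t = t.
Proof. exact: val_inj. Qed.

Lemma level_keyP n g h : level_key n g = level_key n h <->
  forall t : level d n, act g t = act h t.
Proof.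
split=> [/ffunP e t|e]; first by have := e t; rewrite !ffunE.
by apply/ffunP => t; rewrite !ffunE.
Qed.

Lemma level_key_quotient G n : finite_quotient G (level_key n).
Proof.
split=> [g g' h h' _ _ _ _ /level_keyP eg /level_keyP eh|g g' _ _ /level_keyP e].
  by apply/level_keyP => t; rewrite !actM eh eg.
apply/level_keyP => t; rewrite -[RHS]act1 -(mulVg g) actM; congr (act _ _).
by rewrite e -actM mulgV act1.
Qed.

(** A word of length [m] is padded to length [n] with a fixed letter; automorphisms preserve
    prefixes, so the action on the padded word determines the action on the word. *)
Lemma level_key_le m n g h : (m <= n)%N -> (0 < d)%N ->
  level_key n g = level_key n h -> level_key m g = level_key m h.
Proof.
move=> mn d0 /level_keyP e; apply/level_keyP => t; apply: val_inj => /=.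
move: (n - m)%N (subnK mn) => k; rewrite addnC => kn.
pose w : word d := val t ++ nseq k (Ordinal d0).
have wn : size w == n by rewrite size_cat size_nseq size_tuple kn.
have tk f (v : word d) l : take (size v) (aut_fun f (v ++ nseq l (Ordinal d0))) = f v.
  elim: l => [|l IH]; first by rewrite cats0 take_oversize// size_aut.
  rewrite -[l.+1]addn1 nseqD catA cats1.
  have [y ->] := aut_rcons f (v ++ nseq l (Ordinal d0)) (Ordinal d0).
  by rewrite -cats1 takel_cat ?size_aut ?size_cat ?leq_addr.
have := congr1 (fun t => take m (val t)) (e (Tuple wn)).
by rewrite /= -{1}(size_tuple t) -{2}(size_tuple t) !tk.
Qed.

(** On rows, [v *m level_rep n g] is the composite of [v] with the action of [g]. This is
    multiplicative for the right action, and [rho g] corresponds to [level_rep n g^-1]. *)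
Definition level_rep n g : 'M[R[i]]_#|level d n| :=
  \matrix_(i, j) (enum_val i == act g (enum_val j))%:R.

Lemma mul_level_repE n g (v : 'rV_#|level d n|) j :
  (v *m level_rep n g) 0 j = v 0 (enum_rank (act g (enum_val j))).
Proof.
rewrite mxE (bigD1 (enum_rank (act g (enum_val j))))//= big1 ?addr0 => [|k kj].
  by rewrite mxE enum_rankK eqxx mulr1.
by rewrite mxE -(inj_eq enum_rank_inj) enum_valK (negbTE kj) mulr0.
Qed.

Lemma level_rep_unirep G n : unirep G (level_rep n).
Proof.
have piM g h : level_rep n (g * h)%g = level_rep n g *m level_rep n h.
  apply/row_matrixP => i; rewrite !rowE mulmxA; apply/rowP => j.
  by rewrite !mul_level_repE enum_rankK actM.
have pi1 : level_rep n 1%g = 1%:M.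
  apply/row_matrixP => i; rewrite !rowE mulmx1; apply/rowP => j.
  by rewrite mul_level_repE act1 enum_valK.
split=> // g _; apply/unitarymxP.
suff <- : level_rep n g^-1%g = (level_rep n g)^t* by rewrite -piM mulgV pi1.
apply/matrixP => i j; rewrite !mxE conjC_nat; congr (_%:R).
congr nat_of_bool; apply/eqP/eqP => ->; first by rewrite -actM mulgV act1.
by rewrite -actM mulVg act1.
Qed.

Lemma level_rep_factors G n : factors G (level_key n) (level_rep n).
Proof.
move=> g h _ _ /level_keyP e; apply/matrixP => i j.
by rewrite !mxE e.
Qed.

Lemma vec_rho n g (xi : l2 R (word d)) :
  vec (level_proj n (rho g xi)) = vec (level_proj n xi) *m level_rep n g^-1%g.
Proof. by apply/rowP => j; rewrite mul_level_repE !mxE /= enum_rankK. Qed.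

Definition algebra_mx n (s : seq (R[i] * tree_aut d)) : 'M[R[i]]_#|level d n| :=
  \sum_(p <- s) p.1 *: level_rep n p.2^-1%g.

Lemma vec_algebra n s (xi : l2 R (word d)) :
  vec (level_proj n ((\sum_(p <- s) p.1 *: @rho R d p.2) xi)) =
  vec (level_proj n xi) *m algebra_mx n s.
Proof.
rewrite /algebra_mx; elim: s => [|p s IH].
  by rewrite !big_nil mulmx0; apply/rowP => j; rewrite !mxE.
rewrite !big_cons mulmxDr -scalemxAr -IH -vec_rho -vecP -level_projP.
by [].
Qed.

Lemma l2norm0 (V : choiceType) : l2norm (0 : l2 R V) = 0.
Proof.
rewrite /l2norm /sqsum esum1 ?sqrtr0// => v _.
by rewrite -[(_ : l2 R V) v]/(0 : R[i]) Normc.normc0 expr0n.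
Qed.

Lemma l2norm_rho g xi : l2norm (@rho R d g xi) = l2norm xi.
Proof.
rewrite /l2norm; congr (Num.sqrt (fine _)); symmetry.
rewrite /sqsum (reindex_esum setT setT (fun v => (g^-1)%g v))//.
split=> // [v w _ _|v _]; first exact: (can_inj (@aut_funK _ g^-1%g)).
by exists (g v) => //=; rewrite aut_funK.
Qed.

Lemma group_algebra_bounded G T : @group_algebra_image R d G T -> bounded_op T.
Proof.
move: T; apply: group_algebra_ind => [|c g T /bounded_opP[lT [M M0 TM]]].
  apply/bounded_opP; split=> [a u v|].
    by rewrite -[LHS]/(0 : l2 _ _) -[RHS]/(a *: (0 : l2 _ _) + 0) scaler0 addr0.
  by exists 0 => // xi; rewrite mul0r -[X in l2norm X]/(0 : l2 _ _) l2norm0.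
apply/bounded_opP; split.
  move=> a u v; rewrite -[LHS]/(c *: rho g (a *: u + v) + T (a *: u + v)).
  rewrite -[RHS]/(a *: (c *: rho g u + T u) + (c *: rho g v + T v)).
  by rewrite lT linear_rho !scalerDr !scalerA (mulrC c) addrACA.
pose K := 2 * Normc.normc c ^+ 2 + 2 * M ^+ 2.
have K0 : 0 <= K by apply: addr_ge0; apply: mulr_ge0 => //; exact: sqr_ge0.
exists (Num.sqrt K) => [|xi]; first exact: sqrtr_ge0.
apply: l2norm_le; first exact: sqrtr_ge0.
rewrite (sqr_sqrtr K0); apply: (le_trans (sqsumZD c (rho g xi) (T xi))).
have sqf (u : l2 R (word d)) : sqsum u = (l2norm u ^+ 2)%:E.
  by rewrite l2norm_sqr fineK ?sqsum_fin.
rewrite !sqf l2norm_rho -!EFinM -EFinD lee_fin /K [leRHS]mulrDl lerD2l -mulrA.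
by rewrite ler_wpM2l// -exprMn ler_pXn2r// ?nnegrE ?mulr_ge0 ?l2norm_ge0.
Qed.

Lemma group_algebra_Cstar G T : @group_algebra_image R d G T -> Cstar G T.
Proof.
move=> GT; split; first exact: group_algebra_bounded GT.
move=> e e0; exists T => //; apply: (@le_lt_trans _ _ 0%E); last by rewrite lte_fin.
apply: ge_ereal_sup => _ [xi _ <-].
by rewrite -[(T - T)%R xi]/(T xi - T xi) subrr l2norm0.
Qed.

Lemma l2norm_level_proj n (xi : l2 R (word d)) : l2norm (level_proj n xi) <= l2norm xi.
Proof.
rewrite -[leRHS]mul1r; apply: l2norm_le => //; rewrite expr1n mul1e.
rewrite /sqsum -(esum_image setT _
  (fun v => (Normc.normc (xi v) ^+ 2)%:E) (@word_val_inj d n)) esum_mkcond.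
by apply: le_esum => v _; case: ifP => // _; rewrite lee_fin sqr_ge0.
Qed.

(** An element of [Ralg] is a limit of elements of the group algebra, which preserve [W]. The limit
    does too: [v B] is shown orthogonal to each row [w] of the complement by Cauchy-Schwarz. *)
Lemma Ralg_stable G n T (B W : 'M[R[i]]_#|level d n|) : subgroup G ->
  Ralg G T -> (forall u, vec (T u) = vec u *m B) ->
  stable (rep_set G (level_rep n)) W -> stablemx W B.
Proof.
move=> sG [T' CT <-] TB sW; have [_ _ GV] := sG.
have algW s (v : 'rV_#|level d n|) : (forall p, p \in s -> G p.2) ->
    (v <= W)%MS -> (v *m algebra_mx n s <= W)%MS.
  move=> Gs vW; rewrite /algebra_mx mulmx_sumr big_seq; apply: summx_sub => p ps.
  rewrite -scalemxAr scalemx_sub// (submx_trans (submxMr _ vW))//.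
  by apply: sW; exists (p.2^-1)%g => //; apply/GV/Gs.
apply/row_subP => k; rewrite row_mul; set v := row k W.
have vW : (v <= W)%MS by exact: row_sub.
clearbody v; rewrite -(ortho_id W).
set Wo := orthomx _ _ W.
have WWo : (W <= orthomx Num.conj (mx_of_hermitian (hermitian1mx _)) Wo)%MS.
  by rewrite ortho_id.
clearbody Wo; rewrite orthomx1E; apply/eqP/rowP => l; rewrite [RHS]mxE.
set w := row l Wo.
have wE u : (u *m Wo^t*) 0 l = dotmx u w.
  by rewrite dotmxE !mxE; apply: eq_bigr => j _; rewrite !mxE.
have ort u : (u <= W)%MS -> dotmx u w = 0.
  move=> uW; rewrite -wE.
  have /orthomx1P e := submx_trans uW WWo.
  by rewrite e mxE.
rewrite wE; clearbody w.
apply/eqP; rewrite -normr_eq0 -sqrf_eq0 eq_le exprn_ge0// andbT.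
rewrite (_ : 0 = (0%:C)%C)//; have [c c0 cE] := RRe_ge0 (sqn_ge0 w).
have [e eE] : exists e, `|dotmx (v *m B) w| ^+ 2 = (e%:C)%C.
  by rewrite norm_normc -rmorphXn; eexists.
rewrite eE lecR; apply/ler_addgt0Pr => a a0; rewrite add0r.
(* With [c] the squared norm of [w], an approximation within [b] makes the squared scalar product at
   most [a c / (c + 1)], hence at most [a]. *)
pose b := Num.sqrt (a / (c + 1)).
have ac : 0 < a / (c + 1) by rewrite divr_gt0// ltr_wpDl.
have b0 : 0 < b by rewrite sqrtr_gt0.
have [S [GS S1 _]] := Cstar_approx (level_inj (unvec v)) 0 CT b0.
have [s [Gs SE]] := GS.
have le : sqn (v *m B - v *m algebra_mx n s) <= ((a / (c + 1))%:C)%C.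
  have -> : v *m B - v *m algebra_mx n s = vec (level_proj n
      (T' (level_inj (unvec v)) - S (level_inj (unvec v)))).
    have -> xi eta : vec (level_proj n (xi - eta)) =
        vec (level_proj n xi) - vec (level_proj n eta).
      by apply/rowP => j; rewrite !mxE.
    congr (_ - _); first by rewrite -[v in LHS]unvecK -TB.
    by rewrite SE vec_algebra level_projK unvecK.
  rewrite sqn_vec lecR -[leRHS](sqr_sqrtr (ltW ac)).
  rewrite ler_pXn2r ?nnegrE ?l2norm_ge0 ?sqrtr_ge0//.
  exact: le_trans (l2norm_level_proj _ _) S1.
rewrite -lecR -eE -[v *m B](subrK (v *m algebra_mx n s)) linearDl.
rewrite [X in _ + X]ort ?algW// addr0; apply: le_trans (dotmx_sqr_le _ _) _.
rewrite cE; apply: le_trans (ler_wpM2r _ le) _; first by rewrite ler0c.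
rewrite -(rmorphM (real_complex R)) lecR -mulrA ler_piMr ?(ltW a0)//.
by rewrite mulrC ler_pdivrMr ?mul1r ?lerDl ?ler01// ltr_wpDl.
Qed.

Lemma virtually_abelian_spectrum_eq G (x : level_ops R d) :
  subgroup G -> virtually_abelian G -> Salg G x ->
  spectrum (strong_sum x) = closure (\bigcup_n spectrum (x n) : set R[i]^o).
Proof.
move=> sG vG Sx; have [B xB] := Salg_matrix Sx.
have [m mP] := virtually_abelian_small (C := R[i]) sG vG.
apply: (@small_spectrum_eq _ _ G x B m (fun n => rep_set G (level_rep n)) Sx xB).
- by move=> n A; apply: rep_set_adj => //; exact: level_rep_unirep.
- by move=> n W sW; have [Rx _ _] := Sx; apply: (Ralg_stable sG (Rx n)) => // u; exact: xB.
- by move=> n W; apply: mP; exact: level_rep_unirep.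
Qed.

End LevelRepresentation.

(** * Bounded degrees imply virtually abelian *)

Section BoundedDegrees.
Local Open Scope sesquilinear_scope.
Context {R : realType} {d : nat}.
Variable G : set (tree_aut d).
Hypothesis sG : subgroup G.

(** An irreducible constituent of a level, written in an orthonormal basis of its subspace; the
    basis vectors are the rows of [irr_emb]. *)
Record level_irrep := LevelIrrep {
  irr_deg : nat;
  irr_level : nat;
  irr_rep : tree_aut d -> 'M[R[i]]_irr_deg;
  irr_emb : 'M[R[i]]_(irr_deg, #|level d irr_level|);
  irr_unirep : unirep G irr_rep;
  irr_irreducible : irreducible G irr_rep;
  irr_factors : factors G (level_key irr_level) irr_rep;
  irr_emb_unitary : irr_emb \is unitarymx;
  irr_emb_intertwiner : intertwiner G irr_rep (level_rep irr_level) irr_emb }.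

(** An orthonormal basis of a minimal stable [U] gives a matrix representation, irreducible because
    a stable subspace of coordinates maps to a stable subspace of [U]. The last clause carries
    commutation in this representation back to the vectors of [U]. *)
Lemma minimal_irreducible n (U : 'M[R[i]]_#|level d n|) :
  stable (rep_set G (level_rep n)) U -> U != 0 ->
  (forall U', stable (rep_set G (level_rep n)) U' -> U' != 0 -> (U' <= U)%MS -> (U <= U')%MS) ->
  exists r : level_irrep, [/\ irr_level r = n, irr_deg r = \rank U &
    forall A, A `<=` G -> commuting_image A (irr_rep r) ->
    forall v : 'rV_#|level d n|, (v <= U)%MS -> forall a b, A a -> A b ->
      v *m level_rep n a *m level_rep n b = v *m level_rep n b *m level_rep n a].
Proof.
move=> sU U0 Um; have [B uB BU] := onb_exists U.
have pG := @level_rep_unirep R d G n.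
have sB g : G g -> (B *m level_rep n g <= B)%MS.
  by move=> Gg; rewrite BU (eqmxMr _ BU); apply: sU; exists g.
have UB : (U <= B)%MS by rewrite BU.
have BU' : (B <= U)%MS by rewrite BU.
have [s [us fs sE]] : exists s : tree_aut d -> 'M[R[i]]_(\rank U),
    [/\ unirep G s, factors G (level_key n) s &
      forall g, G g -> B *m level_rep n g = s g *m B].
  exists (fun g => B *m level_rep n g *m B^t*); split.
  - exact: unirep_restrict sG pG uB sB.
  - by move=> g h Gg Gh e; rewrite (@level_rep_factors R d G n g h Gg Gh e).
  - by move=> g Gg; exact: (unitary_intertwine uB (sB g Gg)).
have is' : intertwiner G s (level_rep n) B by move=> g Gg; rewrite sE.
have freeB : row_free B by rewrite /row_free mxrank_unitary.
have irs : irreducible G s.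
  split=> [|V sV V0]; first by rewrite lt0n mxrank_eq0.
  have UVB : (U <= genmx (V *m B))%MS.
    apply: Um.
    - move=> _ [g Gg ->]; rewrite (eqmxMr _ (genmxE _)) genmxE -mulmxA sE// mulmxA.
      by apply: submxMr; apply: sV; exists g.
    - by rewrite -mxrank_eq0 mxrank_gen mxrank_eq0 mulmx_free_eq0.
    - by rewrite genmxE mulmx_sub.
  rewrite /row_full eqn_leq rank_leq_col /=.
  by have := mxrankS UVB; rewrite mxrank_gen mxrankMfree.
exists (LevelIrrep us irs fs uB is'); split=> //= A AG cA v vU a b Aa Ab.
have /submxP[c ->] := submx_trans vU UB.
have e x y : G x -> G y -> B *m level_rep n x *m level_rep n y = s x *m s y *m B.
  by move=> Gx Gy; rewrite (sE _ Gx) -[LHS]mulmxA (sE _ Gy) mulmxA.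
rewrite -!(mulmxA c) (e _ _ (AG _ Aa) (AG _ Ab)) (e _ _ (AG _ Ab) (AG _ Aa)).
by rewrite (cA _ _ Aa Ab).
Qed.

Lemma level_rep_inj n g h : level_rep (R := R) n g = level_rep n h ->
  forall t : level d n, act g t = act h t.
Proof.
move=> e t; have := congr1 (fun X : 'M[R[i]]_#|level d n| => X (enum_rank (act g t)) (enum_rank t)) e.
rewrite !mxE !enum_rankK eqxx; case: eqVneq => // _ /eqP.
by rewrite oner_eq0.
Qed.

(** The intersection [A] of the subgroups of index at most [N] lies in the subgroup that
    [Jordan_bound] gives for each constituent, so its elements commute on every irreducible piece of
    every level. *)
Lemma bounded_degrees_virtually_abelian k : finitely_generated G ->
  (forall r : level_irrep, (irr_deg r <= k)%N) -> virtually_abelian G.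
Proof.
move=> fG degk; have [N JN] := @Jordan_bound R (tree_aut d) k.
have [N' iA] := small_index_core N sG fG.
set A := (X in index_le X _ _) in iA; exists A.
have [G1 GM GV] := sG.
have sA : subgroup A.
  split=> [|a b [Ga Ha] [Gb Hb]|a [Ga Ha]].
  - by split=> // H [].
  - split; first exact: GM.
    by move=> H sH HG iH; have [_ HM _] := sH; apply: HM; [exact: Ha|exact: Hb].
  - split; first exact: GV.
    by move=> H sH HG iH; have [_ _ HV] := sH; apply: HV; exact: Ha.
have AG : A `<=` G by move=> a [].
split=> //; last first.
  have [c cA] := iA; pose rep i := xget 1%g [set r | G r /\ c r = i].
  apply: (@sub_finite_set _ _ [set [set (rep i * a)%g | a in A] | i in [set: 'I_N']]);
    last by apply: finite_image; exact: finite_finset.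
  move=> _ [g Gg <-]; exists (c g) => //.
  have [Gr cr] : G (rep (c g)) /\ c (rep (c g)) = c g.
    by apply: (xgetPex 1%g (P := [set r | G r /\ c r = c g])); exists g.
  have [_ AM AV] := sA.
  apply/seteqP; split=> _ [a Aa <-].
    exists (g^-1 * rep (c g) * a)%g; last by rewrite -mulgA mulVKg.
    by apply: AM => //; apply: cA.
  exists ((rep (c g))^-1 * g * a)%g; last by rewrite -mulgA mulVKg.
  by apply: AM => //; apply: cA.
move=> a b Aa Ab.
have comm n (v : 'rV_#|level d n|) :
    v *m level_rep n a *m level_rep n b = v *m level_rep n b *m level_rep n a :> 'rV[R[i]]_#|level d n|.
  pose p (w : 'rV[R[i]]_#|level d n|) := w *m level_rep n a *m level_rep n b = w *m level_rep n b *m level_rep n a.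
  apply: (@stable_ortho_ind _ _ (rep_set G (level_rep n)) p); rewrite /p.
  - by move=> X; apply: rep_set_adj => //; exact: level_rep_unirep.
  - by rewrite !mul0mx.
  - move=> W sW W0; have [U [sU U0 UW Um]] := stable_min sW W0.
    exists U; split=> // {}v vU; have [r [rn rU rP]] := minimal_irreducible sU U0 Um.
    have [A' [sA' A'G iA' cA']] := JN _ G (irr_rep r) _ _ (degk r) sG
      (irr_unirep r) (irr_factors (l := r)).
    by apply: (rP _ A'G cA' _ vU); [apply: Aa.2 | apply: Ab.2].
  - by move=> U V u w _ _ _ _ _ pu pw; rewrite !mulmxDl pu pw.
apply: tree_aut_eq => w.
(* The representation on the level of [w] determines the action on [w], so commuting on all levels
   means commuting in the automorphism group. *)
have pe : level_rep (R := R) (size w) (a * b)%g = level_rep (size w) (b * a)%g.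
  have pM := unirepM (@level_rep_unirep R d G (size w)).
  rewrite pM ?pM//; [|exact: AG..].
  by apply/row_matrixP => i; rewrite !rowE !mulmxA comm.
by have := congr1 val (level_rep_inj pe (in_tuple w)).
Qed.

End BoundedDegrees.

(** * Jordan blocks in S(G) *)

Section Shift.
Local Open Scope sesquilinear_scope.
Context {C : numClosedFieldType}.

Definition shift_mx D : 'M[C]_D := \matrix_(i, j) ((j == i.+1 :> nat)%:R).

Lemma shift_mxE D m (X : 'M[C]_(D, m)) (i : 'I_D) j (lt : (i.+1 < D)%N) :
  (shift_mx D *m X) i j = X (Ordinal lt) j.
Proof.
rewrite mxE (bigD1 (Ordinal lt))//= big1 ?addr0 => [|k ki].
  by rewrite mxE /= eqxx mul1r.
by rewrite mxE -[i.+1]/(val (Ordinal lt)) (inj_eq val_inj) (negbTE ki) mul0r.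
Qed.

Lemma shift_mx_last D m (X : 'M[C]_(D, m)) (i : 'I_D) j : (D <= i.+1)%N ->
  (shift_mx D *m X) i j = 0.
Proof.
move=> le; rewrite mxE big1// => k _; rewrite mxE ltn_eqF ?mul0r//.
exact: leq_trans (ltn_ord k) le.
Qed.

Lemma iter_shift_eq0 D (X : 'M[C]_D) : iter D (mulmx (shift_mx D)) X = 0.
Proof.
apply/matrixP => a j; rewrite [RHS]mxE.
suff H i (b : 'I_D) : (D <= b + i)%N -> (iter i (mulmx (shift_mx D)) X) b j = 0.
  by apply: H; exact: leq_addl.
elim: i b => [|i IH] b le; first by move: (ltn_ord b); rewrite ltnNge -(addn0 b) le.
rewrite iterS; have [lt|ge] := ltnP b.+1 D; last exact: shift_mx_last.
by rewrite (shift_mxE _ _ lt) IH//= addSnnS.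
Qed.

(** This identity carries over to sums of such blocks and shows that they are contractions whatever
    the number and size of the blocks. *)
Lemma shift_partial_isometry D :
  shift_mx D *m (shift_mx D)^t* *m shift_mx D = shift_mx D :> 'M[C]_D.
Proof.
apply/matrixP => i j; rewrite -mulmxA; have [lt|ge] := ltnP i.+1 D; last first.
  by rewrite shift_mx_last// mxE ltn_eqF// (leq_trans (ltn_ord j)).
rewrite (shift_mxE _ _ lt) mxE (bigD1 i)//= big1 ?addr0 => [|k ki].
  by rewrite !mxE /= eqxx conjC1 mul1r.
by rewrite !mxE /= eqSS eq_sym (inj_eq val_inj) (negbTE ki) conjC0 mul0r.
Qed.

(** An approximate eigenvector of the Jordan block for the value 1/2: multiplied by [J - 1/2] it
    keeps only a first coordinate [- 1/2], while its own norm grows with [D]. *)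
Definition geom_row D : 'rV[C]_D := \row_i 2 ^+ i.

Lemma geom_row_shift D :
  sqn (geom_row D *m (shift_mx D - (2^-1)%:M)) <= 1.
Proof.
have E j : (geom_row D *m (shift_mx D - (2^-1)%:M)) 0 j =
    if j == 0%N :> nat then - 2^-1 else 0.
  rewrite mulmxBr mul_mx_scalar !mxE; case: j => -[|j] lt /=.
    by rewrite big1 ?sub0r ?expr0 ?mulr1// => k _; rewrite !mxE /= mulr0.
  rewrite (bigD1 (Ordinal (ltnW lt)))//= big1 ?addr0 => [|k ki].
    by rewrite !mxE /= eqxx mulr1 exprS mulKf ?subrr ?pnatr_eq0.
  rewrite !mxE /= eqSS eq_sym -[j]/(val (Ordinal (ltnW lt))) (inj_eq val_inj).
  by rewrite (negbTE ki) mulr0.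
rewrite sqnE; case: D E => [|D] E; first by rewrite big_ord0 ler01.
rewrite big_ord_recl big1 ?addr0 => [|k _]; last by rewrite E normr0 expr0n.
rewrite E /= normrN normfV normr_nat expr_le1 ?invr_ge0 ?ler0n//.
by rewrite invf_le1 ?ltr0n// ler1n.
Qed.

Lemma sqn_geom_row D : D%:R <= sqn (geom_row D).
Proof.
rewrite sqnE -[X in X%:R](card_ord D) -sumr_const; apply: ler_sum => i _.
by rewrite mxE normrX normr_nat -exprM exprn_ege1// ler1n.
Qed.

End Shift.

(** * An element of S(G) built from constituents of increasing degrees *)

Section JordanBlocks.
Local Open Scope sesquilinear_scope.
Context {R : realType} {d : nat}.
Variable G : set (tree_aut d).
Hypothesis sG : subgroup G.
Hypothesis d0 : (0 < d)%N.
Variable r : nat -> @level_irrep R d G.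
Hypothesis deg_mono : forall k l, (k < l)%N -> (irr_deg (r k) < irr_deg (r l))%N.

Local Notation D k := (irr_deg (r k)).

Lemma deg_gt k : (k < D k)%N.
Proof.
elim: k => [|k IH]; last exact: leq_ltn_trans IH (deg_mono (ltnSn k)).
by have [] := irr_irreducible (r 0%N).
Qed.

Lemma deg_neq k l : k != l -> D k != D l.
Proof. by rewrite !neq_ltn => /orP[/deg_mono->|/deg_mono->]; rewrite ?orbT. Qed.

(** A level at least [m] and at least that of each [r k] with [k < K], so that the action on it
    determines all the representations being averaged. *)
Definition top_level m K := (m + \sum_(k < K) irr_level (r k))%N.

(** Here [m] is the level acted upon, and the average runs over the finite quotient of [G] acting on
    level [M]. *)
Definition block_op m M k (N : 'M[R[i]]_(D k)) : 'M[R[i]]_#|level d m| :=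
  fourier_op G (level_key M) (irr_rep (r k)) (level_rep m) N.

Definition jordan_mx m M K : 'M[R[i]]_#|level d m| :=
  \sum_(k < K) block_op m M (shift_mx (D k)).

Lemma level_rep_factors_le m M : (m <= M)%N ->
  factors G (level_key M) (level_rep (R := R) m).
Proof.
move=> mM g h Gg Gh e; apply: (@level_rep_factors _ _ G) => //.
exact: level_key_le mM d0 e.
Qed.

Lemma irr_factors_le k M : (irr_level (r k) <= M)%N ->
  factors G (level_key M) (irr_rep (r k)).
Proof.
move=> kM g h Gg Gh e; apply: (irr_factors (l := r k)) => //.
exact: level_key_le kM d0 e.
Qed.

Lemma top_level_geq m K : (m <= top_level m K)%N.
Proof. exact: leq_addr. Qed.

Lemma top_level_irr m K k : (k < K)%N -> (irr_level (r k) <= top_level m K)%N.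
Proof.
move=> kK; rewrite (leq_trans _ (leq_addl _ _))//.
by rewrite (bigD1 (Ordinal kK))//= leq_addr.
Qed.

Lemma block_op_indep m M M' k (N : 'M[R[i]]_(D k)) :
  (m <= M)%N -> (irr_level (r k) <= M)%N ->
  (m <= M')%N -> (irr_level (r k) <= M')%N -> block_op m M N = block_op m M' N.
Proof.
move=> mM kM mM' kM'; apply: mean_indep => //; first exact: level_key_quotient.
- exact: level_key_quotient.
- by apply: factors_fourier; [exact: irr_factors_le | exact: level_rep_factors_le].
- by apply: factors_fourier; [exact: irr_factors_le | exact: level_rep_factors_le].
Qed.

Lemma block_op_eq0 m M k (N : 'M[R[i]]_(D k)) : (m <= M)%N ->
  (irr_level (r k) <= M)%N -> (#|level d m| < D k)%N -> block_op m M N = 0.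
Proof.
move=> mM kM lt; apply: (fourier_op_eq0 sG (level_key_quotient G M)) => //.
- move=> c; apply: (intertwiner_gt sG _ _ _ lt).
  + exact: irr_unirep.
  + exact: level_rep_unirep.
  + exact: irr_irreducible.
- exact: irr_unirep.
- exact: level_rep_unirep.
- exact: irr_factors_le.
- exact: level_rep_factors_le.
Qed.

(** A block with [k >= #|level d m|] has degree above the dimension of the level and vanishes there,
    so the sum is stationary in [K]; averages do not depend on the quotient used. *)
Lemma jordan_mx_indep m M K M' K' : (m <= M)%N -> (m <= M')%N ->
  (forall k, (k < K)%N -> (irr_level (r k) <= M)%N) ->
  (forall k, (k < K')%N -> (irr_level (r k) <= M')%N) ->
  (#|level d m| <= K)%N -> (K <= K')%N -> jordan_mx m M K = jordan_mx m M' K'.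
Proof.
move=> mM mM' kM kM' mK KK'; rewrite /jordan_mx.
rewrite (big_ord_widen K' (fun k => block_op m M (shift_mx (D k))) KK').
rewrite [RHS](bigID (fun k : 'I_K' => (k < K)%N))/= [X in _ = _ + X]big1 ?addr0.
  apply: eq_bigr => k kK; apply: block_op_indep => //; [exact: kM | exact: kM'].
move=> k; rewrite -leqNgt => Kk; apply: block_op_eq0; rewrite ?kM'//.
by apply: leq_ltn_trans (deg_gt k); exact: leq_trans Kk.
Qed.

Section OneLevel.
Variables (m M K : nat).
Hypothesis mM : (m <= M)%N.
Hypothesis kM : forall k, (k < K)%N -> (irr_level (r k) <= M)%N.

Let X := jordan_mx m M K.

Lemma block_op_mul k l (N : 'M[R[i]]_(D k)) (N' : 'M[R[i]]_(D l)) :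
  (k < K)%N -> (l < K)%N -> k != l -> block_op m M N *m block_op m M N' = 0.
Proof.
move=> kK lK kl; apply: (fourier_op_mul_neq sG (level_key_quotient G M)).
- exact: irr_irreducible.
- exact: irr_irreducible.
- by rewrite eq_sym deg_neq.
- exact: irr_unirep.
- exact: irr_unirep.
- exact: level_rep_unirep.
- exact/irr_factors_le/kM.
- exact/irr_factors_le/kM.
- exact: level_rep_factors_le.
Qed.

Lemma block_op_mul_same k (N N' : 'M[R[i]]_(D k)) : (k < K)%N ->
  block_op m M N *m block_op m M N' = block_op m M (N *m N').
Proof.
move=> kK; apply: (fourier_op_mul_same sG (level_key_quotient G M)).
- exact: irr_irreducible.
- exact: irr_unirep.
- exact: level_rep_unirep.
- exact/irr_factors_le/kM.
- exact: level_rep_factors_le.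
Qed.

Lemma sum_block_op_mul k (N : forall k, 'M[R[i]]_(D k)) (N' : 'M[R[i]]_(D k)) : (k < K)%N ->
  (\sum_(l < K) block_op m M (N l)) *m block_op m M N' = block_op m M (N k *m N').
Proof.
move=> kK; rewrite mulmx_suml (bigD1 (Ordinal kK))//= big1 ?addr0.
  by rewrite block_op_mul_same.
by move=> l lk; apply: block_op_mul.
Qed.

Lemma jordan_mx_adj : X^t* = \sum_(k < K) block_op m M ((shift_mx (D k))^t*).
Proof.
have adjD (Y Z : 'M[R[i]]_#|level d m|) : (Y + Z)^t* = Y^t* + Z^t*.
  by rewrite linearD map_mxD.
have adj0 : (0 : 'M[R[i]]_#|level d m|)^t* = 0 by rewrite trmx0 map_mx0.
rewrite /X /jordan_mx (big_morph (fun Y : 'M[R[i]]_#|level d m| => Y^t*) adjD adj0).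
apply: eq_bigr => k _; apply: (fourier_op_adj sG (level_key_quotient G M)).
- exact: irr_unirep.
- exact: level_rep_unirep.
- exact/irr_factors_le/kM.
- exact: level_rep_factors_le.
Qed.

Lemma jordan_mx_isometry : X *m X^t* *m X = X.
Proof.
have e : X^t* *m X =
    \sum_(k < K) block_op m M ((shift_mx (D k))^t* *m shift_mx (D k)).
  rewrite jordan_mx_adj /X /jordan_mx mulmx_sumr; apply: eq_bigr => k _.
  by rewrite (sum_block_op_mul (fun k => (shift_mx (D k))^t*) _ (ltn_ord k)).
rewrite -mulmxA e mulmx_sumr; apply: eq_bigr => k _.
rewrite (sum_block_op_mul (fun k => shift_mx (D k)) _ (ltn_ord k)).
by rewrite mulmxA shift_partial_isometry.
Qed.

(** Since [X] is a partial isometry, [P = X X^*] is an orthogonal projection, and [v X] has the same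
    norm as [v P]. *)
Lemma jordan_mx_contraction (v : 'rV_#|level d m|) : sqn (v *m X) <= sqn v.
Proof.
pose P := X *m X^t*.
have Padj : P^t* = P by rewrite /P trmx_mul map_mxM trmxCK.
have PP : P *m P = P by rewrite /P mulmxA jordan_mx_isometry.
have dE Y : sqn (v *m Y) = (v *m (Y *m Y^t*) *m v^t*) 0 0.
  by rewrite /sqn dotmxE trmx_mul map_mxM !mulmxA.
have sqE : sqn (v *m X) = sqn (v *m P) by rewrite !dE Padj PP.
clearbody P; have or : dotmx (v *m P) (v - v *m P) = 0.
  rewrite dotmxE linearB /= map_mxB mulmxBr trmx_mul map_mxM Padj.
  by rewrite -!mulmxA (mulmxA P P) PP subrr mxE.
have -> : sqn v = sqn (v *m P) + sqn (v - v *m P).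
  by rewrite -[LHS]/(sqn v) -{1}[v](subrK (v *m P)) addrC; exact: hnormDd.
by rewrite sqE lerDl sqn_ge0.
Qed.

(** On a row with [v X = l v], replacing [N] by [J^i N] in a block multiplies [v *m block_op m M N]
    by [l^i]. As [J] is nilpotent, a nonzero [l] would make all blocks, hence [v X], vanish. *)
Lemma jordan_mx_eigen l (v : 'rV_#|level d m|) : v != 0 -> v *m X = l *: v -> l = 0.
Proof.
move=> v0 vl; apply: contraTeq v0 => l0; rewrite negbK.
have step k (N : 'M[R[i]]_(D k)) : (k < K)%N ->
    v *m block_op m M (shift_mx (D k) *m N) = l *: (v *m block_op m M N).
  move=> kK; rewrite -(sum_block_op_mul (fun k => shift_mx (D k)) N kK) -/(jordan_mx m M K).
  by rewrite mulmxA vl -scalemxAl.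
have iterE k (N : 'M[R[i]]_(D k)) i : (k < K)%N ->
    v *m block_op m M (iter i (mulmx (shift_mx (D k))) N) = l ^+ i *: (v *m block_op m M N).
  move=> kK; elim: i => [|i IH]; first by rewrite scale1r.
  rewrite exprS -scalerA -IH.
  exact: step.
have blk0 k (N : 'M[R[i]]_(D k)) : (k < K)%N -> v *m block_op m M N = 0.
  move=> kK; have := iterE k N (D k) kK; rewrite iter_shift_eq0.
  have -> : block_op m M (0 : 'M[R[i]]_(D k)) = 0.
    rewrite /block_op /fourier_op -[RHS](mean_cst sG (level_key M)).
    by apply: eq_mean => g _; rewrite mul0mx mxtrace0 mulr0 scale0r.
  rewrite mulmx0 => /esym/eqP; rewrite scaler_eq0 expf_eq0 (negbTE l0) andbF /=.
  by move/eqP.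
have vX : v *m X = 0.
  by rewrite /X /jordan_mx mulmx_sumr big1// => k _; exact: blk0.
by move/eqP: vl; rewrite vX eq_sym scaler_eq0 (negbTE l0).
Qed.

Lemma emb_jordan_mx k : (k < K)%N -> irr_level (r k) = m ->
  exists2 f : 'M[R[i]]_(D k, #|level d m|), f \is unitarymx &
    f *m X = shift_mx (D k) *m f.
Proof.
move=> kK km; have [f uf fi] : exists2 f : 'M[R[i]]_(D k, #|level d m|),
    f \is unitarymx & intertwiner G (irr_rep (r k)) (level_rep m) f.
  rewrite -km; exists (irr_emb (r k)); first exact: irr_emb_unitary.
  exact: irr_emb_intertwiner.
exists f => //; rewrite /X /jordan_mx mulmx_sumr (bigD1 (Ordinal kK))//= big1 ?addr0.
  rewrite (intertwine_fourier_op _ _ _ fi) (fourier_op_self sG (level_key_quotient G M))//.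
  - exact: irr_irreducible.
  - exact: irr_unirep.
  - exact/irr_factors_le/kM.
move=> l lk; rewrite (intertwine_fourier_op _ _ _ fi).
rewrite (fourier_op_eq0 sG (level_key_quotient G M)) ?mul0mx//.
- move=> c; apply: (intertwiner_neq sG).
  + exact: irr_unirep.
  + exact: irr_unirep.
  + exact: irr_irreducible.
  + exact: irr_irreducible.
  + exact: deg_neq.
- exact: irr_unirep.
- exact: irr_unirep.
- exact/irr_factors_le/kM.
- exact/irr_factors_le/kM.
Qed.

End OneLevel.

(** One list [s] serves all levels [m], so the matrices at different levels come from the same
    element of the group algebra. *)
Lemma jordan_mx_algebra M K : exists s : seq (R[i] * tree_aut d),
  (forall p, p \in s -> G p.2) /\ forall m, algebra_mx m s = jordan_mx m M K.
Proof.
have [_ _ GV] := sG.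
elim: K => [|K [s [sGs sE]]].
  by exists [::]; split=> // m; rewrite /algebra_mx big_nil /jordan_mx big_ord0.
pose key := @level_key d M.
pose c (i : {ffun level d M -> level d M}) := (#|key_image G key|%:R)^-1 *
  ((D K)%:R * \tr (shift_mx (D K) *m (irr_rep (r K) (key_lift G key i))^t*)) : R[i].
exists (s ++ [seq (c i, (key_lift G key i)^-1%g) | i <- enum (key_image G key)]).
split=> [p|m].
  rewrite mem_cat => /orP[/sGs//|ps]; case: (mapP ps) => i.
  by rewrite mem_enum => /key_liftP[Gi _] ->; exact: GV.
rewrite /algebra_mx big_cat /= -/(algebra_mx m s) sE /jordan_mx big_ord_recr /=.
congr (_ + _); rewrite big_map big_enum /= /block_op /fourier_op /mean scaler_sumr.
by apply: eq_bigr => i _; rewrite scalerA invgK.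
Qed.

Definition jordan_op : level_ops R d := fun m =>
  mxop (jordan_mx m (top_level m #|level d m|) #|level d m|).

Lemma jordan_mx_stable_range m K M : (m <= M)%N -> (#|level d m| <= K)%N ->
  (forall k, (k < K)%N -> (irr_level (r k) <= M)%N) ->
  jordan_mx m M K = jordan_mx m (top_level m #|level d m|) #|level d m|.
Proof.
move=> mM mK kM; symmetry; apply: jordan_mx_indep => //; first exact: top_level_geq.
by move=> k; exact: top_level_irr.
Qed.

Lemma jordan_op_vec m u : vec (@jordan_op m u) =
  vec u *m jordan_mx m (top_level m #|level d m|) #|level d m|.
Proof. exact: unvecK. Qed.

Lemma jordan_op_Salg : Salg G (@jordan_op).
Proof.
have comp M K m : (m <= M)%N -> (#|level d m| <= K)%N ->
    (forall k, (k < K)%N -> (irr_level (r k) <= M)%N) ->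
    forall s, algebra_mx m s = jordan_mx m M K ->
    compress m (\sum_(p <- s) p.1 *: @rho R d p.2) = @jordan_op m.
  move=> mM mK kM s sE; apply/funext => u; apply: (can_inj vecK).
  rewrite /compress /= vec_algebra level_projK sE jordan_op_vec.
  by rewrite jordan_mx_stable_range.
have alg M K : exists s, Cstar G (\sum_(p <- s) p.1 *: @rho R d p.2) /\
    forall m, algebra_mx m s = jordan_mx m M K.
  have [s [Gs sE]] := jordan_mx_algebra M K; exists s; split=> //.
  by apply: group_algebra_Cstar; exists s.
split=> [m|m|].
- have [s [Cs sE]] := alg (top_level m #|level d m|) #|level d m|.
  exists (\sum_(p <- s) p.1 *: @rho R d p.2) => //.
  apply: (comp _ _ _ (top_level_geq _ _) (leqnn _) _ _ (sE m)).
  by move=> k; exact: top_level_irr.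
(* [K] and [M] are large enough for levels [m] and [m.+1] together, so that one operator compresses
   to both terms. *)
- set K := (#|level d m| + #|level d m.+1|)%N; set M := top_level m.+1 K.
  have [s [Cs sE]] := alg M K.
  have kM k : (k < K)%N -> (irr_level (r k) <= M)%N by exact: top_level_irr.
  exists (\sum_(p <- s) p.1 *: @rho R d p.2); split=> //.
    apply: (comp _ _ _ (top_level_geq _ _) _ kM _ (sE m.+1)).
    exact: leq_addl.
  apply: (comp _ _ _ _ _ kM _ (sE m)); last exact: leq_addr.
  exact: leq_trans (leqnSn m) (top_level_geq _ _).
- apply: (@le_lt_trans _ _ 1%E); last exact: ltry.
  apply: ge_ereal_sup => _ [m _ <-]; apply: ge_ereal_sup => _ [u u1 <-].
  rewrite lee_fin (le_trans _ u1)// -(@ler_pXn2r _ 2) ?nnegrE ?l2norm_ge0//.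
  rewrite -lecR -!sqn_vec jordan_op_vec; apply: jordan_mx_contraction.
    exact: top_level_geq.
  by move=> k; exact: top_level_irr.
Qed.

(** All blocks have spectrum in [{0}], so 1/2 is outside the closure; but a bounded inverse at 1/2
    would bound the norms of [geom_row] for all degrees. *)
Lemma jordan_op_spectrum :
  spectrum (strong_sum (@jordan_op)) <>
  closure (\bigcup_n spectrum (@jordan_op n) : set R[i]^o).
Proof.
move=> eq; have Sx := jordan_op_Salg.
have kM m k : (k < #|level d m|)%N -> (irr_level (r k) <= top_level m #|level d m|)%N.
  exact: top_level_irr.
have /not_spectrum[S [bS e _]] : ~ spectrum (strong_sum (@jordan_op)) (2^-1 : R[i]).
  rewrite eq => cl.
  have [l [[n _ nl]]] : (\bigcup_n spectrum (@jordan_op n) : set R[i]^o) `&`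
      [set l | Normc.normc (2^-1 - l) < 2^-1] !=set0.
    apply: cl; apply/nbhs_ballP; exists (2^-1); first by rewrite /= invr_gt0 ltr0n.
    move=> l; rewrite /ball /= norm_normc (_ : 2^-1 = ((2^-1 : R)%:C)%C) ?ltcR//.
    by rewrite fmorphV rmorph_nat.
  have [v v0 vl] := (finite_spectrumP (jordan_op_vec (m := n)) l).1 nl.
  rewrite /= (jordan_mx_eigen (top_level_geq _ _) (kM n) v0 vl) subr0.
  rewrite -ltcR -norm_normc fmorphV rmorph_nat.
  have h0 : 0 <= 2^-1 :> R[i] by rewrite invr_ge0 ler0n.
  by rewrite (ger0_norm h0) ltxx.
have [_ [c c0 Sc]] := (bounded_opP S).1 bS.
(* The inverse forces [D k <= c^2], whereas [D k >= k + 1 > c^2] for this [k]. *)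
pose k := Num.truncn (c ^+ 2).
pose n := irr_level (r k).
have kn : (k < #|level d n|)%N.
  apply: leq_trans (deg_gt k) _.
  by rewrite -(mxrank_unitary (irr_emb_unitary (r k))) rank_leq_col.
have [f uf fX] := emb_jordan_mx (kM n) kn (erefl n).
pose w := geom_row (D k) *m f.
pose xi := level_inj (unvec w).
have sqf (u : 'rV[R[i]]_(D k)) : sqn (u *m f) = sqn u.
  by rewrite /sqn !dotmxE trmx_mul map_mxM mulmxA mulmxtVK.
have := Sc (strong_sum (@jordan_op) xi - 2^-1 *: xi); rewrite e.
rewrite (strong_sum_inj _ Sx).
have -> : level_inj (@jordan_op n (unvec w)) - 2^-1 *: xi =
    level_inj (unvec (geom_row (D k) *m (shift_mx (D k) - (2^-1)%:M) *m f)).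
  apply: level_ext => p; rewrite level_projB.
  have [->|pn] := eqVneq p n; last first.
    rewrite !level_proj_neq//; apply: val_inj; apply/funext => t /=.
    by rewrite -[LHS]/(0 - 2^-1 * 0 : R[i]) mulr0 subrr.
  rewrite !level_projK; apply: (can_inj vecK).
  rewrite vecB vecZ jordan_op_vec !unvecK /w -(mulmxA _ f) fX.
  by rewrite mulmxBr mulmxBl mul_mx_scalar -scalemxAl mulmxA.
rewrite !l2norm_level_inj => /(l2norm_le_sqn c0).
rewrite !unvecK !sqf => le.
have : (D k)%:R <= ((c ^+ 2)%:C)%C :> R[i].
  apply: le_trans (sqn_geom_row (D k)) (le_trans le _).
  by rewrite ler_piMr ?geom_row_shift// ler0c exprn_ge0.
rewrite -(rmorph_nat (real_complex R)) lecR => le2.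
have := truncnS_gt (c ^+ 2); rewrite -/k => /(le_lt_trans le2).
by rewrite ltr_nat ltnNge deg_gt.
Qed.

End JordanBlocks.

Lemma spectrum_eq_virtually_abelian (R : realType) (d : nat) (G : set (tree_aut d)) :
  (0 < d)%N -> subgroup G -> finitely_generated G ->
  (forall x : level_ops R d, Salg G x ->
    spectrum (strong_sum x) = closure (\bigcup_n spectrum (x n) : set R[i]^o)) ->
  virtually_abelian G.
Proof.
move=> d0 sG fG eqG; apply: contrapT => nva.
have unb k : exists r : @level_irrep R d G, (k < irr_deg r)%N.
  apply: contrapT => nk; apply: nva.
  apply: (@bounded_degrees_virtually_abelian R d G sG k fG) => r.
  by rewrite leqNgt; apply/negP => kr; apply: nk; exists r.
have /boolp.choice[F FP] := unb.
(* Each constituent is chosen of degree larger than the previous one. *)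
pose r := fix r k := if k is k'.+1 then F (irr_deg (r k')) else F 0%N.
have mono k l : (k < l)%N -> (irr_deg (r k) < irr_deg (r l))%N.
  apply: (homo_ltn (f := fun k => irr_deg (r k)) ltn_trans) => i.
  exact: (FP (irr_deg (r i))).
exact: (jordan_op_spectrum sG d0 mono) (eqG _ (jordan_op_Salg sG d0 mono)).
Qed.

Theorem proposition3p5 (R : realType) (d : nat) (G : set (tree_aut d))
    (hd : (2 <= d)%N) (hG : subgroup G) :
  (forall x : level_ops R d, Salg G x -> normal_op (strong_sum x) ->
     spectrum (strong_sum x) =
       closure (\bigcup_n spectrum (x n) : set R[i]^o)) /\
  (finitely_generated G ->
    ((forall x : level_ops R d, Salg G x ->
        spectrum (strong_sum x) =
          closure (\bigcup_n spectrum (x n) : set R[i]^o))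
     <-> virtually_abelian G)).
Proof.
have d0 : (0 < d)%N := ltnW hd.
split=> [x Sx nx|fG]; first exact: normal_spectrum_eq Sx nx.
split=> [eqG|vG x Sx]; first exact: spectrum_eq_virtually_abelian d0 hG fG eqG.
exact: virtually_abelian_spectrum_eq hG vG Sx.
Qed.
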